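(* Let $\Omega\subset\mathbb{R}^3$ be an open bounded contractible polyhedron with Lipschitz boundary, let $r$ be a positive integer, and let $\mathcal{T}_h$ be a member of a regular family of tetrahedral meshes of $\overline{\Omega}$. Consider the discrete eigenvalue problem: find $\lambda_h\in\mathbb{R}$ and $(\mathbf{u}_h,p_h)\in\mathbf{X}_{h,\tau0}\times Y_{h,0}$ such that $\mathbf{u}_h+\nabla p_h\neq\mathbf{0}$ and $$(\nabla\times\mathbf{u}_h,\nabla\times\mathbf{v}_h)=\lambda_h(\mathbf{u}_h+\nabla p_h,\mathbf{v}_h)\quad\forall\,\mathbf{v}_h\in\mathbf{X}_{h,\tau0},\qquad (\mathbf{u}_h+\nabla p_h,\nabla q_h)=0\quad\forall\, q_h\in Y_{h,0},$$ where $\mathbf{X}_{h,\tau0}$ is the continuous vector Lagrange finite element space of order $r$ with vanishing tangential trace and $Y_{h,0}$ is the Lagrange finite element space of order $r+1$ with vanishing trace, both on $\mathcal{T}_h$. Then all eigenvalues $\lambda_h$ of this problem are positive real numbers.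
   Context: $(\cdot,\cdot)$ denotes the inner product of $\mathrm{L}^2(\Omega)$ and of $\mathbf{L}^2(\Omega)=[\mathrm{L}^2(\Omega)]^3$ (real-valued). Contractible means having the homotopy type of a one-point space. $\mathbf{H}_0(\mathbf{curl};\Omega)$ is the space of $\mathbf{v}\in\mathbf{L}^2(\Omega)$ with $\nabla\times\mathbf{v}\in\mathbf{L}^2(\Omega)$ and $\mathbf{v}\times\mathbf{n}=\mathbf{0}$ on $\partial\Omega$, $\mathbf n$ being the unit outward normal. The mesh size is $h=\max_{K\in\mathcal{T}_h}h_K$ with $h_K$ the diameter of $K$; ''regular family'' is meant in the usual finite element sense. $\mathbb{P}_k(K)$ is the space of polynomials of degree at most $k$ on $K$. The finite element spaces are $\mathbf{X}_{h,\tau0}=\{\mathbf{v}_h\in[C(\overline{\Omega})]^3\cap\mathbf{H}_0(\mathbf{curl};\Omega):\mathbf{v}_h|_K\in[\mathbb{P}_r(K)]^3\ \forall K\in\mathcal{T}_h\}$ and $Y_{h,0}=\{q_h\in C(\overline{\Omega}):q_h|_K\in\mathbb{P}_{r+1}(K)\ \forall K\in\mathcal{T}_h,\ q_h=0\text{ on }\partial\Omega\}$. *)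

(* Defs.v *)
From HB Require Import structures.
From mathcomp Require Import all_boot all_order all_algebra.
From mathcomp Require Import all_classical all_reals all_analysis.

Set Implicit Arguments.
Unset Strict Implicit.
Unset Printing Implicit Defensive.

Import Order.TTheory GRing.Theory Num.Theory.
Import numFieldNormedType.Exports.

Local Open Scope classical_set_scope.
Local Open Scope ring_scope.

Section Euclidean.
Variable R : realType.
Implicit Types (x y : 'rV[R]_3) (A : set 'rV[R]_3).

Definition dot x y : R := \sum_(i < 3) x 0 i * y 0 i.

(* The norm `|x| of the library on row vectors is the sup norm: it induces the
   same topology, but diameters and normals need the Euclidean one. *)
Definition enorm x : R := Num.sqrt (dot x x).

(* Indices are computed in 'I_3, that is modulo 3. *)
Definition cross x y : 'rV[R]_3 :=
  \row_(j < 3) (x 0 (j + 1) * y 0 (j + 2) - x 0 (j + 2) * y 0 (j + 1)).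

Definition diam A : R := sup [set enorm (x - y) | x in A & y in A].

Definition inball_diam A : R :=
  sup [set 2 * rho | rho in
    [set rho : R | 0 <= rho /\
       exists c, [set x | enorm (x - c) <= rho] `<=` A]].

End Euclidean.

Section Topology.

Definition homotopic (T U : topologicalType) (R : realType)
    (A : set T) (B : set U) (f g : T -> U) : Prop :=
  exists H : T * R -> U,
    [/\ {within A `*` `[0, 1], continuous H},
        forall x t, A x -> 0 <= t <= 1 -> B (H (x, t)),
        forall x, A x -> H (x, 0) = f x
      & forall x, A x -> H (x, 1) = g x].

Definition homotopy_equivalent (T U : topologicalType) (R : realType)
    (A : set T) (B : set U) : Prop :=
  exists (f : T -> U) (g : U -> T),
    [/\ {within A, continuous f}, {homo f : x / A x >-> B x},
        {within B, continuous g}, {homo g : y / B y >-> A y}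
      & homotopic R A A (g \o f) id /\ homotopic R B B (f \o g) id].

Definition contractible (R : realType) (T : topologicalType) (A : set T) :
    Prop :=
  homotopy_equivalent R A [set (0 : R)].

End Topology.

Section Domain.
Variable R : realType.
Implicit Types (Omega A : set 'rV[R]_3) (x n : 'rV[R]_3).

Definition boundary A : set 'rV[R]_3 := closure A `\` A°.

(* A finite union of finite intersections of closed half-spaces; the trivial
   half-space (a = 0, b = 0) lets all the intersections have n terms. *)
Definition polyhedral A : Prop :=
  exists (m n : nat) (a : 'I_m -> 'I_n -> 'rV[R]_3) (b : 'I_m -> 'I_n -> R),
    A = [set x | exists i, forall j, dot (a i j) x <= b i j].

(* Near each boundary point, in suitable orthonormal coordinates (those of
   x *m Q), Omega is the strict subgraph of a Lipschitz function. *)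
Definition lipschitz_boundary Omega : Prop :=
  forall x, boundary Omega x ->
  exists (Q : 'M[R]_3) (L : R) (gamma : R * R -> R),
    [/\ Q *m Q^T = 1%:M, L.-lipschitz gamma
      & \forall y \near x,
          Omega y <->
          (y *m Q) 0 2 < gamma ((y *m Q) 0 0, (y *m Q) 0 1)].

Definition polyhedron Omega : Prop :=
  [/\ open Omega, bounded_set Omega & polyhedral (closure Omega)].

(* n is the unit outward normal at x: Omega agrees, up to o(|y - x|), with the
   half-space (y - x) . n < 0. On a polyhedron this holds at the points in the
   relative interior of the boundary faces, hence almost everywhere on the
   boundary. *)
Definition outward_normal Omega x n : Prop :=
  [/\ boundary Omega x, enorm n = 1
    & forall eps : R, 0 < eps -> \forall y \near x,
        (dot (y - x) n < - (eps * enorm (y - x)) -> Omega y) /\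
        (eps * enorm (y - x) < dot (y - x) n -> ~ Omega y)].

End Domain.

Section Mesh.
Variable R : realType.
Implicit Types (Omega : set 'rV[R]_3) (K L : 'M[R]_(4, 3)).
Implicit Types (S : {pred 'I_4}) (T : seq 'M[R]_(4, 3)).

(* A tetrahedron is given by the matrix K whose rows are its vertices;
   face K S is the convex hull of the vertices with index in S (it is empty
   for S = pred0). *)
Definition face K S : set 'rV[R]_3 :=
  [set x | exists c : 'I_4 -> R,
     [/\ forall a, 0 <= c a, forall a, a \notin S -> c a = 0,
         \sum_a c a = 1 & x = \sum_a c a *: row a K]].

Definition tetra K : set 'rV[R]_3 := face K predT.

Definition nondegenerate_tetra K : Prop :=
  row_free (\matrix_(i < 3) (row (lift ord0 i) K - row ord0 K)).

(* Two distinct elements meet in a common vertex, edge or triangular face, or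
   not at all. *)
Definition tetrahedral_mesh Omega T : Prop :=
  [/\ closure Omega = \bigcup_(K in [set` T]) tetra K,
      forall K, K \in T -> nondegenerate_tetra K
    & forall K L, K \in T -> L \in T -> K != L ->
        exists S S' : {pred 'I_4},
          [/\ (#|S| < 4)%N, (#|S'| < 4)%N, face K S = face L S'
            & tetra K `&` tetra L = face K S]].

Definition mesh_size T : R :=
  \big[Order.max/0]_(K <- T) diam (tetra K).

(* Regular family in the sense of Ciarlet: the ratios h_K / rho_K are uniformly
   bounded, rho_K being the diameter of the largest ball inscribed in K, and
   the mesh size h takes arbitrarily small values. *)
Definition regular_family Omega (I : Type) (T : I -> seq 'M[R]_(4, 3)) : Prop :=
  [/\ forall i, tetrahedral_mesh Omega (T i),
      exists2 sigma : R, 0 < sigma &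
        forall i K, K \in T i ->
          diam (tetra K) <= sigma * inball_diam (tetra K)
    & forall eps : R, 0 < eps -> exists i, mesh_size (T i) < eps].

End Mesh.

Section L2.
Variable R : realType.
Implicit Types (Omega : set 'rV[R]_3) (f g : 'rV[R]_3 -> R).
Implicit Types (v w : 'rV[R]_3 -> 'rV[R]_3).

(* Row vectors carry no measurable structure in the library, so integrals over
   R^3 are taken over R * R * R with the product Lebesgue measure. *)
Definition pt (t : R * R * R) : 'rV[R]_3 :=
  \row_(j < 3) [:: t.1.1; t.1.2; t.2]`_j.

Definition lebesgue3 :=
  product_measure1
    (product_measure1 (@lebesgue_measure R) (@lebesgue_measure R))
    (@lebesgue_measure R).

Definition L2 Omega f : Prop :=
  measurable_fun (pt @^-1` Omega) (f \o pt) /\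
  lebesgue3.-integrable (pt @^-1` Omega) (EFin \o (fun t => f (pt t) ^+ 2)).

Definition L2v Omega v : Prop := forall j : 'I_3, L2 Omega (fun x => v x 0 j).

Definition ips Omega f g : R :=
  \int[lebesgue3]_(t in pt @^-1` Omega) (f (pt t) * g (pt t)).

Definition ip Omega v w : R :=
  \int[lebesgue3]_(t in pt @^-1` Omega) dot (v (pt t)) (w (pt t)).

End L2.

Section WeakDerivatives.
Variable R : realType.
Implicit Types (Omega : set 'rV[R]_3) (f q : 'rV[R]_3 -> R).
Implicit Types (v w g phi : 'rV[R]_3 -> 'rV[R]_3).

Definition partial (i : 'I_3) f : 'rV[R]_3 -> R :=
  fun x => 'D_(delta_mx 0 i) f x.

Fixpoint Cn (n : nat) f : Prop :=
  if n is m.+1 then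
    continuous f /\
    forall i : 'I_3,
      (forall x, derivable f x (delta_mx 0 i)) /\ Cn m (partial i f)
  else continuous f.

Definition test_field Omega phi : Prop :=
  (forall (n : nat) (j : 'I_3), Cn n (fun x => phi x 0 j)) /\
  exists K : set 'rV[R]_3,
    [/\ compact K, K `<=` Omega & forall x, ~ K x -> phi x = 0].

(* Indices are computed in 'I_3, that is modulo 3. *)
Definition classical_curl phi : 'rV[R]_3 -> 'rV[R]_3 :=
  fun x => \row_(j < 3) (partial (j + 1) (fun y => phi y 0 (j + 2)) x
                         - partial (j + 2) (fun y => phi y 0 (j + 1)) x).

Definition classical_div phi : 'rV[R]_3 -> R :=
  fun x => \sum_(i < 3) partial i (fun y => phi y 0 i) x.

(* w is the distributional curl of v on Omega, and it is square integrable. *)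
Definition is_curl Omega v w : Prop :=
  L2v Omega w /\
  forall phi, test_field Omega phi ->
    ip Omega v (classical_curl phi) = ip Omega w phi.

(* g is the distributional gradient of q on Omega, and it is square
   integrable. *)
Definition is_grad Omega q g : Prop :=
  L2v Omega g /\
  forall phi, test_field Omega phi ->
    ips Omega q (classical_div phi) = - ip Omega g phi.

End WeakDerivatives.

Section FiniteElements.
Variable R : realType.
Implicit Types (Omega A : set 'rV[R]_3) (T : seq 'M[R]_(4, 3)) (r k : nat).
Implicit Types (q p : 'rV[R]_3 -> R) (v u : 'rV[R]_3 -> 'rV[R]_3).

(* q coincides on A with a polynomial of total degree at most k. *)
Definition poly_on k A q : Prop :=
  exists c : nat -> nat -> nat -> R, forall x, A x ->
    q x = \sum_(a < k.+1) \sum_(b < k.+1) \sum_(d < k.+1 | (a + b + d <= k)%N)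
            c a b d * x 0 0 ^+ a * x 0 1 ^+ b * x 0 2 ^+ d.

(* The tangential trace is taken pointwise, which is meaningful for the fields
   that are continuous on closure Omega, the only ones this is used for. *)
Definition H0curl Omega v : Prop :=
  [/\ L2v Omega v, exists w, is_curl Omega v w
    & forall x n, outward_normal Omega x n -> cross (v x) n = 0].

(* Only the values on closure Omega are relevant. *)
Definition X_space Omega T r v : Prop :=
  [/\ {within closure Omega, continuous v}, H0curl Omega v
    & forall K, K \in T ->
        forall j : 'I_3, poly_on r (tetra K) (fun x => v x 0 j)].

Definition Y_space Omega T r q : Prop :=
  [/\ {within closure Omega, continuous q},
      forall K, K \in T -> poly_on r.+1 (tetra K) q
    & forall x, boundary Omega x -> q x = 0].

(* The curls and gradients are determined by u, p, v, q up to null sets, which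
   affect neither the inner products nor the condition u + grad p != 0, to be
   read in L^2(Omega). *)
Definition eigensolution Omega T r (lambda : R) u p : Prop :=
  [/\ X_space Omega T r u, Y_space Omega T r p
    & exists cu gp,
      [/\ is_curl Omega u cu, is_grad Omega p gp,
          ~ {ae @lebesgue3 R, forall t,
               Omega (pt t) -> u (pt t) + gp (pt t) = 0},
          forall v cv, X_space Omega T r v -> is_curl Omega v cv ->
            ip Omega cu cv = lambda * ip Omega (fun x => u x + gp x) v
        & forall q gq, Y_space Omega T r q -> is_grad Omega q gq ->
            ip Omega (fun x => u x + gp x) gq = 0]].

Definition discrete_eigenvalue Omega T r (lambda : R) : Prop :=
  exists u p, eigensolution Omega T r lambda u p.

End FiniteElements.

(* Main.v *)
Require Import Defs.
From HB Require Import structures.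
From mathcomp Require Import all_boot all_order all_algebra.
From mathcomp Require Import all_classical all_reals all_analysis.
From mathcomp Require Import measurable_realfun ring lra.

(** Let w = u + grad p be an eigenfunction and suppose that lambda <= 0. Testing
    the first equation with u, and the second with p, gives
    (curl u, curl u) = lambda (w, u) = lambda (w, w), so both sides vanish and
    curl u = 0. The point is then that u is a gradient of the discrete space:
    if u = grad q with q in Y_h, the second equation says that w is orthogonal
    to u and to grad p, hence w = 0, which is excluded.

    So it has to be shown that a curl-free u in X_h is grad q for a continuous q
    that is polynomial of degree r + 1 on each element and zero on the boundary
    ([discrete_potential]).

    On an element u is polynomial. Its weak curl is zero, so its polynomial curl
    is zero ([curl_free_peval]) and u is the gradient of a polynomial there
    ([element_potential]).

    Extend u by zero to the whole space. The extension still has primitives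
    locally ([increment_cocycle]). Inside, this is because the potentials of
    two elements have the same increments along segments contained in both
    ([psi_agree]). At a boundary point z it is because the closure of the domain
    is locally a cone ([cone_at]): a segment from z to a nearby boundary point
    stays in the boundary, and u, being normal to the boundary, is orthogonal to
    it ([tangential_on_frontier]). Unit normals are available only at regular
    boundary points; these are dense ([regular_point]), and near the interior of
    the segment the boundary is invariant under translations along it
    ([translation_invariant]), so continuity of u suffices.

    Since cubes are simply connected, local primitives glue to a primitive f on
    a large cube, by repeated halving ([primitive_on_cube]). In Omega the
    gradient of f is u, and outside Omega f is locally constant. It remains to
    see that f takes a single value outside Omega, which is then subtracted.
    This is where contractibility enters ([constant_outside]): if f takes two
    values outside Omega, at a point y and far away, a band of level sets of f
    lies in Omega and separates y from infinity, and running the contraction of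
    Omega across this band deforms the field x - y, fixed near infinity, into a
    field without zeros. That is impossible by the Poincare-Miranda theorem
    ([poincare_miranda]), which is obtained from a discrete degree: a sum over a
    grid of cup products of three coboundaries, computed by telescoping on the
    faces ([discrete_degree]).

    Finally, f is differentiable in Omega with continuous partial derivatives,
    and integration by parts shows that u is its weak gradient
    ([is_grad_of_partials]). *)

Set Implicit Arguments.
Unset Strict Implicit.
Unset Printing Implicit Defensive.

Import Order.TTheory GRing.Theory Num.Theory.
Import numFieldNormedType.Exports.

Local Open Scope classical_set_scope.
Local Open Scope ring_scope.

(** * Coordinates of points of R^3 *)

Section Coordinates.
Variable R : realType.
Implicit Types (x y z : 'rV[R]_3).

Lemma ord3_ind (P : 'I_3 -> Prop) : P 0 -> P 1 -> P 2 -> forall j, P j.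
Proof.
move=> h0 h1 h2; case=> [[|[|[|//]]] hj].
- by rewrite (_ : Ordinal hj = 0)//; exact: val_inj.
- by rewrite (_ : Ordinal hj = 1)//; exact: val_inj.
- by rewrite (_ : Ordinal hj = 2)//; exact: val_inj.
Qed.

Lemma ord3_add : ((0 + 1 : 'I_3) = 1) * ((0 + 2 : 'I_3) = 2) *
  ((1 + 1 : 'I_3) = 2) * ((1 + 2 : 'I_3) = 0) *
  ((2 + 1 : 'I_3) = 0) * ((2 + 2 : 'I_3) = 1).
Proof. by do !split; exact: val_inj. Qed.

Lemma sum3 (V : nmodType) (F : 'I_3 -> V) :
  \sum_(i < 3) F i = F 0 + F 1 + F 2.
Proof.
rewrite !big_ord_recl big_ord0 addr0 addrA.
by congr (F _ + F _ + F _); exact: val_inj.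
Qed.

Lemma row3P x y : x 0 0 = y 0 0 -> x 0 1 = y 0 1 -> x 0 2 = y 0 2 -> x = y.
Proof. by move=> h0 h1 h2; apply/rowP; exact: ord3_ind. Qed.

Lemma ptE (a b c : R) :
  (pt (a, b, c) 0 0 = a) * (pt (a, b, c) 0 1 = b) * (pt (a, b, c) 0 2 = c).
Proof. by rewrite !mxE. Qed.

Lemma dot3 x y : dot x y = x 0 0 * y 0 0 + x 0 1 * y 0 1 + x 0 2 * y 0 2.
Proof. exact: sum3. Qed.

Lemma near_coordP x (P : set 'rV[R]_3) :
  (\forall y \near x, P y) <->
  exists2 e : R, 0 < e & forall y, (forall j, `|y 0 j - x 0 j| < e) -> P y.
Proof.
split=> [/nbhs_ballP[e /= e0 h]|[e e0 h]].
  exists e => // y hy; apply: h; split=> // i j; rewrite (ord1 i).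
  by rewrite /ball/= distrC hy.
apply/nbhs_ballP; exists e => //= y [_ hy]; apply: h => j.
by have := hy 0 j; rewrite /ball/= distrC.
Qed.

Definition cube (M : R) : set 'rV[R]_3 := [set x | forall j, `|x 0 j| <= M].

Lemma compact_cube M : compact (cube M).
Proof.
have -> : cube M = [set x | forall j, `[(- M), M]%classic (x 0 j)].
  by apply/seteqP; split=> x /= h j; have := h j; rewrite in_itv/= ler_norml.
apply: (@rV_compact R 3 (fun=> `[(- M), M]%classic)) => _.
exact: segment_compact.
Qed.

Lemma near_ball x (e : R) : 0 < e ->
  nbhs x [set y : 'rV[R]_3 | forall j, `|y 0 j - x 0 j| < e].
Proof. by move=> e0; apply: (near_coordP _ _).2; exists e. Qed.

Lemma open_sup_ball x (e : R) : open [set y : 'rV[R]_3 | forall j, `|y 0 j - x 0 j| < e].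
Proof.
rewrite openE => y /= hy; apply/near_coordP.
pose d := Num.min (e - `|y 0 0 - x 0 0|)
  (Num.min (e - `|y 0 1 - x 0 1|) (e - `|y 0 2 - x 0 2|)).
exists d => [|z hz j].
  by rewrite !lt_min !subr_gt0 !hy.
rewrite -(subrKA (y 0 j)) (le_lt_trans (ler_normD _ _))// -ltrBrDr.
apply: (lt_le_trans (hz j)); rewrite /d !ge_min.
by move: j {hz}; apply: ord3_ind; rewrite lexx ?orbT.
Qed.

(** Lebesgue's number lemma, with a property of points and scales in the place
    of an open cover. *)
Lemma lebesgue_number (K : set 'rV[R]_3) (P : 'rV[R]_3 -> R -> Prop) :
  compact K ->
  (forall z, K z -> exists2 e : R, 0 < e & forall x d,
     (forall j, `|x 0 j - z 0 j| < e) -> 0 < d -> d < e -> P x d) ->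
  exists2 d : R, 0 < d & forall x, K x -> P x d.
Proof.
move=> /compact_near_coveringP cK hK.
have := cK R (0:R)^'+ (fun d x => P x d) _.
move=> /(_ _)[].
  move=> z /hK[e e0 h].
  exists ([set x : 'rV[R]_3 | forall j, `|x 0 j - z 0 j| < e],
    [set d : R | 0 < d < e]).
    split; first exact: near_ball.
    by near=> d => /=; apply/andP; split; near: d;
      [exact: nbhs_right_gt|exact: nbhs_right_lt].
  by move=> [x d] [/= hx /andP[d0 de]]; exact: h.
move=> e /= e0 h; exists (e / 2); first by rewrite divr_gt0.
apply: h => /=; last by rewrite divr_gt0.
by rewrite sub0r normrN gtr0_norm ?divr_gt0// ltr_pdivrMr// ltr_pMr// ltr1n.
Unshelve. all: by end_near. Qed.
End Coordinates.

(** * The Poincare-Miranda theorem from a discrete degree *)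

Section DiscreteDegree.
Variable A : comPzRingType.
Implicit Types f a b c : nat -> nat -> nat -> A.

(** Functions on the grid are 0-cochains of the cubical complex of Z^3; dif1,
    dif2 and dif3 are the components of their coboundary. *)
Definition dif1 f i j k := f i.+1 j k - f i j k.
Definition dif2 f i j k := f i j.+1 k - f i j k.
Definition dif3 f i j k := f i j k.+1 - f i j k.

(** The components, on the squares orthogonal to each axis, of the cup product
    of the coboundaries of b and c. As in the cubical cup product, the first
    factor is read on the front edge and the second on the opposite back edge:
    this shift is what makes the Leibniz rule exact on a grid. *)
Definition cup1 b c i j k :=
  dif2 b i j k * dif3 c i j.+1 k - dif3 b i j k * dif2 c i j k.+1.
Definition cup2 b c i j k :=
  dif3 b i j k * dif1 c i j k.+1 - dif1 b i j k * dif3 c i.+1 j k.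
Definition cup3 b c i j k :=
  dif1 b i j k * dif2 c i.+1 j k - dif2 b i j k * dif1 c i j.+1 k.

(** The triple cup product of the coboundaries of a, b and c, a discrete
    Jacobian determinant. *)
Definition cup a b c i j k :=
  dif1 a i j k * cup1 b c i.+1 j k + dif2 a i j k * cup2 b c i j.+1 k
  + dif3 a i j k * cup3 b c i j k.+1.

(** Coboundaries are cocycles, so the cup product of three of them is the
    coboundary of a times the product of the other two. *)
Lemma cup_coboundary a b c i j k : cup a b c i j k =
  dif1 (fun i j k => a i j k * cup1 b c i j k) i j k +
  dif2 (fun i j k => a i j k * cup2 b c i j k) i j k +
  dif3 (fun i j k => a i j k * cup3 b c i j k) i j k.
Proof. rewrite /cup /cup1 /cup2 /cup3 /dif1 /dif2 /dif3; ring. Qed.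

Lemma sum_dif n (g : nat -> A) : \sum_(i < n) (g i.+1 - g i) = g n - g 0%N.
Proof.
by rewrite -(big_mkord xpredT (fun i => g i.+1 - g i)) telescope_sumr.
Qed.

(** By [cup_coboundary] the sum telescopes to the faces of the cube. On each
    face orthogonal to the second or the third axis b or c is constant, which
    kills the product; among the two others only the face where a = 1 counts.
    What remains there is a sum of the same kind in dimension two, then in
    dimension one, where c increases from 0 to 1. *)
Lemma discrete_degree n a b c :
  (forall j k, (j <= n)%N -> (k <= n)%N -> a 0%N j k = 0 /\ a n j k = 1) ->
  (forall i k, (i <= n)%N -> (k <= n)%N -> b i 0%N k = 0 /\ b i n k = 1) ->
  (forall i j, (i <= n)%N -> (j <= n)%N -> c i j 0%N = 0 /\ c i j n = 1) ->
  \sum_(i < n) \sum_(j < n) \sum_(k < n) cup a b c i j k = 1.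
Proof.
move=> ha hb hc.
have n0 (i : 'I_n) : (i <= n)%N by exact: ltnW.
have a0 j k : (j <= n)%N -> (k <= n)%N -> a 0%N j k = 0.
  by move=> hj hk; case: (ha j k hj hk).
have a1 j k : (j <= n)%N -> (k <= n)%N -> a n j k = 1.
  by move=> hj hk; case: (ha j k hj hk).
have b0 i k : (i <= n)%N -> (k <= n)%N -> b i 0%N k = 0.
  by move=> hi hk; case: (hb i k hi hk).
have b1 i k : (i <= n)%N -> (k <= n)%N -> b i n k = 1.
  by move=> hi hk; case: (hb i k hi hk).
have c0 i j : (i <= n)%N -> (j <= n)%N -> c i j 0%N = 0.
  by move=> hi hj; case: (hc i j hi hj).
have c1 i j : (i <= n)%N -> (j <= n)%N -> c i j n = 1.
  by move=> hi hj; case: (hc i j hi hj).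
pose S f : A := \sum_(i < n) \sum_(j < n) \sum_(k < n) f i j k.
rewrite -/(S (cup a b c)).
have -> : S (cup a b c) = S (dif1 (fun i j k => a i j k * cup1 b c i j k)) +
    S (dif2 (fun i j k => a i j k * cup2 b c i j k)) +
    S (dif3 (fun i j k => a i j k * cup3 b c i j k)).
  rewrite -!big_split; apply: eq_bigr => i _; rewrite -!big_split.
  apply: eq_bigr => j _; rewrite -!big_split; apply: eq_bigr => k _.
  exact: cup_coboundary.
rewrite /S {S}.
have -> : \sum_(i < n) \sum_(j < n) \sum_(k < n)
    dif3 (fun i j k => a i j k * cup3 b c i j k) i j k = 0.
  apply: big1 => i _; apply: big1 => j _; rewrite sum_dif/= /cup3 /dif1 /dif2.
  rewrite !(c0, c1) ?ltn_ord ?n0//.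
  ring.
have -> : \sum_(i < n) \sum_(j < n) \sum_(k < n)
    dif2 (fun i j k => a i j k * cup2 b c i j k) i j k = 0.
  apply: big1 => i _; rewrite exchange_big/=; apply: big1 => k _.
  rewrite (sum_dif _ (fun j => a i j k * cup2 b c i j k))/= /cup2 /dif1 /dif3.
  rewrite !(b0, b1) ?ltn_ord ?n0//.
  ring.
rewrite !addr0 exchange_big/=; under eq_bigr => j _ do rewrite exchange_big/=.
transitivity (\sum_(j < n) \sum_(k < n)
   (dif2 (fun i j k => b i j k * dif3 c i j k) n j k
    - dif3 (fun i j k => b i j k * dif2 c i j k) n j k)).
  apply: eq_bigr => j _; apply: eq_bigr => k _.
  rewrite (sum_dif _ (fun i => a i j k * cup1 b c i j k))/= !(a0, a1) ?ltn_ord ?n0//.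
  rewrite /cup1 /dif2 /dif3; ring.
under eq_bigr => j _ do rewrite big_split/= sumrN.
rewrite big_split/=.
rewrite [X in _ + X]big1 ?addr0; last first.
  move=> j _; rewrite sum_dif/= /dif2 !(c0, c1) ?ltn_ord ?n0//; ring.
rewrite exchange_big/=.
transitivity (\sum_(k < n) dif3 c n n k).
  apply: eq_bigr => k _; rewrite (sum_dif _ (fun j => b n j k * dif3 c n j k))/=.
  by rewrite !(b0, b1) ?n0//; ring.
by rewrite sum_dif/= !(c0, c1)//; ring.
Qed.
End DiscreteDegree.

Definition constant_on_cell (a : nat -> nat -> nat -> bool) i j k :=
  forall e1 e2 e3 : bool, a (i + e1)%N (j + e2)%N (k + e3)%N = a i j k.

(** On a cell where one of the three functions is constant the cup product
    vanishes; since the products sum to 1, they cannot all vanish. *)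
Lemma discrete_miranda n (a b c : nat -> nat -> nat -> bool) :
  (forall j k, (j <= n)%N -> (k <= n)%N -> ~~ a 0%N j k /\ a n j k) ->
  (forall i k, (i <= n)%N -> (k <= n)%N -> ~~ b i 0%N k /\ b i n k) ->
  (forall i j, (i <= n)%N -> (j <= n)%N -> ~~ c i j 0%N /\ c i j n) ->
  exists i j k, [/\ (i < n)%N, (j < n)%N & (k < n)%N] /\
    [/\ ~ constant_on_cell a i j k, ~ constant_on_cell b i j k
      & ~ constant_on_cell c i j k].
Proof.
move=> ha hb hc; apply: contrapT => hno.
pose z (f : nat -> nat -> nat -> bool) i j k : int := (f i j k)%:R.
have := @discrete_degree int n (z a) (z b) (z c).
rewrite big1 => [H|i _].
  suff /eqP : 0 = 1 :> int by [].
  apply: H => i j hi hj; rewrite /z.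
  - by have [/negbTE-> ->] := ha _ _ hi hj.
  - by have [/negbTE-> ->] := hb _ _ hi hj.
  - by have [/negbTE-> ->] := hc _ _ hi hj.
apply: big1 => j _; apply: big1 => k _.
rewrite /cup /cup1 /cup2 /cup3 /dif1 /dif2 /dif3.
have cst f : constant_on_cell f i j k ->
   (z f i j k.+1 = z f i j k) * (z f i j.+1 k = z f i j k) *
   (z f i j.+1 k.+1 = z f i j k) * (z f i.+1 j k = z f i j k) *
   (z f i.+1 j k.+1 = z f i j k) * (z f i.+1 j.+1 k = z f i j k) *
   (z f i.+1 j.+1 k.+1 = z f i j k).
  move=> h; move: (h false false true) (h false true false)
   (h false true true) (h true false false) (h true false true)
   (h true true false) (h true true true).
  by rewrite /z !addn0 !addn1 => -> -> -> -> -> -> ->.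
have [/cst ca|na] := pselect (constant_on_cell a i j k); first by rewrite !ca; ring.
have [/cst cb|nb] := pselect (constant_on_cell b i j k); first by rewrite !cb; ring.
have [/cst cc|nc] := pselect (constant_on_cell c i j k); first by rewrite !cc; ring.
by exfalso; apply: hno; exists i, j, k.
Qed.

Section Miranda.
Variable R : realType.

(** Here p j tells the sign of the j-th component of a field, and the conclusion
    provides a point near which no component keeps its sign: for a continuous
    field it is a zero. Otherwise some p j is constant on each cell of a fine
    enough grid, against [discrete_miranda]. *)
Lemma poincare_miranda (M : R) (p : 'I_3 -> 'rV[R]_3 -> bool) : 0 < M ->
  (forall j x, cube M x -> x 0 j = - M -> ~~ p j x) ->
  (forall j x, cube M x -> x 0 j = M -> p j x) ->
  exists2 z, cube M z &
    forall j, ~ (\forall x \near z, cube M x -> p j x = p j z).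
Proof.
move=> M0 pN pP; apply: contrapT => hno.
pose P (x : 'rV[R]_3) d := exists j, forall y,
  cube M y -> (forall i, `|y 0 i - x 0 i| < d) -> p j y = p j x.
have [z Mz|d d0 hd] := @lebesgue_number R (cube M) (fun x d => cube M x -> P x d)
    (@compact_cube R M).
  have [j /near_coordP[e e0 he]] :
      exists j, \forall x \near z, cube M x -> p j x = p j z.
    apply: contrapT => hz; apply: hno; exists z => // j hj.
    by apply: hz; exists j.
  exists (e / 2); first by rewrite divr_gt0.
  move=> x d hx d0 de Mx; exists j => y My hy.
  rewrite (he x) ?(he y)// => i.
    have := hx i; have := hy i => h1 h2.
    rewrite -(subrKA (x 0 i)) (le_lt_trans (ler_normD _ _))//.
    by rewrite [e]splitr ltrD// (lt_trans h1).
  by rewrite (lt_le_trans (hx i))// ler_pdivrMr// ler_pMr// ler1n.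
(* n subdivisions of [-M, M] give cells of side 2 M / n < d. *)
pose n := (Num.truncn (2 * M / d)).+1.
have n0 : (0 : R) < n%:R by rewrite ltr0n.
have hn : 2 * M / n%:R < d.
  rewrite ltr_pdivrMr// -ltr_pdivrMl// [d^-1 * _]mulrC.
  exact: truncnS_gt.
pose g (i : nat) : R := - M + 2 * M / n%:R * i%:R.
have g0 : g 0%N = - M by rewrite /g mulr0 addr0.
have gn : g n = M by rewrite /g mulfVK ?gt_eqF//; ring.
have gM i : (i <= n)%N -> `|g i| <= M.
  move=> hi; have h0 : 0 <= 2 * M / n%:R by rewrite divr_ge0// mulr_ge0// ltW.
  rewrite ler_norml; apply/andP; split; first by rewrite /g lerDl mulr_ge0.
  by rewrite -gn /g lerD2l ler_wpM2l// ler_nat.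
pose G i j k : 'rV[R]_3 := pt (g i, g j, g k).
have GM i j k : (i <= n)%N -> (j <= n)%N -> (k <= n)%N -> cube M (G i j k).
  by move=> hi hj hk; apply: ord3_ind; rewrite ptE; exact: gM.
have [i [j [k [[hi hj hk] [ha hb hc]]]]] := @discrete_miranda n
  (fun i j k => p 0 (G i j k)) (fun i j k => p 1 (G i j k))
  (fun i j k => p 2 (G i j k))
  (fun j k hj hk => conj (pN 0 (G 0%N j k) (GM _ _ _ (leq0n _) hj hk)
       (etrans (ptE _ _ _).1.1 g0))
     (pP 0 (G n j k) (GM _ _ _ (leqnn _) hj hk) (etrans (ptE _ _ _).1.1 gn)))
  (fun i k hi hk => conj (pN 1 (G i 0%N k) (GM _ _ _ hi (leq0n _) hk)
       (etrans (ptE _ _ _).1.2 g0))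
     (pP 1 (G i n k) (GM _ _ _ hi (leqnn _) hk) (etrans (ptE _ _ _).1.2 gn)))
  (fun i j hi hj => conj (pN 2 (G i j 0%N) (GM _ _ _ hi hj (leq0n _))
       (etrans (ptE _ _ _).2 g0))
     (pP 2 (G i j n) (GM _ _ _ hi hj (leqnn _)) (etrans (ptE _ _ _).2 gn))).
have gd m (e : bool) : `|g (m + e)%N - g m| < d.
  rewrite /g opprD addrACA subrr add0r -mulrBr natrD addrAC subrr add0r.
  case: e; rewrite ?mulr0 ?normr0// mulr1 ger0_norm//.
  by rewrite divr_ge0// mulr_ge0// ltW.
have le1 (m : nat) (e : bool) : (m < n -> m + e <= n)%N.
  by case: e; rewrite ?addn1 ?addn0 => // /ltnW.
have GG : cube M (G i j k) by apply: GM; exact: ltnW.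
have [q hq] := hd _ GG GG.
have {}hq : constant_on_cell (fun i j k => p q (G i j k)) i j k.
  move=> e1 e2 e3; apply: hq; first by apply: GM; exact: le1.
  by apply: ord3_ind; rewrite !ptE; exact: gd.
move: q hq; apply: ord3_ind => //.
Qed.
End Miranda.

(** * Primitives of closed increments *)

Section LocallyConstant.
Variable R : realType.

(** The indicator function of k t = k 0 is continuous with values 0 and 1, so
    it cannot change. With Prop as codomain this says that a segment which
    leaves a set meets the boundary of that set. *)
Lemma locally_constant_segment (T : Type) (k : R -> T) :
  (forall t : R, 0 <= t <= 1 -> \forall s \near t, 0 <= s <= 1 -> k s = k t) ->
  k 1 = k 0.
Proof.
move=> hk; apply: contrapT => k10.
pose g (t : R) : R := (`[< k t = k 0 >])%:R.
have gc : {within `[0, 1], continuous g}.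
  apply/subspace_continuousP => t; rewrite /= in_itv/= => ht.
  apply: cvg_near_cst; rewrite near_withinE.
  have := hk t ht; apply: filterS => s hs; rewrite /= in_itv/= => hs1.
  by rewrite /from_subspace /g (hs hs1).
have : Num.min (g 0) (g 1) <= 2^-1 <= Num.max (g 0) (g 1).
  rewrite /g (asboolT erefl) (asboolF k10) /= min_r ?ler01// max_l ?ler01//.
  by rewrite invr_ge0 ler0n/= invf_le1// ler1n.
move=> /(IVT ler01 gc)[c _]; rewrite /g.
have h2 : (2^-1 : R) < 1 by rewrite invf_lt1// ltr1n.
have h0 : (0 : R) < 2^-1 by rewrite invr_gt0.
by case: `[< _ >] => /= h; move: h2 h0; rewrite -h ltxx.
Qed.

Definition convex_set (S : set 'rV[R]_3) := forall x y t,
  S x -> S y -> 0 <= t <= 1 -> S (x + t *: (y - x)).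

Lemma segment_cvg (x y : 'rV[R]_3) (t : R) (P : set 'rV[R]_3) :
  (\forall u \near x + t *: (y - x), P u) ->
  \forall s \near t, P (x + s *: (y - x)).
Proof.
move=> h; have : (fun s : R => x + s *: (y - x)) @ t --> x + t *: (y - x).
  by apply: cvgD; [exact: cvg_cst|apply: cvgZr_tmp; exact: cvg_id].
exact.
Qed.

Lemma locally_constant_convex (T : Type) (S : set 'rV[R]_3)
    (k : 'rV[R]_3 -> T) : convex_set S ->
  (forall z, S z -> \forall x \near z, S x -> k x = k z) ->
  forall x y, S x -> S y -> k x = k y.
Proof.
move=> cS hk x y Sx Sy.
have := @locally_constant_segment T (fun t => k (x + t *: (y - x))).
rewrite scale1r scale0r addr0 [x + (y - x)]addrC subrK => -> // t ht.
have /segment_cvg := hk _ (cS _ _ _ Sx Sy ht).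
by apply: filterS => s hs hs1; apply: hs; exact: cS.
Qed.
End LocallyConstant.

Section Monodromy.
Variables (R : realType) (D : 'rV[R]_3 -> 'rV[R]_3 -> R).
Implicit Types (f : 'rV[R]_3 -> R) (B : set 'rV[R]_3) (a b x z : 'rV[R]_3).

(** D z x stands for the integral of a closed 1-form along the short segment
    from z to x; only its values for x close to z matter. *)
Definition primitive B f :=
  forall z, B z -> \forall x \near z, B x -> f x - f z = D z x.

Lemma primitive_sub B B' f : B' `<=` B -> primitive B f -> primitive B' f.
Proof.
move=> sB hf z /sB /hf; apply: filterS => x + /sB; exact.
Qed.

Lemma primitive_unique B f g : convex_set B -> primitive B f ->
  primitive B g -> exists c, forall x, B x -> f x = g x + c.
Proof.
move=> cB hf hg; have [[x0 Bx0]|/forallNP nB] := pselect (exists x, B x).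
  exists (f x0 - g x0) => x Bx.
  suff <- : f x - g x = f x0 - g x0 by rewrite addrC subrK.
  apply: (locally_constant_convex (k := fun x => f x - g x) cB) => // z Bz.
  near=> u => Bu.
  have h1 : f u - f z = D z u by move: Bu; near: u; exact: hf.
  have h2 : g u - g z = D z u by move: Bu; near: u; exact: hg.
  by move: h1 h2 => /=; lra.
by exists 0 => x /nB.
Unshelve. all: by end_near. Qed.

(** On the convex intersection the two primitives differ by a constant, which is
    added to the second one. *)
Lemma primitive_glue B1 B2 f1 f2 : closed B1 -> closed B2 ->
  convex_set (B1 `&` B2) -> primitive B1 f1 -> primitive B2 f2 ->
  exists f, primitive (B1 `|` B2) f.
Proof.
move=> cl1 cl2 cv h1 h2.
have [c hc] := primitive_unique cv
  (primitive_sub (@subIsetl _ B1 B2) h1) (primitive_sub (@subIsetr _ B1 B2) h2).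
exists (fun x => if x \in B1 then f1 x else f2 x + c).
have e2 x : B2 x -> (if x \in B1 then f1 x else f2 x + c) = f2 x + c.
  by move=> Bx; case: ifPn => // /set_mem B1x; rewrite hc.
move=> z [] Bz.
  have [B2z|nB2] := pselect (B2 z).
    near=> x => -[] Bx; last rewrite !e2//.
      rewrite !mem_set//; move: Bx; near: x; exact: h1.
    rewrite opprD addrACA subrr addr0; move: Bx; near: x; exact: h2.
  have : \forall x \near z, ~ B2 x.
    exact: (open_nbhs_nbhs (conj (closed_openC cl2) nB2)).
  move=> ?; near=> x => -[] Bx; last by exfalso; move: Bx; near: x.
  rewrite !mem_set//; move: Bx; near: x; exact: h1.
have [B1z|nB1] := pselect (B1 z).
  near=> x => -[] Bx; last rewrite !e2//.
    rewrite !mem_set//; move: Bx; near: x; exact: h1.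
  rewrite opprD addrACA subrr addr0; move: Bx; near: x; exact: h2.
have : \forall x \near z, ~ B1 x.
  exact: (open_nbhs_nbhs (conj (closed_openC cl1) nB1)).
move=> ?; near=> x => -[] Bx; first by exfalso; move: Bx; near: x.
rewrite !e2// opprD addrACA subrr addr0; move: Bx; near: x; exact: h2.
Unshelve. all: by end_near. Qed.

Definition box a b : set 'rV[R]_3 := [set x | forall j, a 0 j <= x 0 j <= b 0 j].

Lemma closed_box a b : closed (box a b).
Proof.
have -> : box a b = \bigcap_(j in [set: 'I_3])
    ((fun x : 'rV[R]_3 => x 0 j) @^-1` `[a 0 j, b 0 j]).
  apply/seteqP; split=> x h j; [move=> _|]; have := h j;
    rewrite /= in_itv//=; exact.
apply: closed_bigI => j _; apply: closed_comp; last exact: itv_closed.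
by move=> x _; exact: coord_continuous.
Qed.

Lemma convex_box a b : convex_set (box a b).
Proof.
move=> x y t hx hy /andP[t0 t1] j; rewrite !mxE.
have /andP[] := hx j; have /andP[] := hy j; move=> *; apply/andP; split; nra.
Qed.

(** The increments of a closed form add up along small triangles. *)
Hypothesis D_cocycle : forall z, \forall x \near z, \forall y \near x,
  D z y - D z x = D x y.

(** A discrete Poincare lemma. Around each point D itself provides a primitive,
    hence by compactness there is one on every box of side d; gluing two halves
    doubles a side, and finitely many doublings reach the cube. *)
Lemma primitive_on_cube M : exists f, primitive (cube M) f.
Proof.
pose P x (d : R) := exists f, primitive [set y | forall j, `|y 0 j - x 0 j| <= d] f.
have [z _|d d0 hd] := @lebesgue_number R (cube M) P (@compact_cube R M).
  have /near_coordP[e e0 he] := D_cocycle z.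
  exists (e / 2); first by rewrite divr_gt0.
  move=> x d hx d0 de; exists (D z) => y hy.
  have hz : forall j, `|y 0 j - z 0 j| < e.
    move=> j; rewrite -(subrKA (x 0 j)) (le_lt_trans (ler_normD _ _))//.
    rewrite [e]splitr ltrD// (le_lt_trans (hy j))//.
  by have := he _ hz; apply: filterS => u hu _.
pose H (L : 'I_3 -> R) := forall a b, (forall j, b 0 j - a 0 j <= L j) ->
  box a b `<=` cube M -> exists f, primitive (box a b) f.
have H0 : H (fun=> d).
  move=> a b hab sM; have [[x hx]|/forallNP nB] := pselect (exists x, box a b x).
    have /sM Ma : box a b a.
      by move=> j; have := hx j => /andP[h1 h2]; rewrite lexx (le_trans h1 h2).
    have [f hf] := hd _ Ma; exists f; apply: primitive_sub hf => y hy j /=.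
    have /andP[h1 h2] := hy j.
    by rewrite ger0_norm ?subr_ge0// (le_trans _ (hab j))// lerD2r.
  by exists (fun=> 0) => x /nB.
have HD L j : H L -> H (fun i => if i == j then 2 * L i else L i).
  move=> HL a b hab sM.
  pose m := (a 0 j + b 0 j) / 2.
  have [|hlt] := leP (a 0 j) (b 0 j); last first.
    by exists (fun=> 0) => x /(_ j)/andP[h1 h2]; have := le_trans h1 h2; rewrite leNgt hlt.
  move=> hle.
  have hm : a 0 j <= m <= b 0 j by rewrite /m; apply/andP; split; lra.
  pose b' : 'rV[R]_3 := \row_i if i == j then m else b 0 i.
  pose a' : 'rV[R]_3 := \row_i if i == j then m else a 0 i.
  have sl : box a b' `<=` box a b.
    move=> x hx i; have := hx i; rewrite !mxE; case: eqP => // -> /andP[-> h].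
    by rewrite (le_trans h)//; case/andP: hm.
  have sr : box a' b `<=` box a b.
    move=> x hx i; have := hx i; rewrite !mxE; case: eqP => // -> /andP[h ->].
    by rewrite (le_trans _ h)//; case/andP: hm.
  have [i|f1 hf1] := HL a b' _ (subset_trans sl sM).
    rewrite !mxE; have := hab i; case: eqP => // ->.
    by rewrite /m; lra.
  have [i|f2 hf2] := HL a' b _ (subset_trans sr sM).
    rewrite !mxE; have := hab i; case: eqP => // ->.
    by rewrite /m; lra.
  have [|f hf] := primitive_glue (@closed_box a b') (@closed_box a' b) _ hf1 hf2.
    move=> x y t [x1 x2] [y1 y2] ht; split; exact: convex_box.
  exists f; apply: primitive_sub hf => x hx.
  have [hxm|hxm] := leP (x 0 j) m; [left|right] => i; have := hx i; rewrite !mxE.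
    by case: eqP => // -> /andP[-> _].
  by case: eqP => // -> /andP[_ ->]; rewrite (ltW hxm).
have Hn n : H (fun=> d * 2 ^+ n).
  elim: n => [|n IH].
    by rewrite (_ : (fun _ => _) = fun=> d)//; apply: funext => i; rewrite mulr1.
  have := HD _ 0 (HD _ 1 (HD _ 2 IH)).
  congr H; apply: funext; apply: ord3_ind => /=; rewrite exprS; ring.
pose n := (Num.truncn (2 * M / d)).+1.
have [||f hf] := Hn n (const_mx (- M)) (const_mx M).
- move=> j; rewrite !mxE opprK (_ : M + M = d * (2 * M / d)); last first.
    by field; rewrite gt_eqF.
  rewrite ler_pM2l// (@le_trans _ _ n%:R)//.
    by apply: ltW; exact: truncnS_gt.
  by rewrite -natrX ler_nat ltnW// ltn_expl.
- by move=> x hx j; have := hx j; rewrite !mxE ler_norml.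
exists f; apply: primitive_sub hf => x hx j; have := hx j.
by rewrite !mxE ler_norml.
Qed.
End Monodromy.

(** * Polyhedral sets and their regular frontier points *)

Section Dot.
Variable R : realType.
Implicit Types (x y z d n : 'rV[R]_3) (t : R).

Lemma dotC x y : dot x y = dot y x.
Proof. by rewrite !dot3; ring. Qed.
Lemma dotDr x y z : dot x (y + z) = dot x y + dot x z.
Proof. by rewrite !dot3 !mxE; ring. Qed.
Lemma dotBr x y z : dot x (y - z) = dot x y - dot x z.
Proof. by rewrite !dot3 !mxE; ring. Qed.
Lemma dotZr t x y : dot x (t *: y) = t * dot x y.
Proof. by rewrite !dot3 !mxE; ring. Qed.
Lemma dotZl t x y : dot (t *: x) y = t * dot x y.
Proof. by rewrite !dot3 !mxE; ring. Qed.
Lemma dotBl x y z : dot (x - y) z = dot x z - dot y z.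
Proof. by rewrite !dot3 !mxE; ring. Qed.
Lemma dot0l x : dot 0 x = 0.
Proof. by rewrite dot3 !mxE; ring. Qed.

Lemma dotxx_ge0 x : 0 <= dot x x.
Proof. by rewrite dot3; nra. Qed.

Lemma dotxx_eq0 x : dot x x = 0 -> x = 0.
Proof. by rewrite dot3 => h; apply: row3P; rewrite mxE; nra. Qed.

Lemma dot_continuous x : continuous (dot x).
Proof.
have -> : dot x = fun y => x 0 0 * y 0 0 + x 0 1 * y 0 1 + x 0 2 * y 0 2.
  by apply: funext => y; rewrite dot3.
have c j : continuous (fun y : 'rV[R]_3 => x 0 j * y 0 j).
  move=> y; apply: (@continuousM _ _ (fun=> x 0 j) (fun y : 'rV[R]_3 => y 0 j)).
    exact: cst_continuous.
  exact: coord_continuous.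
move=> y; apply: (@continuousD _ _ _ (fun y => x 0 0 * y 0 0 + x 0 1 * y 0 1)
  (fun y => x 0 2 * y 0 2)); last exact: c.
by apply: (@continuousD _ _ _ (fun y => x 0 0 * y 0 0)
  (fun y => x 0 1 * y 0 1)); exact: c.
Qed.

(** Lagrange's identity. It shows that a field with no tangential component is
    orthogonal to every tangent vector. *)
Lemma dot_cross x z n :
  dot (cross x n) (cross z n) = dot x z * dot n n - dot x n * dot z n.
Proof. by rewrite !dot3 /cross !mxE !ord3_add; ring.
Qed.

(** The planes are avoided one after the other: a point lying on the current
    one is moved off along the normal, within the open set still available. *)
Lemma open_avoid_planes (J : finType) (A : J -> 'rV[R]_3) (B : J -> R)
    (V : set 'rV[R]_3) : open V -> V !=set0 ->
  exists2 q, V q & forall k, A k != 0 -> dot (A k) q != B k.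
Proof.
move=> oV V0.
suff : exists2 W : set 'rV[R]_3, open W /\ W !=set0 & W `<=` V /\
    forall q, W q -> forall k, k \in enum J -> A k != 0 -> dot (A k) q != B k.
  case=> W [_ [q Wq]] [sW h]; exists q; first exact: sW.
  by move=> k; apply: h => //; rewrite mem_enum.
elim: (enum J) => [|k s [W [oW [q Wq]] [sW h]]].
  by exists V; split=> // q _ k; rewrite in_nil.
have [Ak|Ak] := eqVneq (A k) 0.
  exists W; first by split=> //; exists q.
  split=> // x Wx l; rewrite inE => /orP[/eqP ->|]; last exact: h.
  by rewrite Ak eqxx.
exists (W `&` [set x | dot (A k) x != B k]); last first.
  split; first by move=> x [/sW].
  move=> x [Wx /= hx] l; rewrite inE => /orP[/eqP -> //|]; exact: h.
split.
  apply: openI => //.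
  have oh : open (dot (A k) @^-1` [set t : R | t != B k]).
    by apply: open_comp; [move=> x _; exact: dot_continuous|exact: open_neq].
  exact: oh.
have [hq|hq] := eqVneq (dot (A k) q) (B k); last by exists q.
have : \forall t \near (0 : R), W (q + t *: A k).
  have : \forall u \near q + 0 *: ((q + A k) - q), W u.
    by rewrite scale0r addr0; exact: open_nbhs_nbhs.
  by move=> /segment_cvg; rewrite [q + A k]addrC addrK.
move=> /nbhs_ballP[e /= e0 he]; exists (q + (e / 2) *: A k); split => /=.
  apply: he; rewrite /ball/= sub0r normrN gtr0_norm ?divr_gt0//.
  by rewrite ltr_pdivrMr// ltr_pMr// ltr1n.
rewrite dotDr dotZr hq -subr_eq0 addrAC subrr add0r mulf_eq0 negb_or.
rewrite gt_eqF ?divr_gt0//=; apply: contra Ak => /eqP /dotxx_eq0 ->.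
exact: eqxx.
Qed.
End Dot.

Section Polyhedral.
Variables (R : realType) (m n : nat).
Variables (a : 'I_m -> 'I_n -> 'rV[R]_3) (b : 'I_m -> 'I_n -> R).
Implicit Types (x y z p q d : 'rV[R]_3) (t s : R).

Definition constraints : set 'rV[R]_3 :=
  [set x | exists i, forall j, dot (a i j) x <= b i j].
Local Notation C := constraints.

Lemma inactive_near (c : 'rV[R]_3) (e : R) z : dot c z != e ->
  \forall x \near z, (dot c x <= e) = (dot c z <= e).
Proof.
rewrite neq_lt => /orP[h|h].
  have : \forall x \near z, dot c x < e.
    exact: (@dot_continuous R c z _ (open_nbhs_nbhs (conj (@open_lt R e) h))).
  by apply: filterS => x /= hx; rewrite !ltW.
have : \forall x \near z, e < dot c x.
  exact: (@dot_continuous R c z _ (open_nbhs_nbhs (conj (@open_gt R e) h))).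
by apply: filterS => x /= hx; rewrite !leNgt hx h.
Qed.

Lemma near_constraints (P : 'I_m -> 'I_n -> 'rV[R]_3 -> Prop) z :
  (forall i j, \forall x \near z, P i j x) ->
  \forall x \near z, forall i j, P i j x.
Proof.
move=> h.
have h1 i : \forall x \near z, forall j, P i j x.
  exact: (@filter_forall _ _ (fun j (x : 'rV[R]_3) => P i j x) (nbhs z) _ (h i)).
exact: (@filter_forall _ _ (fun i (x : 'rV[R]_3) => forall j, P i j x) (nbhs z) _ h1).
Qed.

Lemma constraints_eq x y :
  (forall i j, (dot (a i j) x <= b i j) = (dot (a i j) y <= b i j)) ->
  C x <-> C y.
Proof.
by move=> h; split=> -[i hi]; exists i => j; move: (hi j); rewrite h.
Qed.

Lemma near_segment z (P : set 'rV[R]_3) : nbhs z P ->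
  \forall x \near z, forall t, 0 <= t <= 1 -> P (z + t *: (x - z)).
Proof.
move=> /near_coordP[e e0 he]; apply/near_coordP; exists e => // x hx t /andP[t0 t1].
apply: he => j; rewrite !mxE addrAC subrr add0r normrM ger0_norm//.
by rewrite (le_lt_trans _ (hx j))// ler_piMl.
Qed.

Lemma near_homothety z x t (P : set 'rV[R]_3) : 0 <= t <= 1 ->
  nbhs (z + t *: (x - z)) P -> \forall u \near x, P (z + t *: (u - z)).
Proof.
move=> /andP[t0 t1] /near_coordP[e e0 he]; apply/near_coordP; exists e => // u hu.
apply: he => j; rewrite (_ : _ - _ = t * (u 0 j - x 0 j)).
  rewrite normrM ger0_norm//.
  by rewrite (le_lt_trans _ (hu j))// ler_piMl.
by rewrite !mxE; ring.
Qed.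

(** Near z the constraints inactive at z keep their truth value, and those
    active at z are homogeneous in x - z. *)
Lemma cone_at z : \forall x \near z, forall t, 0 < t -> t <= 1 ->
  C (z + t *: (x - z)) <-> C x.
Proof.
have : \forall x \near z, forall i j, dot (a i j) z != b i j ->
    (dot (a i j) x <= b i j) = (dot (a i j) z <= b i j).
  apply: near_constraints => i j.
  have [h|h] := eqVneq (dot (a i j) z) (b i j); first by near=> x.
  by have := inactive_near h; apply: filterS.
move=> /near_segment; apply: filterS => x hx t t0 t1.
apply: constraints_eq => i j.
have [h|h] := eqVneq (dot (a i j) z) (b i j); last first.
  rewrite (hx t)//; last by rewrite (ltW t0).
  have := hx 1; rewrite scale1r [z + _]addrC subrK => ->//.
  by rewrite ler01 lexx.
by rewrite dotDr dotZr dotBr -h gerDl pmulr_rle0// subr_le0.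
Unshelve. all: by end_near. Qed.

Definition frontier : set 'rV[R]_3 := [set x | C x /\ ~ nbhs x C].

(** A homothety centred at z maps neighbourhoods of x to neighbourhoods of the
    image of x, so the cone structure of C passes to its frontier. *)
Lemma frontier_cone z : \forall x \near z, frontier z -> frontier x ->
  forall t, 0 <= t <= 1 -> frontier (z + t *: (x - z)).
Proof.
have : \forall x \near z, \forall u \near x, forall t, 0 < t -> t <= 1 ->
  C (z + t *: (u - z)) <-> C u by apply: near_join; exact: cone_at.
apply: filterS => x hx fz [Cx fx] t /andP[].
rewrite le_eqVlt => /orP[/eqP<- _|t0 t1]; first by rewrite scale0r addr0.
split; first by apply/(nbhs_singleton hx).
move=> h; apply: fx.
have : \forall u \near x, C (z + t *: (u - z)).
  by apply: near_homothety h; rewrite ltW.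
apply: filterS2 hx => u hu hCu.
exact/(hu t t0 t1).
Qed.

(** Inside the segment from the apex z to a nearby x, the set is a cone with
    apex y as well as a cone with apex z. A homothety centred at z followed by
    one centred at y of inverse ratio is a translation along y - z, so C is
    invariant under small translations along the segment. *)
Lemma translation_invariant z : \forall x \near z, forall t, 0 < t < 1 ->
  exists2 e : R, 0 < e & forall p s,
    (forall j, `|p 0 j - (z + t *: (x - z)) 0 j| < e) -> 0 < s -> s < e ->
    C (p - s *: (x - z)) <-> C p.
Proof.
have : \forall x \near z, \forall u \near x, forall t, 0 < t -> t <= 1 ->
  C (z + t *: (u - z)) <-> C u by apply: near_join; exact: cone_at.
move=> /near_segment; apply: filterS => x hz t /andP[t0 t1].
set y := z + t *: (x - z).
have ht : 0 <= t <= 1 by rewrite !ltW.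
have /near_coordP[e1 e10 h1] := cone_at y.
have /near_coordP[e2 e20 h2] := hz t ht.
pose S := 1 + `|(x - z) 0 0| + `|(x - z) 0 1| + `|(x - z) 0 2|.
have S0 : 0 < S by rewrite /S -!addrA ltr_pwDl// !addr_ge0.
have dS j : `|(x - z) 0 j| <= S.
  rewrite /S; move: j; apply: ord3_ind; move: (normr_ge0 ((x - z) 0 0))
    (normr_ge0 ((x - z) 0 1)) (normr_ge0 ((x - z) 0 2)); lra.
exists (Num.min e2 (Num.min (e1 / 2) (e1 / 2 / S))).
  by rewrite !lt_min e20 !divr_gt0.
move=> p s hp s0; rewrite !lt_min => /and3P[_ _ s3].
have hs : forall t, 0 < t -> t <= 1 ->
    C (y + t *: (p - s *: (x - z) - y)) <-> C (p - s *: (x - z)).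
  apply: h1 => j; have := hp j; rewrite !lt_min => /and3P[_ hp1 _].
  have -> : (p - s *: (x - z)) 0 j - y 0 j =
      (p 0 j - y 0 j) - s * (x - z) 0 j by rewrite !mxE; ring.
  rewrite (le_lt_trans (ler_normB _ _))// [e1]splitr ltrD//.
  rewrite normrM gtr0_norm// (le_lt_trans (ler_wpM2l (ltW s0) (dS j)))//.
  by rewrite -ltr_pdivlMr.
have hzp : forall t, 0 < t -> t <= 1 -> C (z + t *: (p - z)) <-> C p.
  by apply: h2 => j; have := hp j; rewrite !lt_min => /and3P[].
(* With rho = 1 / (1 + s / t), the homothety of ratio rho centred at y sends
   p - s (x - z) to the image of p under the one centred at z. *)
have st : 0 < 1 + s / t by rewrite ltr_wpDr// divr_ge0// ltW.
have t1' : 0 < (1 + s / t)^-1 by rewrite invr_gt0.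
have t2 : (1 + s / t)^-1 <= 1.
  by rewrite invf_le1// lerDl divr_ge0// ltW.
have <- := hs _ t1' t2; have <- := hzp _ t1' t2.
suff -> : y + (1 + s / t)^-1 *: (p - s *: (x - z) - y) =
          z + (1 + s / t)^-1 *: (p - z) by [].
rewrite /y; apply/rowP => j; rewrite !mxE; field.
by rewrite !gt_eqF ?addr_gt0.
Qed.
End Polyhedral.

Section RegularPoints.
Variables (R : realType) (m n : nat).
Variables (a : 'I_m -> 'I_n -> 'rV[R]_3) (b : 'I_m -> 'I_n -> R).
Local Notation C := (constraints a b).

Lemma convex_ball (y : 'rV[R]_3) (e : R) :
  convex_set [set x : 'rV[R]_3 | forall j, `|x 0 j - y 0 j| < e].
Proof.
move=> x z t /= hx hz /andP[t0 t1] j; rewrite !mxE.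
have := hx j; have := hz j; rewrite !ltr_norml => /andP[z1 z2] /andP[x1 x2].
have [t2|t2] := ltP t 1; last first.
  have -> : t = 1 by apply/eqP; rewrite eq_le t1 t2.
  by rewrite mul1r [x 0 j + _]addrC subrK z1 z2.
by apply/andP; split; nra.
Qed.

(** Near each frontier point there are others around which C is a half-space.
    Join a point p of the interior to a point q of the complement, both close
    to y and in general position: the segment leaves C at a point y' where all
    active constraints share one plane, so that near y' membership in C depends
    only on the side of this plane. The points by which the segment leaves C
    give a side outside C; as C is the closure of an open set it has points
    near y' off the plane, and these give a side inside C. *)
Lemma regular_point (Om : set 'rV[R]_3) (y : 'rV[R]_3) (U : set 'rV[R]_3) :
  open Om -> closure Om = C -> frontier a b y -> nbhs y U ->
  exists y' c, [/\ U y', C y', c != 0 &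
    \forall x \near y', C x <-> dot c (x - y') <= 0].
Proof.
move=> oOm hC [Cy fy] /near_coordP[e e0 he].
pose B := [set x : 'rV[R]_3 | forall j, `|x 0 j - y 0 j| < e].
have nB : nbhs y B° by apply: nbhs_interior; exact: near_ball.
have clC : closed C by rewrite -hC; exact: closed_closure.
have [|p [Op Bp] hp] := @open_avoid_planes R ('I_m * 'I_n)%type
    (fun k => a k.1 k.2) (fun k => b k.1 k.2) (Om `&` B°)
    (openI oOm (@open_interior _ B)).
  by move: Cy; rewrite -hC => /(_ _ nB).
pose al k : R := dot (a k.1 k.2) p - b k.1 k.2.
have alN k : a k.1 k.2 != 0 -> al k != 0 by move=> /hp; rewrite /al subr_eq0.
(* If the segment from p to q meets the planes of two constraints k and l at
   the same point, then q satisfies al k * (a l . q - b l) =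
   al l * (a k . q - b k). When q avoids the planes so defined, this happens
   only if the normals are proportional. *)
have [|q [Cq Bq] hq] := @open_avoid_planes R
    (('I_m * 'I_n) * ('I_m * 'I_n))%type
    (fun k => al k.1 *: a k.2.1 k.2.2 - al k.2 *: a k.1.1 k.1.2)
    (fun k => al k.1 * b k.2.1 k.2.2 - al k.2 * b k.1.1 k.1.2)
    (~` C `&` B°) (openI (closed_openC clC) (@open_interior _ B)).
  apply: contrapT => hno; apply: fy; apply: filterS nB => x Bx.
  by apply: contrapT => Cx; apply: hno; exists x.
pose w t := p + t *: (q - p).
have Cp : C p by rewrite -hC; exact: subset_closure.
have [T [T01 CT hT]] : exists T, [/\ 0 <= T <= 1, C (w T) &
    forall N, nbhs (w T) N -> exists t, N (w t) /\ ~ C (w t)].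
  apply: contrapT => hno.
  have := @locally_constant_segment R Prop (fun t => C (w t)).
  rewrite /w scale1r scale0r addr0 [p + _]addrC subrK => h.
  suff E : C q = C p by apply: Cq; rewrite E.
  apply: h => T T01; have [CT|CT] := pselect (C (w T)); last first.
    have : \forall s \near T, ~ C (w s).
      apply: (@segment_cvg R p q T (~` C)).
      exact: open_nbhs_nbhs (conj (closed_openC clC) CT).
    by apply: filterS => s hs _; apply/propext; split.
  have [N hN] : exists N, nbhs (w T) N /\ forall t, N (w t) -> C (w t).
    apply: contrapT => hno'; apply: hno; exists T; split=> // N hN.
    apply: contrapT => hno2; apply: hno'; exists N; split=> // t Nt.
    by apply: contrapT => Ct; apply: hno2; exists t.
  have := @segment_cvg R p q T N hN.1.
  by apply: filterS => s /hN.2 hs _; apply/propext; split.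
set y' := w T in CT hT.
have By' : B y'.
  by apply: convex_ball T01; exact: interior_subset.
have hin : \forall x \near y', forall i j, dot (a i j) y' != b i j ->
    (dot (a i j) x <= b i j) = (dot (a i j) y' <= b i j).
  apply: near_constraints => i j.
  have [h|h] := eqVneq (dot (a i j) y') (b i j); first by near=> x.
  by have := inactive_near h; apply: filterS.
have [t1 [Nt1 Ct1]] := hT _ hin.
have [k0 [ak0 hk0]] : exists k, a k.1 k.2 != 0 /\ dot (a k.1 k.2) y' = b k.1 k.2.
  apply: contrapT => hno; apply: Ct1.
  apply/(constraints_eq (y := y')) => // i j.
  have [h|h] := eqVneq (dot (a i j) y') (b i j); last exact: Nt1.
  have [a0|a0] := eqVneq (a i j) 0; first by rewrite a0 !dot0l.
  by exfalso; apply: hno; exists (i, j).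
set a0 := a k0.1 k0.2 in ak0 hk0.
have al0 := alN _ ak0.
have T0 : T != 0.
  apply: contra al0 => /eqP T0; rewrite /al -/a0.
  by move: hk0; rewrite /y' /w T0 scale0r addr0 => ->; rewrite subrr.
pose s x := dot a0 (x - y').
(* Each active constraint is a multiple of the linear form s, with a factor
   that does not depend on x. *)
have key i j x : a i j != 0 -> dot (a i j) y' = b i j ->
    dot (a i j) x - b i j = al (i, j) / al k0 * s x.
  move=> aij hij.
  have h0 : al k0 *: a i j = al (i, j) *: a0.
    apply/eqP; rewrite -subr_eq0; apply: contraT => /(hq (k0, (i, j)))/negP[].
    rewrite /= dotBl !dotZl -/a0; move: hk0 hij.
    rewrite /y' /w !dotDr !dotZr !dotBr -/a0 => h1 h2.
    apply/eqP/(mulfI T0)/eqP; rewrite -subr_eq0.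
    have E1 : T * (dot a0 q - b k0.1 k0.2) = - (1 - T) * al k0.
      by rewrite /al -/a0 -h1; ring.
    have E2 : T * (dot (a i j) q - b i j) = - (1 - T) * al (i, j).
      by rewrite /al /= -h2; ring.
    rewrite (_ : _ - _ = al k0 * (T * (dot (a i j) q - b i j))
        - al (i, j) * (T * (dot a0 q - b k0.1 k0.2))); last by ring.
    by rewrite E1 E2; apply/eqP; ring.
  apply: (mulfI al0); rewrite mulrA mulrCA divff// mulr1.
  by rewrite /s -hij -dotBr -!dotZl h0.
have sgC x x' : (forall i j, dot (a i j) y' != b i j ->
      (dot (a i j) x <= b i j) = (dot (a i j) y' <= b i j)) ->
    (forall i j, dot (a i j) y' != b i j ->
      (dot (a i j) x' <= b i j) = (dot (a i j) y' <= b i j)) ->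
    Num.sg (s x) = Num.sg (s x') -> C x <-> C x'.
  move=> hx hx' hs; apply: constraints_eq => i j.
  have [h|h] := eqVneq (dot (a i j) y') (b i j); last by rewrite hx// hx'.
  have [aij|aij] := eqVneq (a i j) 0; first by rewrite aij !dot0l.
  rewrite -[LHS]subr_le0 -[RHS]subr_le0 !key//.
  by rewrite -[LHS]sgr_le0 -[RHS]sgr_le0 !sgrM hs.
have sy' : s y' = 0 by rewrite /s dotBr subrr.
have Ny' : forall i j, dot (a i j) y' != b i j ->
      (dot (a i j) y' <= b i j) = (dot (a i j) y' <= b i j) by [].
have st1 : s (w t1) != 0.
  apply/eqP => h; apply: Ct1; apply/(sgC (w t1) y') => //.
  by rewrite h sy'.
(* A point of Om near y' off the plane; it is in C, so it lies on the side
   opposite to w t1. *)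
have [x [Ox Nx] sx] : exists2 x, (Om `&` [set x | forall i j,
    dot (a i j) y' != b i j ->
    (dot (a i j) x <= b i j) = (dot (a i j) y' <= b i j)]°) x & s x != 0.
  have [|x Vx /(_ tt ak0) hx] := @open_avoid_planes R unit (fun=> a0)
     (fun=> dot a0 y') _ (openI oOm (@open_interior _ [set x | forall i j,
    dot (a i j) y' != b i j ->
    (dot (a i j) x <= b i j) = (dot (a i j) y' <= b i j)])).
    by move: CT; rewrite -hC; apply; exact: nbhs_interior.
  by exists x => //; rewrite /s dotBr subr_eq0.
have {}Nx := interior_subset Nx.
have Cx : C x by rewrite -hC; exact: subset_closure.
have sgx : Num.sg (s x) = - Num.sg (s (w t1)).
  have : Num.sg (s x) != Num.sg (s (w t1)).
    by apply/eqP => h; apply: Ct1; apply/(sgC (w t1) x).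
  case: (sgrP (s x)) sx => // _ _; case: (sgrP (s (w t1))) st1 => // _ _;
   by rewrite ?eqxx ?opprK.
exists y', (Num.sg (s (w t1)) *: a0); split=> //.
- by apply: he.
- by rewrite scaler_eq0 negb_or ak0 sgr_eq0 st1.
apply: filterS hin => z Nz; rewrite dotZl -/(s z).
have [h|h] := eqVneq (Num.sg (s z)) (Num.sg (s (w t1))).
  have nCz : ~ C z by move=> /(sgC z (w t1) Nz Nt1 h).
  split=> // ; rewrite -h -normrEsg normr_le0 => /eqP sz0; move: h.
  by rewrite sz0 sgr0 => /esym/eqP; rewrite sgr_eq0 (negbTE st1).
have Cz : C z.
  case: (sgrP (s z)) (h) => hz; rewrite ?(hz).
  + by move=> _; apply/(sgC z y') => //; rewrite hz sy'.
  + move=> h1; apply/(sgC z x) => //; rewrite sgx gtr0_sg//.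
    by case: (sgrP (s (w t1))) st1 h1; rewrite ?eqxx ?opprK.
  + move=> h1; apply/(sgC z x) => //; rewrite sgx ltr0_sg//.
    by case: (sgrP (s (w t1))) st1 h1; rewrite ?eqxx ?opprK.
split=> // _.
case: (sgrP (s z)) h => hz; case: (sgrP (s (w t1))) st1 => //;
  rewrite ?eqxx ?hz ?mulr0// => _ _ _; rewrite ?mulN1r ?mul1r ?oppr_le0 ltW//.
Unshelve. all: by end_near. Qed.
End RegularPoints.

(** * Lipschitz domains and tangential traces *)

Section LipschitzDomain.
Variable R : realType.
Implicit Types (Om : set 'rV[R]_3).

(** A Lipschitz domain lies on one side of its boundary: a point of the interior
    of the closure which is not in Om is on or above the graph, and moving up
    along the third axis gives a point of the closure strictly above the graph,
    which no sequence of points below the graph can approach. *)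
Lemma lipschitz_interior Om : open Om -> lipschitz_boundary Om ->
  (closure Om)° `<=` Om.
Proof.
move=> oOm lip x hx; apply: contrapT => nx.
have [|Q [L [g [QQ glip hQ]]]] := lip x.
  split; first exact: interior_subset.
  by move/interior_subset.
pose q j : 'rV[R]_3 := \row_k Q k j.
have qE y j : (y *m Q) 0 j = dot (q j) y.
  by rewrite mxE /dot; apply: eq_bigr => k _; rewrite !mxE mulrC.
have qq j : dot (q j) (q 2) = (j == 2)%:R.
  have /matrixP/(_ j 2) := mulmx1C QQ; rewrite !mxE => <-.
  by apply: eq_bigr => k _; rewrite !mxE.
have Lge (u v : R * R) : `|g u - g v| <= `|L| * `|u - v|.
  have /= := glip (u, v) (conj I I) => /le_trans; apply.
  by rewrite ler_wpM2r// ler_norm.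
(* The height of y above the graph. *)
pose h y := dot (q 2) y - g (dot (q 0) y, dot (q 1) y).
have h0 : 0 <= h x.
  rewrite subr_ge0 leNgt; apply/negP => hlt; apply: nx.
  by apply/(nbhs_singleton hQ); rewrite !qE.
have hc z (e : R) : 0 < e -> \forall y \near z, h z - e < h y.
  move=> e0; pose d := e / (2 + `|L|).
  have d0 : 0 < d by rewrite divr_gt0// ltr_wpDr.
  have near_dot j : \forall y \near z, `|dot (q j) z - dot (q j) y| < d.
    have /cvgr_dist_lt := @dot_continuous R (q j) z.
    exact.
  near=> y.
  have h2 : `|dot (q 2) z - dot (q 2) y| < d by near: y; exact: near_dot.
  have hg : `|g (dot (q 0) z, dot (q 1) z) - g (dot (q 0) y, dot (q 1) y)| <= `|L| * d.
    rewrite (le_trans (Lge _ _))// ler_wpM2l//.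
    rewrite prod_normE/= ge_max; apply/andP; split; apply: ltW; near: y; exact: near_dot.
  have ed : e = 2 * d + `|L| * d.
    by rewrite /d -mulrDl mulrCA divff ?mulr1// gt_eqF// ltr_wpDr.
  rewrite /h; move: h2 hg; rewrite ltr_norml ler_norml => /andP[? ?] /andP[? ?].
  by rewrite ed; lra.
have hx' : nbhs x (closure Om) by [].
have : \forall y \near x, closure Om y /\ \forall u \near y, (Om u <->
          (u *m Q) 0 2 < g ((u *m Q) 0 0, (u *m Q) 0 1)).
  exact: (filterI hx' (near_join hQ)).
have -> : x = x + (0 : R) *: (x + q 2 - x) by rewrite scale0r addr0.
move=> /segment_cvg /nbhs_ballP[e /= e0].
move=> /(_ (e / 2)) [].
  rewrite /ball/= sub0r normrN gtr0_norm ?divr_gt0//.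
  by rewrite ltr_pdivrMr// ltr_pMr// ltr1n.
rewrite [x + q 2]addrC addrK; set x' := x + _ => clx' hx'2.
have hpos : 0 < h x'.
  rewrite (_ : h x' = h x + e / 2); first by rewrite ltr_wpDl// divr_gt0.
  by rewrite /h /x' !dotDr !dotZr !qq/= !mulr0 !addr0 mulr1; ring.
have [u [Ou [hu1 hu2]]] := clx' _ (filterI hx'2 (hc x' _ hpos)).
have := hu1.1 Ou; rewrite !qE ltNge => /negP; apply.
by move: hu2; rewrite subrr /h subr_gt0 => /ltW.
Unshelve. all: by end_near. Qed.
End LipschitzDomain.

Section TangentialTrace.
Variables (R : realType) (m n : nat).
Variables (a : 'I_m -> 'I_n -> 'rV[R]_3) (b : 'I_m -> 'I_n -> R).
Local Notation C := (constraints a b).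
Variables (Om : set 'rV[R]_3).
Hypotheses (oOm : open Om) (clOm : closure Om = C) (intC : C° `<=` Om).

Lemma boundaryE : boundary Om = frontier a b.
Proof.
rewrite /boundary clOm; apply/seteqP; split=> x [Cx fx]; split=> //.
  move=> /intC Ox; apply: fx.
  exact: open_nbhs_nbhs.
move=> ix; apply: fx; move: ix; apply: filterS => y Oy.
by rewrite -clOm; exact: subset_closure.
Qed.

Lemma enorm_gt0 (c : 'rV[R]_3) : c != 0 -> 0 < enorm c.
Proof.
move=> c0; rewrite sqrtr_gt0 lt_neqAle dotxx_ge0 andbT eq_sym.
by apply: contra c0 => /eqP/dotxx_eq0/eqP.
Qed.

Lemma half_space_normal y c : C y -> c != 0 ->
  (\forall x \near y, C x <-> dot c (x - y) <= 0) ->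
  outward_normal Om y ((enorm c)^-1 *: c).
Proof.
move=> Cy c0 hc; have cp := enorm_gt0 c0.
have dE x : dot (x - y) ((enorm c)^-1 *: c) = (enorm c)^-1 * dot c (x - y).
  by rewrite dotZr dotC.
split.
- rewrite boundaryE; split=> // nC.
  have : \forall x \near y + (0 : R) *: (y + c - y), dot c (x - y) <= 0.
    rewrite scale0r addr0; apply: filterS2 hc nC => x h1 Cx; exact/h1.
  move=> /(@segment_cvg R y (y + c) 0 [set x | dot c (x - y) <= 0]).
  move=> /nbhs_ballP[e /= e0 /(_ (e / 2))].
  rewrite /ball/= sub0r normrN gtr0_norm ?divr_gt0// => h.
  have {h} := h; rewrite ltr_pdivrMr// ltr_pMr// ltr1n => /(_ isT).
  rewrite [y + c]addrC addrK [y + _]addrC addrK dotZr pmulr_rle0 ?divr_gt0//.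
  rewrite le_eqVlt ltNge dotxx_ge0 orbF => /eqP/dotxx_eq0/eqP.
  by rewrite (negbTE c0).
- rewrite /enorm dotZr dotZl mulrA -expr2 sqrtrM ?exprn_ge0 ?invr_ge0 ?ltW//.
  by rewrite sqrtr_sqr ger0_norm ?invr_ge0 ?ltW// mulVf ?gt_eqF.
- move=> eps eps0.
  have h2 : \forall x \near y, \forall u \near x, C u <-> dot c (u - y) <= 0.
    exact: near_join.
  apply: filterS2 hc h2 => x hx hux; split; rewrite dE => h.
    apply: intC; have lt0 : dot c (x - y) < 0.
      rewrite -(@pmulr_rlt0 _ (enorm c)^-1) ?invr_gt0// (lt_le_trans h)//.
      by rewrite oppr_le0 mulr_ge0 ?sqrtr_ge0// ltW.
    have : \forall u \near x, dot c (u - y) < 0.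
      have : \forall u \near x, dot c u < dot c y.
        have := @dot_continuous R c x.
        move=> /cvgr_lt; apply.
        by rewrite -subr_lt0 -dotBr.
      by apply: filterS => u; rewrite dotBr subr_lt0.
    by apply: filterS2 hux => u hu /ltW /hu.
  move=> Ox; have /hx : C x by rewrite -clOm; exact: subset_closure.
  rewrite -(@pmulr_rle0 _ (enorm c)^-1) ?invr_gt0// leNgt (le_lt_trans _ h)//.
  by rewrite mulr_ge0 ?sqrtr_ge0// ltW.
Qed.

(** Near an interior point y of the segment from z to x the set C is invariant
    under translations along the segment. If u were not orthogonal to x - z
    at y, by continuity it would not be so at some regular frontier point y'
    close to y; but there x - z is tangent to the boundary plane and u is
    normal to it. *)
Lemma tangential_on_frontier (u : 'rV[R]_3 -> 'rV[R]_3) :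
  {within closure Om, continuous u} ->
  (forall x nu, outward_normal Om x nu -> cross (u x) nu = 0) ->
  forall z, frontier a b z -> \forall x \near z, frontier a b x ->
    forall t, 0 < t < 1 -> dot (u (z + t *: (x - z))) (x - z) = 0.
Proof.
move=> cu tru z fz.
have h1 := frontier_cone a b z; have h2 := translation_invariant a b z.
apply: filterS2 h1 h2 => x hx htr fx t ht.
have fy := hx fz fx t; move: fy (htr t ht).
set y := z + t *: (x - z) => fy [e e0 hy].
have {}fy : frontier a b y by apply: fy; case/andP: ht => *; rewrite !ltW.
apply: contrapT => /eqP hne.
have hU : \forall p \near y, (C p -> dot (u p) (x - z) != 0) /\
   (forall j, `|p 0 j - y 0 j| < e).
  apply: filterI; last exact: near_ball.
  move/subspace_continuousP : cu => /(_ y).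
  rewrite clOm => /(_ fy.1) cuy.
  have cuy' : (fun p => dot (x - z) (u p)) @ within C (nbhs y) --> dot (x - z) (u y).
    exact: (continuous_cvg _ (@dot_continuous R (x - z) (u y)) cuy).
  have := cvgr_neq0 (dot (x - z) (u y)) cuy'.
  rewrite dotC hne => /(_ _ isT).
  rewrite near_withinE; apply: filterS => p hp /hp; rewrite dotC; exact.
have [y' [c [[Uy' hinv] Cy' c0 hc]]] := regular_point oOm clOm fy hU.
have nrm := half_space_normal Cy' c0 hc.
have := tru _ _ nrm; set nu := _ *: c => hcr.
(* Both translates y' + s (x - z) and y' - s (x - z) belong to C, hence to the
   half-space. *)
have hd : dot c (x - z) = 0.
  have : \forall s \near (0 : R), (forall j, `|(y' + s *: (x - z)) 0 j - y 0 j| < e) /\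
      (C (y' + s *: (x - z)) <-> s * dot c (x - z) <= 0).
    pose P := [set p : 'rV[R]_3 |
        (forall j, `|p 0 j - y 0 j| < e) /\ (C p <-> dot c (p - y') <= 0)].
    have : nbhs (y' + (0 : R) *: (y' + (x - z) - y')) P.
      rewrite scale0r addr0; apply: filterI hc.
      by apply: (@open_nbhs_nbhs _ y'); split=> //; exact: open_sup_ball.
    move=> /(@segment_cvg R y' (y' + (x - z)) 0 P).
    rewrite [y' + (x - z)]addrC addrK; apply: filterS => s; rewrite /P /=.
    by rewrite [y' + s *: _ - y']addrAC subrr add0r dotZr.
  move=> /nbhs_ballP[e' /= e'0 he'].
  pose s := Num.min (e' / 2) (e / 2).
  have s0 : 0 < s by rewrite lt_min !divr_gt0.
  have h2 (r : R) : 0 < r -> r / 2 < r.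
    by move=> r0; rewrite ltr_pdivrMr// ltr_pMr// ltr1n.
  have se' : s < e' by rewrite gt_min h2.
  have se : s < e by rewrite gt_min orbC h2.
  have /he' [b1 [c1 _]] : ball (0 : R) e' s.
    by rewrite /ball/= sub0r normrN gtr0_norm.
  have /he' [_ [c2 _]] : ball (0 : R) e' (- s).
    by rewrite /ball/= sub0r opprK gtr0_norm.
  apply/eqP; rewrite eq_le; apply/andP; split.
    rewrite -(pmulr_rle0 _ s0); apply: c1.
    by apply/(hy _ s b1 s0 se); rewrite addrK.
  rewrite -(pmulr_rge0 _ s0) -oppr_le0 -mulNr; apply: c2.
  by rewrite scaleNr; apply/(hy y' s).
apply/negP : (Uy' Cy'); rewrite negbK; apply/eqP.
have nn : dot nu nu = 1.
  case: nrm => _ + _; rewrite /enorm => h.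
  by rewrite -(@sqr_sqrtr _ (dot nu nu)) ?dotxx_ge0// h expr1n.
have := dot_cross (u y') (x - z) nu; rewrite hcr dot0l nn mulr1.
by rewrite /nu [dot (x - z) _]dotC dotZl hd mulr0 mulr0 subr0 => <-.
Qed.
End TangentialTrace.

(** * Polynomials in three variables *)

Section Polynomials.
Variable R : realType.
Implicit Types (c e : nat -> nat -> nat -> R) (x z d : 'rV[R]_3).

(** The exponents range over a cube, so that the sums separate into iterated sums
    in one variable; [degree_le] keeps track of the total degree. *)
Definition peval n c x : R :=
  \sum_(i < n) \sum_(j < n) \sum_(k < n)
    c i j k * x 0 0 ^+ i * x 0 1 ^+ j * x 0 2 ^+ k.

Definition degree_le k c := forall i j l, (k < i + j + l)%N -> c i j l = 0.

Definition pdiff (j : 'I_3) c : nat -> nat -> nat -> R := fun i1 i2 i3 =>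
  match val j with
  | 0%N => i1.+1%:R * c i1.+1 i2 i3
  | 1%N => i2.+1%:R * c i1 i2.+1 i3
  | _ => i3.+1%:R * c i1 i2 i3.+1
  end.

Lemma poly_onP k A q : poly_on k A q ->
  exists2 c, degree_le k c & forall n x, (k < n)%N -> A x -> q x = peval n c x.
Proof.
move=> [c hc].
pose c' i j l := if (i + j + l <= k)%N then c i j l else 0.
exists c' => [i j l|]; first by rewrite /c' ltnNge => /negbTE->.
move=> n x kn Ax; rewrite hc// /peval.
have wid (F : nat -> R) : (forall i, (k < i)%N -> F i = 0) ->
    \sum_(i < n) F i = \sum_(i < k.+1) F i.
  move=> hF; rewrite (big_ord_widen n F kn) [RHS]big_mkcond/=.
  by apply: eq_bigr => i _; case: ltnP => // /hF.
have c0 i j l : (k < i + j + l)%N -> c' i j l = 0.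
  by rewrite /c' ltnNge => /negbTE->.
rewrite [RHS](wid (fun i => \sum_(j < n) \sum_(k < n)
    c' i j k * x 0 0 ^+ i * x 0 1 ^+ j * x 0 2 ^+ k)); last first.
  move=> i hi; apply: big1 => j _; apply: big1 => l _.
  by rewrite c0 ?mul0r// -addnA ltn_addr.
apply: eq_bigr => i _.
rewrite [RHS](wid (fun j => \sum_(k < n)
    c' i j k * x 0 0 ^+ i * x 0 1 ^+ j * x 0 2 ^+ k)); last first.
  move=> j hj; apply: big1 => l _.
  by rewrite c0 ?mul0r// -addnA ltn_addl// ltn_addr.
apply: eq_bigr => j _.
rewrite [RHS](wid (fun l => c' i j l * x 0 0 ^+ i * x 0 1 ^+ j * x 0 2 ^+ l)).
  rewrite big_mkcond/=; apply: eq_bigr => l _; rewrite /c'.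
  by case: ifP => // _; rewrite !mul0r.
by move=> l hl; rewrite c0 ?mul0r// ltn_addl.
Qed.

Lemma degree_le_poly_on k c A q : degree_le k c ->
  (forall x, A x -> q x = peval k.+1 c x) -> poly_on k A q.
Proof.
move=> hc hq; exists c => x Ax; rewrite hq//.
apply: eq_bigr => i _; apply: eq_bigr => j _; rewrite [RHS]big_mkcond/=.
by apply: eq_bigr => l _; case: leqP => // /hc ->; rewrite !mul0r.
Qed.

(** A polynomial of degree less than n has fewer than the n + 1 roots used here. *)
Lemma poly1_eq0 n (g : nat -> R) (s t : R) : s < t ->
  (forall x : R, s < x < t -> \sum_(i < n) g i * x ^+ i = 0) ->
  forall i, (i < n)%N -> g i = 0.
Proof.
move=> st h i hi; pose p := \poly_(i < n) g i.
suff p0 : p = 0 by have := coef_poly n g i; rewrite hi -/p p0 coef0.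
pose xs := [seq s + (t - s) / (n.+2%:R) * (k.+1)%:R | k <- iota 0 n.+1].
have ts : 0 < t - s by rewrite subr_gt0.
apply/eqP; apply: contraT => pN0.
have roots : all (root p) xs.
  apply/allP => x /mapP[k]; rewrite mem_iota add0n => /andP[_ hk] ->.
  apply/rootP; rewrite horner_poly h//; apply/andP; split.
    by rewrite ltrDl mulr_gt0// divr_gt0.
  rewrite -ltrBrDl -mulrA gtr_pMr// mulrC ltr_pdivrMr ?ltr0n// mul1r ltr_nat.
  by rewrite ltnS.
have uxs : uniq xs.
  rewrite map_inj_uniq ?iota_uniq// => k l /addrI/mulfI.
  rewrite gt_eqF ?divr_gt0// => /(_ isT)/eqP; rewrite eqr_nat => /eqP[].
  by [].
have := max_poly_roots pN0 roots uxs.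
by rewrite size_map size_iota => /leq_trans/(_ (size_poly _ _)); rewrite ltnNge leqnSn.
Qed.

(** One variable at a time, on a cube contained in V. *)
Lemma peval_eq0 n c (V : set 'rV[R]_3) : open V -> V !=set0 ->
  (forall x, V x -> peval n c x = 0) ->
  forall i j k, (i < n)%N -> (j < n)%N -> (k < n)%N -> c i j k = 0.
Proof.
move=> oV [z Vz] h i j k hi hj hk.
have /near_coordP[e e0 he] : nbhs z V by exact: open_nbhs_nbhs.
have lt l : z 0 l - e < z 0 l + e by rewrite ltrBlDr -addrA ltrDl addr_gt0.
apply: (poly1_eq0 (lt 2) _ hk) => x2 h2.
apply: (poly1_eq0 (lt 1) _ hj (g := fun j => \sum_(l < n) c i j l * x2 ^+ l)) => x1 h1.
apply: (poly1_eq0 (lt 0) _ hi (g := fun i => \sum_(j < n)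
  (\sum_(l < n) c i j l * x2 ^+ l) * x1 ^+ j)) => x0 h0.
rewrite -[RHS](h (pt (x0, x1, x2))); last first.
  by apply: he; apply: ord3_ind; rewrite ptE ltr_distl.
rewrite /peval !ptE.
apply: eq_bigr => a _; rewrite mulr_suml; apply: eq_bigr => b _.
rewrite !mulr_suml; apply: eq_bigr => l _; ring.
Qed.

Definition line_poly n c z d : {poly R} :=
  \sum_(i < n) \sum_(j < n) \sum_(k < n) (c i j k)%:P *
    ((z 0 0)%:P + (d 0 0)%:P * 'X) ^+ i *
    ((z 0 1)%:P + (d 0 1)%:P * 'X) ^+ j *
    ((z 0 2)%:P + (d 0 2)%:P * 'X) ^+ k.

Lemma line_polyE n c z d t : (line_poly n c z d).[t] = peval n c (z + t *: d).
Proof.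
rewrite /line_poly /peval horner_sum; apply: eq_bigr => i _.
rewrite horner_sum; apply: eq_bigr => j _; rewrite horner_sum.
apply: eq_bigr => k _; rewrite !hornerE !mxE.
by rewrite ![t * _]mulrC.
Qed.

Lemma shift_sum n (V : {poly R}) (g : nat -> {poly R}) : g n = 0 ->
  \sum_(i < n) g i * (V ^+ i.-1 *+ i) = \sum_(i < n) g i.+1 * (V ^+ i *+ i.+1).
Proof.
move=> gn.
have := big_ord_recl n (fun i => g i * (V ^+ i.-1 *+ i)) => /= E1.
rewrite [LHS](_ : _ = \sum_(i < n.+1) g i * (V ^+ i.-1 *+ i)); last first.
  by rewrite big_ord_recr/= gn mul0r addr0.
by rewrite big_ord_recl/= mulr0n mulr0 add0r.
Qed.

(** The bound n.-1 makes the coefficients of exponent n vanish: they are the ones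
    that [pdiff] reads past the range of the sums. *)
Lemma deriv_line_poly n c z d : degree_le n.-1 c ->
  (line_poly n c z d)^`() =
   (d 0 0)%:P * line_poly n (pdiff 0 c) z d +
   (d 0 1)%:P * line_poly n (pdiff 1 c) z d +
   (d 0 2)%:P * line_poly n (pdiff 2 c) z d.
Proof.
case: n => [|n]/= hc.
  by rewrite /line_poly !big_ord0 deriv0 !mulr0 !addr0.
rewrite /line_poly.
set L0 := (z 0 0)%:P + _; set L1 := (z 0 1)%:P + _; set L2 := (z 0 2)%:P + _.
have dL0 : L0^`() = (d 0 0)%:P by rewrite !poly.derivE ?(mul0r, add0r, mulr1).
have dL1 : L1^`() = (d 0 1)%:P by rewrite !poly.derivE ?(mul0r, add0r, mulr1).
have dL2 : L2^`() = (d 0 2)%:P by rewrite !poly.derivE ?(mul0r, add0r, mulr1).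
transitivity (
 (d 0 0)%:P * (\sum_(i < n.+1) (\sum_(j < n.+1) \sum_(k < n.+1)
   (c i j k)%:P * L1 ^+ j * L2 ^+ k) * (L0 ^+ i.-1 *+ i))
 + (d 0 1)%:P * (\sum_(i < n.+1) \sum_(j < n.+1) (\sum_(k < n.+1)
   (c i j k)%:P * L0 ^+ i * L2 ^+ k) * (L1 ^+ j.-1 *+ j))
 + (d 0 2)%:P * (\sum_(i < n.+1) \sum_(j < n.+1) \sum_(k < n.+1)
   ((c i j k)%:P * L0 ^+ i * L1 ^+ j) * (L2 ^+ k.-1 *+ k))).
  rewrite !mulr_sumr -!big_split/= raddf_sum/=; apply: eq_bigr => i _.
  rewrite !mulr_suml !mulr_sumr -!big_split/= raddf_sum/=; apply: eq_bigr => j _.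
  rewrite !mulr_suml !mulr_sumr -!big_split/= raddf_sum/=; apply: eq_bigr => k _.
  rewrite !poly.derivM poly.derivC !deriv_exp dL0 dL1 dL2; ring.
congr (_ + _ + _); congr (_ * _).
- rewrite (shift_sum _ (g := fun i => \sum_(j < n.+1) \sum_(k < n.+1)
    (c i j k)%:P * L1 ^+ j * L2 ^+ k)).
    apply: eq_bigr => i _; rewrite mulr_suml; apply: eq_bigr => j _.
    rewrite mulr_suml; apply: eq_bigr => k _; rewrite /pdiff/= polyCM polyC_natr.
    by rewrite -mulr_natr; ring.
  apply: big1 => j _; apply: big1 => k _; rewrite hc ?mul0r//.
  by rewrite -addnA ltn_addr.
- apply: eq_bigr => i _.
  rewrite (shift_sum _ (g := fun j => \sum_(k < n.+1) (c i j k)%:P * L0 ^+ i * L2 ^+ k)).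
    apply: eq_bigr => j _.
    rewrite mulr_suml; apply: eq_bigr => k _; rewrite /pdiff/= polyCM polyC_natr.
    by rewrite -mulr_natr; ring.
  apply: big1 => k _; rewrite hc ?mul0r//.
  by rewrite -addnA ltn_addl// ltn_addr.
- apply: eq_bigr => i _; apply: eq_bigr => j _.
  rewrite (shift_sum _ (g := fun k => (c i j k)%:P * L0 ^+ i * L1 ^+ j)).
    apply: eq_bigr => k _; rewrite /pdiff/= polyCM polyC_natr.
    by rewrite -mulr_natr; ring.
  by rewrite hc ?mul0r// ltn_addl.
Qed.
End Polynomials.

Section PolynomialCalculus.
Variable R : realType.
Implicit Types (c e : nat -> nat -> nat -> R) (x z d v : 'rV[R]_3).

Lemma is_derive_lineP (V : normedModType R) (f : V -> R) (x v : V) df :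
  is_derive x v f df <->
  forall e : R, 0 < e -> \forall h \near (0 : R)^',
    `|df - h^-1 * (f (x + h *: v) - f x)| < e.
Proof.
have E : (fun h : R => h^-1 *: ((f \o shift x) (h *: v) - f x)) =
         (fun h : R => h^-1 * (f (x + h *: v) - f x)).
  by apply: funext => h; rewrite /= [h *: v + x]addrC.
split=> [[ex <-] e e0|h].
  have := ex; rewrite /derivable => /cvgrPdist_lt /(_ e e0).
  by apply: filterS => h; rewrite -(congr1 (@^~ h) E).
have cv : (fun h : R => h^-1 *: ((f \o shift x) (h *: v) - f x)) @ 0^' --> df.
  by rewrite E; apply/cvgrPdist_lt => e e0; exact: h.
split; first exact: cvgP cv.
by apply: cvg_lim cv; exact: norm_hausdorff.
Qed.

Lemma peval_line_derive n c z d (t : R) : degree_le n.-1 c ->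
  is_derive t 1 (fun t => peval n c (z + t *: d))
    (d 0 0 * peval n (pdiff 0 c) (z + t *: d)
     + d 0 1 * peval n (pdiff 1 c) (z + t *: d)
     + d 0 2 * peval n (pdiff 2 c) (z + t *: d)).
Proof.
move=> hc.
rewrite (_ : (fun t => _) = horner (line_poly n c z d)); last first.
  by apply: funext => s; rewrite line_polyE.
apply: trigger_derive.
by rewrite deriv_line_poly// !hornerE !line_polyE.
Qed.

Lemma peval_is_partial n c x i : degree_le n.-1 c ->
  is_derive x (delta_mx 0 i) (peval n c) (peval n (pdiff i c) x).
Proof.
move=> hc; apply/is_derive_lineP => e e0.
have := peval_line_derive x (delta_mx 0 i) 0 hc.
rewrite scale0r addr0 !mxE.
have -> : (0 == i)%:R * peval n (pdiff 0 c) x + (1 == i)%:R * peval n (pdiff 1 c) x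
   + (2 == i)%:R * peval n (pdiff 2 c) x = peval n (pdiff i c) x.
  by move: i; apply: ord3_ind; rewrite !(mul0r, mul1r, addr0, add0r).
case=> ex <-.
have := ex; rewrite /derivable => /cvgrPdist_lt /(_ e e0).
rewrite /derive; apply: filterS => h /=.
by rewrite scale0r !addr0 [h *: 1]mulr1.
Qed.

Lemma continuous_sum_ord n (F : 'I_n -> 'rV[R]_3 -> R) :
  (forall i, continuous (F i)) -> continuous (fun x => \sum_(i < n) F i x).
Proof.
elim: n F => [|n IH] F hF.
  rewrite (_ : (fun x => _) = cst 0); first exact: cst_continuous.
  by apply: funext => x; rewrite big_ord0.
rewrite (_ : (fun x => _) = (fun x => \sum_(i < n) F (widen_ord (leqnSn n) i) x)
   \+ F ord_max); last by apply: funext => x; rewrite big_ord_recr.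
by move=> x; apply: continuousD; [exact: IH|exact: hF].
Qed.

Lemma continuous_coordX (j : 'I_3) k : continuous (fun x : 'rV[R]_3 => x 0 j ^+ k).
Proof.
move=> x; apply: (@continuous_comp _ _ _ (fun x : 'rV[R]_3 => x 0 j) (fun t => t ^+ k)).
  exact: coord_continuous.
exact: exprn_continuous.
Qed.

Lemma continuous_peval n c : continuous (peval n c).
Proof.
apply: continuous_sum_ord => i; apply: continuous_sum_ord => j.
apply: continuous_sum_ord => k x.
apply: (@continuousM _ _ (fun x => c i j k * x 0 0 ^+ i * x 0 1 ^+ j)
   (fun x => x 0 2 ^+ k)); last exact: continuous_coordX.
apply: (@continuousM _ _ (fun x => c i j k * x 0 0 ^+ i)
   (fun x => x 0 1 ^+ j)); last exact: continuous_coordX.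
apply: (@continuousM _ _ (fun x => c i j k)
   (fun x => x 0 0 ^+ i)); last exact: continuous_coordX.
exact: cst_continuous.
Qed.

(** The coefficients of the integral of the field along the broken line from the
    origin that runs parallel to the third axis, then the second, then the
    first. *)
Definition potential (c : 'I_3 -> nat -> nat -> nat -> R) i j k : R :=
  if i is i'.+1 then c 0 i' j k / i%:R
  else if j is j'.+1 then c 1 i j' k / j%:R
  else if k is k'.+1 then c 2 i j k' / k%:R else 0.

Lemma potential_degree (c : 'I_3 -> nat -> nat -> nat -> R) r :
  (forall j, degree_le r (c j)) ->
  degree_le r.+1 (potential c).
Proof.
move=> hc [|i] [|j] [|k] //= h; rewrite hc ?mul0r//;
  by move: h; rewrite ?addnS ?addSn ltnS ?addnS ?addSn.
Qed.

Lemma pdiff_potential (c : 'I_3 -> nat -> nat -> nat -> R) :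
  (forall i j k, pdiff 1 (c 0) i j k = pdiff 0 (c 1) i j k) ->
  (forall i j k, pdiff 2 (c 0) i j k = pdiff 0 (c 2) i j k) ->
  (forall i j k, pdiff 2 (c 1) i j k = pdiff 1 (c 2) i j k) ->
  forall l i j k, pdiff l (potential c) i j k = c l i j k.
Proof.
rewrite /pdiff/= => h01 h02 h12.
have nz (i : nat) : i.+1%:R != 0 :> R by rewrite pnatr_eq0.
apply: ord3_ind => i j k /=.
- by rewrite mulrC divfK.
- case: i => [|i] /=; first by rewrite mulrC divfK.
  by rewrite mulrA h01 mulrAC divff ?mul1r.
- case: i => [|i] /=; last by rewrite mulrA h02 mulrAC divff ?mul1r.
  case: j => [|j] /=; first by rewrite mulrC divfK.
  by rewrite mulrA h12 mulrAC divff ?mul1r.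
Qed.
Lemma pdiff_degree k c (l : 'I_3) i1 i2 i3 : degree_le k c ->
  (k <= i1 + i2 + i3)%N -> pdiff l c i1 i2 i3 = 0.
Proof.
move=> hc hk; rewrite /pdiff; case: (val l) => [|[|_]]; rewrite hc ?mulr0//;
  by rewrite ?addnS ?addSn ?addnS ltnS.
Qed.

Lemma degree_leW k k' c : (k <= k')%N -> degree_le k c -> degree_le k' c.
Proof. by move=> kk hc i j l h; apply: hc; exact: leq_ltn_trans h. Qed.

Lemma pevalD n c c' x :
  peval n (fun i j k => c i j k + c' i j k) x = peval n c x + peval n c' x.
Proof.
rewrite -big_split; apply: eq_bigr => i _; rewrite -big_split.
apply: eq_bigr => j _; rewrite -big_split; apply: eq_bigr => k _.
by rewrite !mulrDl.
Qed.

Lemma pevalN n c x :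
  peval n (fun i j k => - c i j k) x = - peval n c x.
Proof.
rewrite -sumrN; apply: eq_bigr => i _; rewrite -sumrN.
apply: eq_bigr => j _; rewrite -sumrN; apply: eq_bigr => k _.
by rewrite !mulNr.
Qed.

Definition const_coef (s : R) (i j k : nat) : R :=
  if (i + j + k == 0)%N then s else 0.

Lemma peval_const n (s : R) x : peval n.+1 (const_coef s) x = s.
Proof.
have nz (i : 'I_n.+1) : i != ord0 -> (i == 0 :> nat) = false by move=> /negbTE.
rewrite /peval (bigD1 ord0)//= (bigD1 ord0)//= (bigD1 ord0)//=.
rewrite /const_coef/= !expr0 !mulr1 big1 ?addr0 => [|k /nz k0]; last first.
  by rewrite !add0n k0 !mul0r.
rewrite big1 ?addr0 => [|j /nz j0]; last first.
  by apply: big1 => k _; rewrite add0n addn_eq0 j0/= !mul0r.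
rewrite big1 ?addr0// => i /nz i0.
by apply: big1 => j _; apply: big1 => k _; rewrite !addn_eq0 i0/= !mul0r.
Qed.

End PolynomialCalculus.

(** * Integrals of partial derivatives *)

Section MeasureR3.
Variable R : realType.
Local Notation mu := (@lebesgue_measure R).
Local Notation mu3 := (@lebesgue3 R).

(** An open set is a union of cubes with rational centres and sides; there are
    countably many of them. *)
Lemma measurable_pt_open (U : set 'rV[R]_3) : open U ->
  measurable (@pt R @^-1` U).
Proof.
move=> oU.
pose B (k : rat * rat * rat * rat) : set (R * R * R) :=
  (ball (ratr k.1.1.1 : R) (ratr k.2) `*` ball (ratr k.1.1.2 : R) (ratr k.2)) `*`
  ball (ratr k.1.2 : R) (ratr k.2).
have -> : @pt R @^-1` U = \bigcup_(k in [set k | B k `<=` @pt R @^-1` U]) B k.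
  apply/seteqP; split=> [[[x y] z] Ut|t [k hk /hk//]].
  have /near_coordP[e e0 he] : nbhs (pt (x, y, z)) U.
    exact: (open_nbhs_nbhs (conj oU Ut)).
  have [q [q0 qe]] : exists q : rat, (0 : R) < ratr q /\ ratr q < e / 2.
    have e20 : 0 < e / 2 by rewrite divr_gt0.
    by have [q] := rat_in_itvoo e20; rewrite in_itv/= => /andP[]; exists q.
  have app (w : R) : exists p : rat, `|w - ratr p| < ratr q.
    have [|p] := @rat_in_itvoo R (w - ratr q) (w + ratr q).
      by rewrite ltrBlDr -addrA ltrDl addr_gt0.
    rewrite in_itv/= => /andP[h1 h2]; exists p; rewrite ltr_norml.
    by apply/andP; split; lra.
  have [p1 h1] := app x; have [p2 h2] := app y; have [p3 h3] := app z.
  exists (p1, p2, p3, q); last by split; [split|]; rewrite /= /ball/= distrC.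
  have tri (v v' p : R) : `|v - p| < ratr q -> `|p - v'| < ratr q -> `|v' - v| < e.
    by rewrite !ltr_norml => /andP[? ?] /andP[? ?]; apply/andP; split; lra.
  move=> [[x' y'] z'] [[/= h1' h2'] h3']; rewrite /preimage/=.
  apply: he => j; move: j; apply: ord3_ind; rewrite !ptE.
  - exact: tri h1 h1'.
  - exact: tri h2 h2'.
  - exact: tri h3 h3'.
rewrite bigcup_mkcond; apply: countable_bigcupT_measurable => // k.
case: ifP => // _; apply: measurableX; first apply: measurableX;
  by rewrite ball_itv; exact: measurable_itv.
Qed.

Lemma measurable_pt_continuous (G : 'rV[R]_3 -> R) : continuous G ->
  measurable_fun setT (G \o @pt R).
Proof.
move=> /continuousP cG; apply: (measurability _ (RGenOpens.measurableE R)).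
move=> _ [_ [a [b ->] <-]]; rewrite setTI comp_preimage.
by apply: measurable_pt_open; apply: cG; exact: interval_open.
Qed.

Lemma bounded_support_integrable d (T : measurableType d)
    (m : {measure set T -> \bar R}) (A : set T) (g : T -> R) (B : R) :
  measurable A -> (m A < +oo)%E -> measurable_fun setT g ->
  (forall t, `|g t| <= B) -> (forall t, ~ A t -> g t = 0) ->
  m.-integrable setT (EFin \o g).
Proof.
move=> mA Afin mg gB g0.
apply: (@le_integrable _ _ _ m setT measurableT _ (fun t => (B * \1_A t)%:E)).
- exact/measurable_EFinP.
- move=> t _; rewrite /= lee_fin; have B0 : 0 <= B by rewrite (le_trans _ (gB t)).
  have [At|nA] := pselect (A t).
    by rewrite indicE mem_set// mulr1 [leRHS]ger0_norm.
  by rewrite (g0 _ nA) normr0.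
under [X in integrable _ _ X]funext do rewrite EFinM.
apply: integrableZl => //; apply/integrableP; split; first exact/measurable_EFinP.
under eq_integral do rewrite gee0_abs ?lee_fin//.
by rewrite integral_indic// setIT.
Qed.

Lemma derivative_integral0 (M : R) (g dg : R -> R) : 0 < M ->
  (forall t : R, is_derive t 1 g (dg t)) -> continuous dg ->
  (forall t, M <= `|t| -> g t = 0 /\ dg t = 0) ->
  (\int[mu]_t (dg t)%:E = 0)%E.
Proof.
move=> M0 hg cdg h0.
have -> : (\int[mu]_t (dg t)%:E = \int[mu]_(t in `[(- M)%R, M]) (dg t)%:E)%E.
  rewrite [RHS]integral_mkcond; apply: eq_integral => t _.
  rewrite patchE; case: ifPn => // /negP; rewrite inE/= in_itv/= => ht.
  rewrite (h0 t _).2// leNgt; apply/negP => ltM; apply: ht.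
  by move/ltW: ltM; rewrite ler_norml.
have cg : continuous g.
  by move=> t; apply/differentiable_continuous/derivable1_diffP; case: (hg t).
have gM : g M = 0 by apply: (h0 _ _).1; rewrite ger0_norm// ltW.
have gN : g (- M) = 0 by apply: (h0 _ _).1; rewrite normrN ger0_norm// ltW.
rewrite (continuous_FTC2 (F := g)).
- by rewrite gM gN subee.
- lra.
- exact: continuous_subspaceT.
- split.
  + by move=> x _; case: (hg x).
  + exact/cvg_at_right_filter/cg.
  + exact/cvg_at_left_filter/cg.
- by move=> x _; rewrite derive1E; case: (hg x).
Qed.
End MeasureR3.

Section Divergence.
Variable R : realType.
Local Notation mu := (@lebesgue_measure R).
Local Notation mu3 := (@lebesgue3 R).
Implicit Types (F G : 'rV[R]_3 -> R) (M : R).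

Definition supported_in_cube M G := forall x, G x != 0 -> forall j, `|x 0 j| < M.

Lemma supported_bounded M G : continuous G -> supported_in_cube M G ->
  exists B, forall x, `|G x| <= B.
Proof.
move=> cG sG.
have : compact (G @` cube M).
  apply: continuous_compact; last exact: compact_cube.
  exact: continuous_subspaceT.
move=> /compact_bounded [B [_ hB]]; exists (Num.max 0 (B + 1)) => x.
have [->|Gx] := eqVneq (G x) 0; first by rewrite normr0 le_max lexx.
rewrite le_max (hB (B + 1)) ?orbT ?ltrDl//.
by exists x => // j; exact/ltW/sG.
Qed.

(** The plane measure has a name of its own to carry its sigma-finiteness, which
    iterated integration on R * R * R asks of its first factor. *)
Definition lebesgue2 : set (measurableTypeR R * measurableTypeR R) -> \bar R :=
  product_measure1 mu mu.

HB.instance Definition _ := Measure.on lebesgue2.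

Lemma lebesgue2_square M :
  (lebesgue2 (`[(- M)%R, M]%classic `*` `[(- M)%R, M]%classic) < +oo)%E.
Proof.
have mI : measurable (`[(- M), M]%classic : set R) by exact: measurable_itv.
rewrite /lebesgue2 product_measure1E//.
have fI : mu `[(- M), M]%classic \is a fin_num.
  rewrite ge0_fin_numE// lebesgue_measure_itv/=.
  by case: ifP => // _; rewrite ltry.
by rewrite ltey_eq fin_numM.
Qed.

Lemma lebesgue2_sigma_finite : sigma_finite setT lebesgue2.
Proof.
exists (fun n => `[(- n%:R), n%:R]%classic `*` `[(- n%:R), n%:R]%classic).
  apply/esym/seteqP; split=> // -[x y] _.
  exists (maxn (Num.truncn `|x|).+1 (Num.truncn `|y|).+1) => //.
  split; rewrite /= in_itv/= -ler_norml natr_max le_max.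
    by rewrite (ltW (truncnS_gt _)).
  by rewrite (ltW (truncnS_gt _)) orbT.
move=> n; split; last exact: lebesgue2_square.
by apply: measurableX; exact: measurable_itv.
Qed.

HB.instance Definition _ :=
  Measure_isSigmaFinite.Build _ _ _ lebesgue2 lebesgue2_sigma_finite.

Lemma supported_integrable M G : continuous G -> supported_in_cube M G ->
  mu3.-integrable setT (EFin \o (G \o @pt R)).
Proof.
move=> cG sG; have [B hB] := supported_bounded cG sG.
pose I : set R := `[(- M), M]%classic.
apply: (@bounded_support_integrable _ _ _ mu3 ((I `*` I) `*` I) _ B).
- by apply: measurableX; first apply: measurableX; exact: measurable_itv.
- have mI : measurable I by exact: measurable_itv.
  change (product_measure1 lebesgue2 mu ((I `*` I) `*` I) < +oo)%E.
  rewrite product_measure1E//; last exact: measurableX.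
  have fI : mu I \is a fin_num.
    by rewrite ge0_fin_numE// lebesgue_measure_itv/=; case: ifP => // _; rewrite ltry.
  by rewrite ltey_eq fin_numM// ge0_fin_numE// lebesgue2_square.
- exact: measurable_pt_continuous.
- by move=> t; exact: hB.
- move=> [[x y] z] nI /=; apply/eqP; apply: contraT => /sG h; exfalso; apply: nI.
  have := h 0; have := h 1; have := h 2; rewrite !ptE !ltr_norml /I.
  move=> /andP[z1 z2] /andP[y1 y2] /andP[x1 x2].
  by split; [split|]; rewrite /= in_itv/=; apply/andP; split; exact: ltW.
Qed.

Lemma supported_integrable2 M G z : continuous G -> supported_in_cube M G ->
  lebesgue2.-integrable setT
     (EFin \o (fun p : R * R => G (pt (p, z)))).
Proof.
move=> cG sG; have [B hB] := supported_bounded cG sG.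
pose I : set R := `[(- M), M]%classic.
apply: (@bounded_support_integrable _ _ _ lebesgue2 (I `*` I) _ B).
- by apply: measurableX; exact: measurable_itv.
- exact: lebesgue2_square.
- exact: (measurable_fun_pair1 (f := G \o @pt R) z (measurable_pt_continuous cG)).
- by move=> t; exact: hB.
- move=> [x y] nI /=; apply/eqP; apply: contraT => /sG h; exfalso; apply: nI.
  have := h 0; have := h 1; rewrite !ptE !ltr_norml /I.
  move=> /andP[y1 y2] /andP[x1 x2].
  by split; rewrite /= in_itv/=; apply/andP; split; exact: ltW.
Qed.

(** w parametrizes a line parallel to the i-th axis by the i-th coordinate; on it
    G is the derivative of F, which vanishes at both ends. *)
Lemma partial_slice0 (i : 'I_3) M F G (w : R -> 'rV[R]_3) :
  0 < M -> (forall t h, w (t + h) = w t + h *: delta_mx 0 i) ->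
  (forall t, w t 0 i = t) ->
  (forall x, is_derive x (delta_mx 0 i) F (G x)) -> continuous G ->
  supported_in_cube M F -> supported_in_cube M G ->
  (\int[mu]_t (G (w t))%:E = 0)%E.
Proof.
move=> M0 wD wi hF cG sF sG.
apply: (derivative_integral0 (g := F \o w) M0).
- move=> t; apply/is_derive_lineP => e e0.
  have /is_derive_lineP/(_ e e0) := hF (w t).
  by apply: filterS => h; rewrite /= wD [h *: 1]mulr1.
- have -> : (fun t => G (w t)) = (fun t : R => G (w 0 + t *: delta_mx 0 i)).
    by apply: funext => t; rewrite -wD add0r.
  move=> t; apply: (@continuous_comp _ _ _
    (fun t : R => w 0 + t *: delta_mx 0 i) G); last exact: cG.
  by apply: cvgD; [exact: cvg_cst|apply: cvgZr_tmp; exact: cvg_id].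
- move=> t tM; split; apply/eqP; apply: contraT.
    by move=> /sF/(_ i); rewrite wi ltNge tM.
  by move=> /sG/(_ i); rewrite wi ltNge tM.
Qed.

Lemma integral_last_outside M G : continuous G -> supported_in_cube M G ->
  (\int[mu3]_t (G (pt t))%:E =
   \int[mu]_z \int[lebesgue2]_p (G (pt (p, z)))%:E)%E.
Proof.
move=> cG sG.
have H : (lebesgue2 \x mu)%E.-integrable setT (fun t => (G (pt t))%:E).
  exact: supported_integrable cG sG.
have := @integral21_prod_meas1 _ _ _ _ R lebesgue2 mu (fun t => (G (pt t))%:E).
by move=> /(_ H); rewrite /fubini_G => <-.
Qed.

Lemma integral_last_inside M G : continuous G -> supported_in_cube M G ->
  (\int[mu3]_t (G (pt t))%:E =
   \int[lebesgue2]_p \int[mu]_z (G (pt (p, z)))%:E)%E.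
Proof.
move=> cG sG.
have H : (lebesgue2 \x mu)%E.-integrable setT (fun t => (G (pt t))%:E).
  exact: supported_integrable cG sG.
have := @integral12_prod_meas1 _ _ _ _ R lebesgue2 mu (fun t => (G (pt t))%:E).
by move=> /(_ H); rewrite /fubini_F => <-.
Qed.

Lemma integral2_fst_inside M G z : continuous G -> supported_in_cube M G ->
  (\int[lebesgue2]_p (G (pt (p, z)))%:E =
   \int[mu]_y \int[mu]_x (G (pt (x, y, z)))%:E)%E.
Proof.
move=> cG sG.
have H : (mu \x mu)%E.-integrable setT (fun p => (G (pt (p, z)))%:E).
  exact: supported_integrable2 z cG sG.
have := @integral21_prod_meas1 _ _ _ _ R mu mu (fun p => (G (pt (p, z)))%:E).
by move=> /(_ H); rewrite /fubini_G => <-.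
Qed.

Lemma integral2_snd_inside M G z : continuous G -> supported_in_cube M G ->
  (\int[lebesgue2]_p (G (pt (p, z)))%:E =
   \int[mu]_x \int[mu]_y (G (pt (x, y, z)))%:E)%E.
Proof.
move=> cG sG.
have H : (mu \x mu)%E.-integrable setT (fun p => (G (pt (p, z)))%:E).
  exact: supported_integrable2 z cG sG.
have := @integral12_prod_meas1 _ _ _ _ R mu mu (fun p => (G (pt (p, z)))%:E).
by move=> /(_ H); rewrite /fubini_F => <-.
Qed.

(** Integration by parts: the integrals are iterated with the variable of
    differentiation innermost. *)
Lemma partial_integral0 (i : 'I_3) M F G : 0 < M ->
  (forall x, is_derive x (delta_mx 0 i) F (G x)) -> continuous G ->
  supported_in_cube M F -> supported_in_cube M G ->
  (\int[mu3]_t (G (pt t))%:E = 0)%E.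
Proof.
move=> M0; move: i; apply: ord3_ind => hF cG sF sG.
- rewrite (integral_last_outside cG sG); apply: integral0_eq => z _.
  rewrite (integral2_fst_inside z cG sG); apply: integral0_eq => y _.
  apply: (partial_slice0 (w := fun t => pt (t, y, z)) M0 _ _ hF cG sF sG).
    by move=> t h; apply: row3P; rewrite !mxE/=; ring.
  by move=> t; rewrite ptE.
- rewrite (integral_last_outside cG sG); apply: integral0_eq => z _.
  rewrite (integral2_snd_inside z cG sG); apply: integral0_eq => x _.
  apply: (partial_slice0 (w := fun t => pt (x, t, z)) M0 _ _ hF cG sF sG).
    by move=> t h; apply: row3P; rewrite !mxE/=; ring.
  by move=> t; rewrite ptE.
- rewrite (integral_last_inside cG sG); apply: integral0_eq => -[x y] _.
  apply: (partial_slice0 (w := fun t => pt (x, y, t)) M0 _ _ hF cG sF sG).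
    by move=> t h; apply: row3P; rewrite !mxE/=; ring.
  by move=> t; rewrite ptE.
Qed.
End Divergence.

(** * Smooth bump functions *)

Section SmoothBump.
Variable R : realType.
Implicit Types (t : R).

(** t^-n exp(-1/t): the derivatives of exp(-1/t) are combinations of these
    functions, so that a statement on all of them is proved by induction on
    the order of differentiation. *)
Definition flat n t : R := if 0 < t then t^-1 ^+ n * expR (- t^-1) else 0.

Lemma flat_ge0 n t : 0 <= flat n t.
Proof.
rewrite /flat; case: ifPn => // t0.
by rewrite mulr_ge0 ?expR_ge0// exprn_ge0// invr_ge0 ltW.
Qed.

Lemma flat_gt0 t : 0 < t -> 0 < flat 0 t.
Proof. by move=> t0; rewrite /flat t0 mul1r expR_gt0. Qed.

Lemma flat_eq0 n t : t <= 0 -> flat n t = 0.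
Proof. by rewrite /flat ltNge => ->. Qed.

(** Since exp(1/t) is at least (1/t)^(n+2) / (n+2)!; the quadratic bound makes the
    derivative at 0 vanish. *)
Lemma flat_le_sqr n t : flat n t <= n.+2`!%:R * t ^+ 2.
Proof.
rewrite /flat; case: ifPn => [t0|_]; last by rewrite mulr_ge0// sqr_ge0.
have s0 : 0 < t^-1 by rewrite invr_gt0.
have h : t^-1 ^+ n.+2 / n.+2`!%:R <= expR t^-1.
  by rewrite (le_trans _ (@expR_ge1Dxn R _ n.+1 (ltW s0)))// lerDr.
have f0 : (0 : R) < n.+2`!%:R by rewrite ltr0n fact_gt0.
rewrite expRN ler_pdivrMr ?expR_gt0//.
apply: le_trans (ler_wpM2l _ h); last by rewrite mulr_ge0// sqr_ge0.
rewrite -addn2 exprD; set u := t^-1 ^+ n; rewrite le_eqVlt; apply/orP; left.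
by apply/eqP; field; rewrite !gt_eqF.
Qed.

Lemma is_derive_flat n t :
  is_derive t 1 (flat n) (flat n.+2 t - n%:R * flat n.+1 t).
Proof.
have [t0|t0|->] := ltgtP t 0.
- rewrite !flat_eq0 ?ltW// mulr0 subr0.
  apply: (@near_eq_is_derive _ _ _ (cst 0)).
  have : \forall s \near t, s < 0 by exact: lt_nbhsl.
  by apply: filterS => s s0; rewrite flat_eq0 ?ltW.
- have d1 : is_derive t 1 (fun s : R => s^-1) (- t ^- 2 *: 1).
    by apply: is_deriveV; rewrite gt_eqF.
  have d2 : is_derive t 1 (fun s : R => (s^-1) ^+ n)
      ((n%:R * t^-1 ^+ n.-1) *: (- t ^- 2 *: 1)).
    by have := @is_deriveX _ _ (fun s : R => s^-1) n t 1 _ d1; rewrite exprfctE.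
  have d3 : is_derive t 1 (fun s : R => - s^-1) (- (- t ^- 2 *: 1)).
    exact: (@is_deriveN _ _ _ (fun s : R => s^-1) t 1 _ d1).
  have d4 := @is_derive1_comp _ expR (fun s : R => - s^-1) t _ _ (is_derive_expR _) d3.
  have d5 := is_deriveM d2 d4.
  have d6 : is_derive t 1
      ((fun s : R => (s^-1) ^+ n) * (expR \o (fun s : R => - s^-1)))
      (flat n.+2 t - n%:R * flat n.+1 t).
    apply: (trigger_derive d5); rewrite /flat t0.
    rewrite /GRing.scale/= !mulr1 -exprVn; case: n {d2 d5} => [|n]/=.
      by rewrite !mul0r mulr0 addr0 subr0 mul1r; ring.
    by rewrite !exprS; ring.
  apply: near_eq_is_derive d6.
  have : \forall s \near t, 0 < s by exact: lt_nbhsr.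
  by apply: filterS => s s0; rewrite /flat s0.
- rewrite !(flat_eq0 _ (lexx 0)).
  rewrite (_ : 0 - _ = 0); last by ring.
  apply/is_derive_lineP => e e0.
  pose k : R := n.+2`!%:R; have k0 : 0 < k by rewrite ltr0n fact_gt0.
  have : \forall h \near (0 : R)^', h != 0 by exact: nbhs_dnbhs_neq.
  have : \forall h \near (0 : R)^', `|h| < e / k.
    apply: dnbhs0_lt; exact: divr_gt0.
  apply: filterS2 => h hk h0.
  rewrite sub0r add0r [flat n 0]flat_eq0// subr0 normrN normrM normfV.
  rewrite ltr_pdivrMl ?normr_gt0// [h *: 1]mulr1 ger0_norm ?flat_ge0//.
  rewrite (le_lt_trans (flat_le_sqr n h))// -normr_nat -/k.
  rewrite -[h ^+ 2]ger0_norm ?sqr_ge0// normrX expr2 ger0_norm ?ltW// mulrCA.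
  by rewrite ltr_pM2l ?normr_gt0// mulrC -ltr_pdivlMr.
Qed.

Lemma continuous_flat n : continuous (flat n).
Proof.
move=> t; apply/differentiable_continuous/derivable1_diffP.
by case: (is_derive_flat n t).
Qed.
End SmoothBump.

Section CnAlgebra.
Variable R : realType.
Implicit Types (f g : 'rV[R]_3 -> R) (x : 'rV[R]_3).

Lemma continuous_addf f g : continuous f -> continuous g ->
  continuous (fun x => f x + g x).
Proof. by move=> cf cg x; apply: (@continuousD _ _ _ f g x (cf x) (cg x)). Qed.

Lemma continuous_mulf f g : continuous f -> continuous g ->
  continuous (fun x => f x * g x).
Proof. by move=> cf cg x; apply: (@continuousM _ _ f g x (cf x) (cg x)). Qed.

Lemma CnS_Cn m f : Cn m.+1 f -> Cn m f.
Proof.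
elim: m f => [|m IH] f [cf hf]; first exact: cf.
split=> // i; split; first by case: (hf i).
by apply: IH; case: (hf i).
Qed.

Lemma Cn_add m f g : Cn m f -> Cn m g -> Cn m (fun x => f x + g x).
Proof.
elim: m f g => [|m IH] f g; first exact: continuous_addf.
move=> [cf hf] [cg hg]; split; first exact: continuous_addf.
move=> i; have [df cdf] := hf i; have [dg cdg] := hg i; split.
  by move=> x; exact: derivableD.
rewrite (_ : partial i _ = fun x => partial i f x + partial i g x).
  exact: IH.
by apply: funext => x; rewrite /partial -deriveD.
Qed.

Lemma Cn_mul m f g : Cn m f -> Cn m g -> Cn m (fun x => f x * g x).
Proof.
elim: m f g => [|m IH] f g; first exact: continuous_mulf.
move=> cnf cng; have cf := CnS_Cn cnf; have cg := CnS_Cn cng.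
case: cnf => ctf hf; case: cng => ctg hg.
split; first exact: continuous_mulf.
move=> i; have [df cdf] := hf i; have [dg cdg] := hg i; split.
  by move=> x; exact: derivableM.
rewrite (_ : partial i _ = fun x => f x * partial i g x + g x * partial i f x).
  by apply: Cn_add; exact: IH.
by apply: funext => x; rewrite /partial [LHS]deriveM.
Qed.

Lemma Cn_cst m (c : R) : Cn m (fun=> c).
Proof.
elim: m c => [|m IH] c; first exact: cst_continuous.
split; first exact: cst_continuous.
move=> i; split; first by move=> x; exact: derivable_cst.
rewrite (_ : partial i _ = fun=> 0); first exact: IH.
by apply: funext => x; rewrite /partial derive_cst.
Qed.

Lemma is_partial_flat n (s c : R) (j i : 'I_3) x :
  is_derive x (delta_mx 0 i) (fun x => flat n (s * x 0 j + c))
   ((j == i)%:R * s * (flat n.+2 (s * x 0 j + c) - n%:R * flat n.+1 (s * x 0 j + c))).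
Proof.
apply/is_derive_lineP => e e0.
set d : R := (j == i)%:R * s.
have dl : is_derive (0 : R) 1 (fun h : R => d * h + (s * x 0 j + c)) d.
  have dz : is_derive (0 : R) 1 ( *%R d) d.
    have := @is_deriveZ _ _ _ id d (0 : R) 1 1 (is_derive_id _ _).
    by rewrite [d *: 1]mulr1.
  have := @is_deriveD _ _ _ ( *%R d) (cst (s * x 0 j + c)) (0 : R) 1 d 0 dz
    (is_derive_cst _ _ _).
  by rewrite addr0.
have := @is_derive1_comp _ (flat n) _ 0 _ _ (is_derive_flat n _) dl.
rewrite mulr0 add0r [_ * d]mulrC => /is_derive_lineP /(_ e e0).
apply: filterS => h; rewrite /= mulr0 !add0r !mxE eqxx/=.
suff -> : d * (h *: 1) + (s * x 0 j + c) = s * (x 0 j + h * (j == i)%:R) + c by [].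
by rewrite [h *: 1]mulr1 /d; ring.
Qed.

Lemma Cn_flat m n (s c : R) (j : 'I_3) :
  Cn m (fun x : 'rV[R]_3 => flat n (s * x 0 j + c)).
Proof.
have ct n' : continuous (fun x : 'rV[R]_3 => flat n' (s * x 0 j + c)).
  move=> x; apply: (@continuous_comp _ _ _ (fun x : 'rV[R]_3 => s * x 0 j + c) (flat n')).
    move: x; apply: continuous_addf; last exact: cst_continuous.
    apply: continuous_mulf; first exact: cst_continuous.
    by move=> x; exact: coord_continuous.
  exact: continuous_flat.
elim: m n => [|m IH] n; first exact: ct.
split; first exact: ct.
move=> i; split; first by move=> x; case: (is_partial_flat n s c j i x).
rewrite (_ : partial i _ = fun x : 'rV[R]_3 => (j == i)%:R * s *
  (flat n.+2 (s * x 0 j + c) + - n%:R * flat n.+1 (s * x 0 j + c))).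
  apply: Cn_mul; first exact: Cn_cst.
  by apply: Cn_add; [exact: IH|apply: Cn_mul; [exact: Cn_cst|exact: IH]].
apply: funext => x; rewrite /partial; case: (is_partial_flat n s c j i x) => _ ->.
by rewrite mulNr.
Qed.

Definition bump (a b : 'rV[R]_3) x : R :=
  flat 0 (x 0 0 - a 0 0) * flat 0 (b 0 0 - x 0 0) *
  (flat 0 (x 0 1 - a 0 1) * flat 0 (b 0 1 - x 0 1)) *
  (flat 0 (x 0 2 - a 0 2) * flat 0 (b 0 2 - x 0 2)).

Lemma bump_ge0 a b x : 0 <= bump a b x.
Proof. by rewrite /bump !mulr_ge0 ?flat_ge0. Qed.

Lemma bump_gt0 (a b : 'rV[R]_3) x : (forall j, a 0 j < x 0 j < b 0 j) -> 0 < bump a b x.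
Proof.
move=> h; have /andP[? ?] := h 0; have /andP[? ?] := h 1.
have /andP[? ?] := h 2.
by rewrite /bump !mulr_gt0// flat_gt0// subr_gt0.
Qed.

Lemma bump_supp a b x : bump a b x != 0 -> box a b x.
Proof.
rewrite /bump !mulf_eq0 !negb_or => /andP[/andP[/andP[h1 h2] /andP[h3 h4]]].
move=> /andP[h5 h6].
have le (t : R) : flat 0 t != 0 -> 0 <= t.
  by apply: contraNT; rewrite -ltNge => t0; rewrite flat_eq0// ltW.
by apply: ord3_ind; rewrite -[_ <= x 0 _]subr_ge0 -[_ <= b 0 _]subr_ge0 !le.
Qed.

Lemma Cn_bump m a b : Cn m (bump a b).
Proof.
have l (j : 'I_3) : Cn m (fun x => flat 0 (x 0 j - a 0 j)).
  rewrite (_ : (fun x => _) = fun x => flat 0 (1 * x 0 j + - a 0 j)).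
    exact: Cn_flat.
  by apply: funext => x; rewrite mul1r.
have r (j : 'I_3) : Cn m (fun x => flat 0 (b 0 j - x 0 j)).
  rewrite (_ : (fun x => _) = fun x => flat 0 (-1 * x 0 j + b 0 j)).
    exact: Cn_flat.
  by apply: funext => x; rewrite mulN1r addrC.
by do !apply: Cn_mul.
Qed.
End CnAlgebra.

(** * Weak and classical curls and gradients *)

Section SupportedIntegrals.
Variable R : realType.
Local Notation mu := (@lebesgue_measure R).
Local Notation mu3 := (@lebesgue3 R).
Implicit Types (f g F G : 'rV[R]_3 -> R) (x : 'rV[R]_3).

(** This class contains the products of polynomials, bump functions and their
    first partial derivatives, to which integration by parts is applied. *)
Definition test_function G := continuous G /\ exists M, supported_in_cube M G.

Lemma supported_le M N G : M <= N -> supported_in_cube M G -> supported_in_cube N G.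
Proof. by move=> MN sG x /sG h j; rewrite (lt_le_trans (h j)). Qed.

Lemma test_integrable G : test_function G ->
  mu3.-integrable setT (EFin \o (G \o @pt R)).
Proof. by move=> [cG [M sG]]; exact: supported_integrable cG sG. Qed.

Lemma test_mulr f G : continuous f -> test_function G ->
  test_function (fun x => f x * G x).
Proof.
move=> cf [cG [M sG]]; split; first exact: continuous_mulf.
by exists M => x; rewrite mulf_eq0 negb_or => /andP[_ /sG].
Qed.

Lemma test_addf F G : test_function F -> test_function G ->
  test_function (fun x => F x + G x).
Proof.
move=> [cF [M sF]] [cG [N sG]]; split; first exact: continuous_addf.
exists (Num.max M N) => x.
have [Fx|Fx _] := eqVneq (F x) 0.
  by rewrite Fx add0r => /sG h j; rewrite lt_max h orbT.
by move: Fx => /sF h j; rewrite lt_max h.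
Qed.

Lemma test_opp G : test_function G -> test_function (fun x => - G x).
Proof.
move=> tG; rewrite (_ : (fun x => _) = fun x => -1 * G x).
  by apply: test_mulr => //; exact: cst_continuous.
by apply: funext => x; rewrite mulN1r.
Qed.

Lemma Rintegral_testD F G : test_function F -> test_function G ->
  \int[mu3]_t (F (pt t) + G (pt t)) =
  \int[mu3]_t F (pt t) + \int[mu3]_t G (pt t).
Proof. by move=> tF tG; apply: RintegralD => //; exact: test_integrable. Qed.

Lemma Rintegral_testN G : test_function G ->
  \int[mu3]_t (- G (pt t)) = - \int[mu3]_t G (pt t).
Proof.
move=> tG; rewrite -mulN1r -RintegralZl//; last exact: test_integrable.
by apply: eq_Rintegral => t _; rewrite mulN1r.
Qed.

Lemma Rintegral_partial0 (i : 'I_3) F G :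
  (forall x, is_derive x (delta_mx 0 i) F (G x)) ->
  test_function F -> test_function G -> \int[mu3]_t G (pt t) = 0.
Proof.
move=> hF [_ [M sF]] [cG [N sG]].
rewrite /Rintegral (@partial_integral0 _ i (Num.max 1 (Num.max M N)) F G)//.
- by rewrite lt_max ltr01.
- by apply: supported_le sF; rewrite !le_max lexx orbT.
- by apply: supported_le sG; rewrite !le_max lexx !orbT.
Qed.

Lemma Rintegral_extend (Om : set 'rV[R]_3) (f : R * R * R -> R) G :
  (forall t, Om (pt t) -> f t = G (pt t)) -> (forall x, ~ Om x -> G x = 0) ->
  \int[mu3]_(t in @pt R @^-1` Om) f t = \int[mu3]_t G (pt t).
Proof.
move=> fG G0; rewrite Rintegral_mkcond; apply: eq_Rintegral => t _.
rewrite patchE; case: ifPn => [/set_mem /fG //|/negP nO].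
by rewrite G0// => Ot; apply: nO; rewrite inE.
Qed.

(** G exceeds G x / 2 on a cube around x, and cubes have positive measure. *)
Lemma Rintegral_test_gt0 G x : test_function G -> (forall y, 0 <= G y) ->
  0 < G x -> 0 < \int[mu3]_t G (pt t).
Proof.
move=> tG G0 Gx.
have iG := test_integrable tG.
have : \forall y \near x, G x / 2 < G y.
  have h : G x / 2 < G x by rewrite ltr_pdivrMr// ltr_pMr// ltr1n.
  exact: (tG.1 x _ (open_nbhs_nbhs (conj (@open_gt R (G x / 2)) h))).
move=> /near_coordP[e e0 he].
pose B : set (measurableTypeR R * measurableTypeR R * measurableTypeR R)%type :=
  (ball (x 0 0) e `*` ball (x 0 1) e) `*` ball (x 0 2) e.
have mb (z : R) : measurable (ball z e : set (measurableTypeR R)).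
  by rewrite ball_itv; exact: measurable_itv.
have mB : measurable B by apply: measurableX => //; exact: measurableX.
have muB : (0 < mu3 B)%E.
  change (0 < product_measure1 (@lebesgue2 R) mu B)%E.
  rewrite /B product_measure1E//; last exact: measurableX.
  rewrite [X in (X * _)%E]product_measure1E//.
  have mub z : (0 < mu (ball z e : set (measurableTypeR R)))%E.
    by rewrite lebesgue_measure_ball ?ltW// lte_fin pmulrn_lgt0.
  by rewrite !mule_gt0 ?mub.
have hB t : B t -> G x / 2 < G (pt t).
  case: t => -[a b] c [[/= h0 h1] h2]; apply: he => j; move: j.
  by apply: ord3_ind; rewrite ptE distrC.
have lt : (0 < \int[mu3]_t (G (pt t))%:E)%E.
  apply: (@lt_le_trans _ _ (\int[mu3]_t ((G x / 2)%:E * (\1_B t)%:E)))%E.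
    rewrite ge0_integralZl//; first last.
    - by rewrite lee_fin divr_ge0// ltW.
    - exact/measurable_EFinP.
    rewrite integral_indic// setIT mule_gt0// lte_fin divr_gt0//.
  apply: ge0_le_integral => //.
  - by move=> t _; rewrite mule_ge0// lee_fin// divr_ge0// ltW.
  - by apply: measurable_funeM; exact/measurable_EFinP.
  - by have /integrableP[] := iG.
  - move=> t _; rewrite -EFinM lee_fin; have [Bt|nB] := pselect (B t).
      by rewrite indicE mem_set// mulr1 ltW// hB.
    by rewrite indicE memNset// mulr0.
rewrite /Rintegral fine_gt0// lt/=.
have /integrable_fin_num : mu3.-integrable setT (EFin \o (G \o @pt R)) by [].
by move=> /(_ measurableT) /=; rewrite fin_numE ltey => /andP[_].
Qed.
End SupportedIntegrals.

Section CurlFree.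
Variable R : realType.
Local Notation mu3 := (@lebesgue3 R).
Implicit Types (f g : 'rV[R]_3 -> R) (x a b : 'rV[R]_3) (i j l : 'I_3).

Lemma curl_algebra (w A : 'I_3 -> R) j :
  w 0 * ((0 + 2 == j)%:R * A (0 + 1) - (0 + 1 == j)%:R * A (0 + 2)) +
  w 1 * ((1 + 2 == j)%:R * A (1 + 1) - (1 + 1 == j)%:R * A (1 + 2)) +
  w 2 * ((2 + 2 == j)%:R * A (2 + 1) - (2 + 1 == j)%:R * A (2 + 2)) =
  w (j + 1) * A (j + 2) - w (j + 2) * A (j + 1).
Proof. by move: j; apply: ord3_ind; rewrite !ord3_add /=; ring. Qed.

Lemma compact_box a b : compact (box a b).
Proof.
have -> : box a b = [set x | forall j, `[a 0 j, b 0 j]%classic (x 0 j)].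
  by apply/seteqP; split=> x /= h j; have := h j; rewrite in_itv.
apply: (@rV_compact R 3 (fun j => `[a 0 j, b 0 j]%classic)) => j.
exact: segment_compact.
Qed.

Lemma partial_outside (K : set 'rV[R]_3) f i x : closed K ->
  (forall y, ~ K y -> f y = 0) -> ~ K x -> partial i f x = 0.
Proof.
move=> cK f0 nK; rewrite /partial (@near_eq_derive _ _ _ f (cst 0)).
  by rewrite derive_cst.
have : \forall y \near x, ~ K y.
  exact: (open_nbhs_nbhs (conj (closed_openC cK) nK)).
by apply: filterS => y /f0.
Qed.

Lemma test_compact (K : set 'rV[R]_3) f : compact K -> continuous f ->
  (forall x, ~ K x -> f x = 0) -> test_function f.
Proof.
move=> cK cf f0; split=> //.
have [M [_ hM]] := compact_bounded cK.
exists (`|M| + 2) => x fx.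
have Kx : K x by apply: contrapT => /f0/eqP; rewrite (negbTE fx).
have hx : `|x| <= `|M| + 1.
  by apply: hM => //; rewrite (le_lt_trans (ler_norm M))// ltrDl.
move=> j; apply: (@le_lt_trans _ _ `|x|).
  rewrite /Num.norm/= mx_normrE.
  exact: (le_bigmax _ (fun k : 'I_1 * 'I_3 => `|x k.1 k.2|) (0, j)).
by rewrite (le_lt_trans hx)// ltrD2l ltr1n.
Qed.

Variables (n : nat) (c : 'I_3 -> nat -> nat -> nat -> R).
Hypothesis hc : forall j, degree_le n.-1 (c j).
Variables (Om V : set 'rV[R]_3) (u cu : 'rV[R]_3 -> 'rV[R]_3).
Hypotheses (oV : open V) (VOm : V `<=` Om).
Hypothesis uE : forall x j, V x -> u x 0 j = peval n (c j) x.
Hypothesis ucu : is_curl Om u cu.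
Hypothesis cu0 : forall phi, test_field Om phi -> ip Om cu phi = 0.

(** If D, the j-th component of the classical curl of the polynomial field, is
    not zero at x, it keeps its sign on a box around x. Tested against e_j
    times a bump function supported there, the weak curl yields a zero
    integral; moving the derivatives from the bump function to the polynomials
    turns it into the integral of D times the bump function, which has a
    sign. *)
Lemma curl_free_peval j x : V x ->
  peval n (pdiff (j + 1) (c (j + 2))) x = peval n (pdiff (j + 2) (c (j + 1))) x.
Proof.
have alg (P1 P2 I1 I2 : R) :
    P1 + I2 = 0 -> P2 + I1 = 0 -> P1 - P2 = 0 -> I1 - I2 = 0 by lra.
move=> Vx0; apply/eqP; rewrite -subr_eq0; apply: contraT => Dx0.
pose D x := peval n (pdiff (j + 1) (c (j + 2))) x -
            peval n (pdiff (j + 2) (c (j + 1))) x.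
have cD : continuous D.
  rewrite /D; apply: continuous_addf; first exact: continuous_peval.
  rewrite (_ : (fun x => _) = fun x => -1 * peval n (pdiff (j + 2) (c (j + 1))) x).
    by apply: continuous_mulf; [exact: cst_continuous|exact: continuous_peval].
  by apply: funext => y; rewrite mulN1r.
(* Multiplying by the sign s of D x reduces both cases to one. *)
pose s := Num.sg (D x).
have : \forall y \near x, V y /\ 0 < s * D y.
  apply: filterI; first exact: (open_nbhs_nbhs (conj oV Vx0)).
  have csD : continuous (fun y => s * D y).
    by apply: continuous_mulf => //; exact: cst_continuous.
  have h : 0 < s * D x by rewrite -normrEsg normr_gt0.
  exact: (csD x _ (open_nbhs_nbhs (conj (@open_gt R 0) h))).
move=> /near_coordP[e e0 he].
have e20 : 0 < e / 2 by rewrite divr_gt0.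
pose a := x - const_mx (e / 2); pose b := x + const_mx (e / 2).
have Bx y : box a b y -> V y /\ 0 < s * D y.
  move=> hy; apply: he => k; have := hy k; rewrite !mxE => /andP[y1 y2].
  by rewrite ltr_norml; apply/andP; split; lra.
pose eta := bump a b.
have eta0 y : ~ box a b y -> eta y = 0.
  by move=> nb; apply/eqP; apply: contraT => /bump_supp.
have ceta m : Cn m eta by exact: Cn_bump.
have [ce hpe] := ceta 1.
have teta : test_function eta.
  by apply: (test_compact (@compact_box a b)).
have pe0 i y : ~ box a b y -> partial i eta y = 0.
  by apply: partial_outside => //; exact: closed_box.
have tpe i : test_function (partial i eta).
  apply: (test_compact (@compact_box a b)); first by case: (hpe i).
  by move=> y; exact: pe0.
pose phi y : 'rV[R]_3 := eta y *: delta_mx 0 j.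
have phiE k : (fun y => phi y 0 k) = fun y => eta y * (k == j)%:R.
  by apply: funext => y; rewrite !mxE eqxx.
have tphi : test_field Om phi.
  split=> [m k|].
    by rewrite phiE; apply: Cn_mul => //; exact: Cn_cst.
  exists (box a b); split; first exact: compact_box.
    by move=> y /Bx[/VOm].
  by move=> y /eta0; rewrite /phi => ->; rewrite scale0r.
have pphi i k y : partial i (fun y => phi y 0 k) y = (k == j)%:R * partial i eta y.
  rewrite phiE /partial.
  have := @is_deriveM _ _ eta (cst (k == j)%:R) y (delta_mx 0 i) (partial i eta y) 0.
  move=> /(_ (DeriveDef ((hpe i).1 y) erefl) (is_derive_cst _ _ _))[_].
  by rewrite scaler0 add0r => E; exact: E.
pose p := peval n (c (j + 1)); pose q := peval n (c (j + 2)).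
pose G y := p y * partial (j + 2) eta y + - (q y * partial (j + 1) eta y).
have IG : \int[mu3]_t G (pt t) = 0.
  rewrite -(cu0 tphi) -ucu.2//; apply/esym/Rintegral_extend => [t Ot|y nO]; last first.
    rewrite /G !pe0 ?mulr0 ?subr0//; by move=> /Bx[/VOm].
  have -> : dot (u (pt t)) (classical_curl phi (pt t)) =
      u (pt t) 0 (j + 1) * partial (j + 2) eta (pt t)
      - u (pt t) 0 (j + 2) * partial (j + 1) eta (pt t).
    rewrite dot3 /classical_curl !mxE !pphi.
    exact: (curl_algebra (u (pt t) 0) (fun i => partial i eta (pt t))).
  have [hb|nb] := pselect (box a b (pt t)); last by rewrite /G !pe0 ?mulr0 ?subr0.
  by have [Vt _] := Bx _ hb; rewrite /G /p /q !uE.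
have dprod i k : \int[mu3]_t (peval n (c k) (pt t) * partial i eta (pt t) +
     peval n (pdiff i (c k)) (pt t) * eta (pt t)) = 0.
  apply: (@Rintegral_partial0 _ i (fun x => peval n (c k) x * eta x)
    (fun x => peval n (c k) x * partial i eta x + peval n (pdiff i (c k)) x * eta x)).
  - move=> y; have := @is_deriveM _ _ (peval n (c k)) eta y (delta_mx 0 i) _ _
      (peval_is_partial y i (hc k)) (DeriveDef ((hpe i).1 y) erefl).
    by move=> H; apply: (is_derive_eq H); rewrite /GRing.scale/= [eta y * _]mulrC.
  - by apply: test_mulr => //; exact: continuous_peval.
  - by apply: test_addf; apply: test_mulr => //; exact: continuous_peval.
have tpq i k : test_function (fun y => peval n (c k) y * partial i eta y).
  by apply: test_mulr => //; exact: continuous_peval.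
have tde i k : test_function (fun y => peval n (pdiff i (c k)) y * eta y).
  by apply: test_mulr => //; exact: continuous_peval.
have ID : \int[mu3]_t (D (pt t) * eta (pt t)) = 0.
  have h1 := dprod (j + 2) (j + 1); have h2 := dprod (j + 1) (j + 2).
  rewrite (Rintegral_testD (tpq _ _) (tde _ _)) in h1.
  rewrite (Rintegral_testD (tpq _ _) (tde _ _)) in h2.
  have h3 := IG; rewrite (Rintegral_testD (tpq _ _) (test_opp (tpq _ _))) in h3.
  rewrite (Rintegral_testN (tpq _ _)) in h3.
  transitivity (\int[mu3]_t (peval n (pdiff (j + 1) (c (j + 2))) (pt t) * eta (pt t)
     + - (peval n (pdiff (j + 2) (c (j + 1))) (pt t) * eta (pt t)))).
    by apply: eq_Rintegral => t _; rewrite /D mulrBl.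
  rewrite (Rintegral_testD (tde _ _) (test_opp (tde _ _))).
  rewrite (Rintegral_testN (tde _ _)).
  exact: (alg _ _ _ _ h1 h2 h3).
have tD : test_function (fun y => s * (D y * eta y)).
  apply: test_mulr; first exact: cst_continuous.
  exact: test_mulr.
have := @Rintegral_test_gt0 _ _ x tD.
rewrite RintegralZl//; last first.
  exact: (@test_integrable R (fun y => D y * eta y) (test_mulr cD teta)).
rewrite ID mulr0 ltxx => H; suff : false by []; apply: H.
  move=> y; have [hb|nb] := pselect (box a b y); last by rewrite eta0 ?mulr0.
  rewrite mulrA mulr_ge0 ?bump_ge0//; apply: ltW; by case: (Bx y hb).
rewrite mulrA mulr_gt0//; last first.
  by apply: bump_gt0 => k; rewrite !mxE ltrBlDr !ltrDl !e20.
by have [] : V x /\ 0 < s * D x by apply: he => k; rewrite subrr normr0.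
Qed.
End CurlFree.

Section GradientFromPartials.
Variable R : realType.
Local Notation mu3 := (@lebesgue3 R).
Variables (Om : set 'rV[R]_3) (q : 'rV[R]_3 -> R) (u : 'rV[R]_3 -> 'rV[R]_3).
Hypotheses (oOm : open Om) (Lu : L2v Om u).
Hypothesis cq : forall x, Om x -> {for x, continuous q}.
Hypothesis cu : forall x, Om x -> forall i, {for x, continuous (fun x => u x 0 i)}.
Hypothesis dq : forall x, Om x -> forall i : 'I_3,
  is_derive x (delta_mx 0 i) q (u x 0 i).

Lemma test_local (K : set 'rV[R]_3) g : compact K -> K `<=` Om ->
  (forall x, Om x -> {for x, continuous g}) -> (forall x, ~ K x -> g x = 0) ->
  test_function g.
Proof.
move=> cK KO cg g0; apply: (test_compact cK) => // x.
have [Ox|nOx] := pselect (Om x); first exact: cg.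
have nK : ~ K x by move=> /KO.
have : \forall y \near x, g x = g y.
  have : \forall y \near x, ~ K y.
    apply: (open_nbhs_nbhs (conj (closed_openC _) nK)).
    by apply: compact_closed => //; exact: norm_hausdorff.
  by apply: filterS => y nKy; rewrite !g0.
move=> h P hP; apply: filterS h => y /= <-; exact: nbhs_singleton hP.
Qed.

(** The product of q with a component of a test field, extended by zero outside
    Om, has continuous partial derivatives, whose integrals vanish. *)
Lemma is_grad_of_partials : is_grad Om q u.
Proof.
have alg (a0 a1 a2 b0 b1 b2 : R) : a0 + b0 = 0 -> a1 + b1 = 0 -> a2 + b2 = 0 ->
    a0 + a1 + a2 = - (b0 + b1 + b2) by lra.
split=> // phi [sphi [K [cK KO phi0]]].
have clK : closed K by apply: compact_closed => //; exact: norm_hausdorff.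
have phi0j j x : ~ K x -> phi x 0 j = 0 by move=> /phi0 ->; rewrite mxE.
have cphi j : continuous (fun x => phi x 0 j) by case: (sphi 1%N j).
have dphi j i x : derivable (fun x => phi x 0 j) x (delta_mx 0 i).
  by case: (sphi 1%N j) => _ /(_ i)[h _]; exact: h.
have cdphi j i : continuous (partial i (fun x => phi x 0 j)).
  by case: (sphi 1%N j) => _ /(_ i)[_ h].
have dphi0 j i x : ~ K x -> partial i (fun x => phi x 0 j) x = 0.
  by apply: partial_outside => // y; exact: phi0j.
pose F i x := q x * phi x 0 i.
pose G1 i x := q x * partial i (fun x => phi x 0 i) x.
pose G2 i x := u x 0 i * phi x 0 i.
have tF i : test_function (F i).
  apply: (test_local cK KO) => [x Ox|x nK]; last by rewrite /F phi0j ?mulr0.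
  exact: (@continuousM _ _ q (fun x => phi x 0 i) x (cq Ox) (cphi i x)).
have tG1 i : test_function (G1 i).
  apply: (test_local cK KO) => [x Ox|x nK]; last by rewrite /G1 dphi0 ?mulr0.
  exact: (@continuousM _ _ q (partial i (fun x => phi x 0 i)) x (cq Ox) (cdphi i i x)).
have tG2 i : test_function (G2 i).
  apply: (test_local cK KO) => [x Ox|x nK]; last by rewrite /G2 phi0j ?mulr0.
  exact: (@continuousM _ _ (fun x => u x 0 i) (fun x => phi x 0 i) x (@cu x Ox i) (cphi i x)).
have IG i : \int[mu3]_t G1 i (pt t) + \int[mu3]_t G2 i (pt t) = 0.
  rewrite -(Rintegral_testD (tG1 i) (tG2 i)).
  apply: (@Rintegral_partial0 _ i (F i) (fun x => G1 i x + G2 i x)) => //;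
    last exact: test_addf.
  move=> x; have [Ox|nOx] := pselect (Om x).
    have H := @is_deriveM _ _ q (fun x => phi x 0 i) x (delta_mx 0 i) _ _ (@dq x Ox i)
      (DeriveDef (dphi i i x) erefl).
    apply: (is_derive_eq H); rewrite /G1 /G2 /partial /GRing.scale/=.
    by rewrite [phi x 0 i * _]mulrC.
  have nK : ~ K x by move=> /KO.
  rewrite /G1 /G2 dphi0// phi0j// !mulr0 addr0.
  apply: (@near_eq_is_derive _ _ _ (cst 0) (F i) x (delta_mx 0 i) 0 _ (is_derive_cst _ _ _)).
  have : \forall y \near x, ~ K y.
    exact: (open_nbhs_nbhs (conj (closed_openC clK) nK)).
  by apply: filterS => y nKy; rewrite /F phi0j// mulr0.
have E1 : ips Om q (classical_div phi) =
    \int[mu3]_t G1 0 (pt t) + \int[mu3]_t G1 1 (pt t) + \int[mu3]_t G1 2 (pt t).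
  rewrite -(Rintegral_testD (tG1 0) (tG1 1)).
  rewrite -(Rintegral_testD (test_addf (tG1 0) (tG1 1)) (tG1 2)).
  apply: (Rintegral_extend (G := fun x => G1 0 x + G1 1 x + G1 2 x)).
    by move=> t Ot; rewrite /classical_div sum3 /G1 !mulrDr.
  by move=> x nOx; rewrite /G1 !dphi0 ?mulr0 ?addr0// => /KO.
have E2 : ip Om u phi =
    \int[mu3]_t G2 0 (pt t) + \int[mu3]_t G2 1 (pt t) + \int[mu3]_t G2 2 (pt t).
  rewrite -(Rintegral_testD (tG2 0) (tG2 1)).
  rewrite -(Rintegral_testD (test_addf (tG2 0) (tG2 1)) (tG2 2)).
  apply: (Rintegral_extend (G := fun x => G2 0 x + G2 1 x + G2 2 x)).
    by move=> t Ot; rewrite dot3.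
  by move=> x nOx; rewrite /G2 !phi0j ?mulr0 ?addr0// => /KO.
rewrite E1 E2; have I0 := IG 0; have I1 := IG 1; have I2 := IG 2.
exact: alg I0 I1 I2.
Qed.
End GradientFromPartials.

(** * Primitives of fields that are piecewise gradients *)

Lemma near_all_seq (S : eqType) (X : Type) (F : set_system X) (s : seq S)
    (P : S -> set X) : Filter F -> (forall k, k \in s -> F (P k)) ->
  \forall x \near F, forall k, k \in s -> P k x.
Proof.
move=> FF; elim: s => [|k s IH] h; first by near=> x.
have h1 : F (P k) by apply: h; rewrite mem_head.
have h2 : \forall x \near F, forall k, k \in s -> P k x.
  by apply: IH => l ls; apply: h; rewrite inE ls orbT.
by apply: filterS2 h1 h2 => x h1 h2 l; rewrite inE => /orP[/eqP ->//|/h2].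
Unshelve. all: by end_near. Qed.

Section Tetrahedra.
Variable R : realType.
Implicit Types (K : 'M[R]_(4, 3)) (x y z : 'rV[R]_3).

Lemma convex_tetra K : convex_set (tetra K).
Proof.
move=> x y t [c [c0 cS c1 ->]] [d [d0 dS d1 ->]] /andP[t0 t1].
exists (fun a => (1 - t) * c a + t * d a); split.
- by move=> a; rewrite addr_ge0// mulr_ge0// subr_ge0.
- by move=> a aS; rewrite cS// dS// !mulr0 addr0.
- by rewrite big_split/= -!mulr_sumr c1 d1; ring.
- rewrite -sumrB scaler_sumr -big_split/=; apply: eq_bigr => a _.
  by apply/rowP => j; rewrite !mxE; ring.
Qed.

Definition edges K : 'M[R]_3 := \matrix_(i < 3) (row (lift ord0 i) K - row ord0 K).

(** The barycentric coordinate of the vertex lift ord0 i, as an affine function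
    of the point; the one of the vertex ord0 is 1 minus the sum. *)
Definition bary K (i : 'I_3) x : R := dot (col i (invmx (edges K)))^T (x - row ord0 K).

Lemma baryE K x i : bary K i x = ((x - row ord0 K) *m invmx (edges K)) 0 i.
Proof. by rewrite /bary /dot mxE; apply: eq_bigr => k _; rewrite !mxE mulrC. Qed.

Lemma tetraE K x : nondegenerate_tetra K ->
  tetra K x <-> (forall i, 0 <= bary K i x) /\ \sum_i bary K i x <= 1.
Proof.
move=> nd; have uK : edges K \in unitmx by rewrite -row_free_unit.
split=> [[c [c0 _ c1 ->]]|[b0 b1]].
  have bE i : bary K i (\sum_a c a *: row a K) = c (lift ord0 i).
    rewrite baryE (_ : _ - _ = (\row_i c (lift ord0 i)) *m edges K).
      by rewrite mulmxK// mxE.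
    rewrite mulmx_sum_row big_ord_recl/=.
    have -> : c ord0 = 1 - \sum_(i < 3) c (lift ord0 i).
      by rewrite -c1 big_ord_recl/= addrK.
    rewrite scalerBl scale1r addrAC addrAC.
    rewrite [_ - _ + _ - _]addrC !addrA addNr add0r addrC scaler_suml -sumrB.
    by apply: eq_bigr => k _; rewrite mxE rowK scalerBr.
  split=> [i|]; first by rewrite bE.
  under eq_bigr do rewrite bE.
  by rewrite -c1 [leRHS]big_ord_recl/= lerDr.
pose c a := if unlift ord0 a is Some i then bary K i x
            else 1 - \sum_i bary K i x.
have cl i : c (lift ord0 i) = bary K i x by rewrite /c liftK.
have c0 : c ord0 = 1 - \sum_i bary K i x by rewrite /c unlift_none.
exists c; split=> //.
- by move=> a; rewrite /c; case: unliftP => [i _|_] //; rewrite subr_ge0.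
- rewrite big_ord_recl; under eq_bigr do rewrite cl.
  by rewrite c0 subrK.
- rewrite big_ord_recl; under eq_bigr do rewrite cl.
  rewrite c0.
  have {1}-> : x = row ord0 K + (x - row ord0 K) *m invmx (edges K) *m edges K.
    by rewrite mulmxKV// addrC subrK.
  rewrite mulmx_sum_row scalerBl scale1r -addrA; congr (_ + _).
  rewrite scaler_suml addrC -sumrB; apply: eq_bigr => k _.
  by rewrite rowK baryE scalerBr.
Qed.

Lemma continuous_bary K i : continuous (bary K i).
Proof.
rewrite (_ : bary K i = fun x => dot (col i (invmx (edges K)))^T x
   + - dot (col i (invmx (edges K)))^T (row ord0 K)).
  by apply: continuous_addf; [exact: dot_continuous|exact: cst_continuous].
by apply: funext => x; rewrite /bary dotBr.
Qed.

Lemma closed_tetra K : nondegenerate_tetra K -> closed (tetra K).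
Proof.
move=> nd.
have -> : tetra K = (\bigcap_(i in [set: 'I_3]) (bary K i @^-1` [set t | 0 <= t]))
    `&` ((fun x => \sum_i bary K i x) @^-1` [set t | t <= 1]).
  apply/seteqP; split=> x; rewrite tetraE//.
    by move=> [b0 b1]; split=> // i _; exact: b0.
  by move=> [b0 b1]; split=> // i; exact: b0.
apply: closedI.
  apply: closed_bigI => i _; apply: closed_comp; last exact: closed_ge.
  by move=> x _; exact: continuous_bary.
apply: closed_comp; last exact: closed_le.
by move=> x _; apply: continuous_sum_ord => i; exact: continuous_bary.
Qed.

Lemma tetra_interior K : nondegenerate_tetra K ->
  exists V, [/\ open V, V !=set0 & V `<=` tetra K].
Proof.
move=> nd; have uK : edges K \in unitmx by rewrite -row_free_unit.
exists ((bary K 0 @^-1` [set t | 0 < t] `&` bary K 1 @^-1` [set t | 0 < t])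
  `&` (bary K 2 @^-1` [set t | 0 < t] `&`
   (fun x => \sum_i bary K i x) @^-1` [set t | t < 1])); split.
- do !apply: openI; apply: open_comp; try exact: open_gt; try exact: open_lt.
  + by move=> x _; exact: continuous_bary.
  + by move=> x _; exact: continuous_bary.
  + by move=> x _; exact: continuous_bary.
  + by move=> x _; apply: continuous_sum_ord => i; exact: continuous_bary.
- exists (row ord0 K + const_mx 4^-1 *m edges K).
  have bE i : bary K i (row ord0 K + const_mx 4^-1 *m edges K) = 4^-1.
    by rewrite baryE [row _ _ + _]addrC addrK mulmxK// mxE.
  by split; split; rewrite /= ?sum3 !bE//; lra.
- move=> x [[/= b0 b1] [b2 b3]]; apply/tetraE => //; split; last exact: ltW.
  by apply: ord3_ind; exact: ltW.
Qed.
End Tetrahedra.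

Section LocalPotential.
Variables (R : realType) (m1 m2 : nat).
Variables (a : 'I_m1 -> 'I_m2 -> 'rV[R]_3) (b : 'I_m1 -> 'I_m2 -> R).
Local Notation C := (constraints a b).
Variables (Om : set 'rV[R]_3) (u : 'rV[R]_3 -> 'rV[R]_3).
Hypotheses (oOm : open Om) (clOm : closure Om = C) (intC : C° `<=` Om).
Hypothesis cu : {within closure Om, continuous u}.
Hypothesis tru : forall x nu, outward_normal Om x nu -> cross (u x) nu = 0.
Variables (T : seq 'M[R]_(4, 3)) (n : nat).
Variable (e : 'M[R]_(4, 3) -> nat -> nat -> nat -> R).
Hypothesis CT : C = \bigcup_(K in [set` T]) tetra K.
Hypothesis ndT : forall K, K \in T -> nondegenerate_tetra K.
Hypothesis deg_e : forall K, K \in T -> degree_le n.-1 (e K).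
Hypothesis grad_e : forall K x l, K \in T -> tetra K x ->
  peval n (pdiff l (e K)) x = u x 0 l.
Implicit Types (K L : 'M[R]_(4, 3)) (x y z : 'rV[R]_3).

Local Notation psi K := (peval n (e K)).

Lemma psi_segment K z x (t : R) : K \in T -> tetra K z -> tetra K x ->
  0 <= t <= 1 ->
  is_derive t 1 (fun t => psi K (z + t *: (x - z)))
    (dot (u (z + t *: (x - z))) (x - z)).
Proof.
move=> KT Kz Kx ht; have := peval_line_derive z (x - z) t (deg_e KT).
rewrite !(grad_e _ KT (convex_tetra Kz Kx ht)) dot3.
by rewrite ![u _ _ _ * _]mulrC.
Qed.

Lemma segment_ends (g : R -> R) (dg : R -> R) :
  (forall t : R, 0 <= t <= 1 -> is_derive t 1 g (dg t)) ->
  (forall t, 0 < t < 1 -> dg t = 0) -> g 1 = g 0.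
Proof.
move=> hg dg0.
have [t|t ht|t] := @MVT R g dg 0 1 ltr01.
- by rewrite in_itv/= => /andP[t0 t1]; apply: hg; rewrite !ltW.
- apply: derivable_within_continuous => s; rewrite in_itv/= => hs.
  by case: (hg s hs).
rewrite in_itv/= => /dg0 ->; rewrite mul0r => /eqP.
by rewrite subr_eq0 => /eqP.
Qed.

(** Along the segment from z to x, contained in both tetrahedra, psi K and psi L
    have the same derivative, the component of u along the segment. *)
Lemma psi_agree K L z x : K \in T -> L \in T -> tetra K z -> tetra K x ->
  tetra L z -> tetra L x -> psi K x - psi K z = psi L x - psi L z.
Proof.
move=> KT LT Kz Kx Lz Lx.
have h t (ht : 0 <= t <= 1) := is_deriveB (psi_segment KT Kz Kx ht)
   (psi_segment LT Lz Lx ht).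
have : psi K (z + 1 *: (x - z)) - psi L (z + 1 *: (x - z)) =
    psi K (z + 0 *: (x - z)) - psi L (z + 0 *: (x - z)).
  exact: (segment_ends h (fun t _ => subrr _)).
rewrite !scale1r !scale0r !addr0 [z + _]addrC subrK; lra.
Qed.

(** The integral from z to a nearby x of the field u extended by zero outside the
    mesh. The value does not depend on the tetrahedron, by [psi_agree]. *)
Definition increment z x : R :=
  if pselect (exists K, [/\ K \in T, tetra K z & tetra K x]) is left h
  then psi (projT1 (cid h)) x - psi (projT1 (cid h)) z else 0.

Lemma incrementE K z x : K \in T -> tetra K z -> tetra K x ->
  increment z x = psi K x - psi K z.
Proof.
move=> KT Kz Kx; rewrite /increment; case: pselect => [h|[]]; last by exists K.
by case: cid => L /= [LT Lz Lx]; exact: psi_agree.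
Qed.

Lemma increment_out z x :
  (forall K, K \in T -> tetra K z -> tetra K x -> False) -> increment z x = 0.
Proof.
by move=> h; rewrite /increment; case: pselect => // -[K [KT Kz Kx]]; case: (h K).
Qed.

Lemma tetra_near z : \forall x \near z, forall K, K \in T -> tetra K x -> tetra K z.
Proof.
apply: (near_all_seq (F := nbhs z) (P := fun K x => tetra K x -> tetra K z)) => K KT.
have [Kz|nKz] := pselect (tetra K z); first by near=> x.
have : \forall x \near z, ~ tetra K x.
  exact: (open_nbhs_nbhs (conj (closed_openC (closed_tetra (ndT KT))) nKz)).
by apply: filterS => x nx /nx.
Unshelve. all: by end_near. Qed.

(** Near z the segment from z to a frontier point stays in the frontier, where u
    has no component along it. *)
Lemma increment_frontier z : frontier a b z -> \forall x \near z,
  frontier a b x -> increment z x = 0.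
Proof.
move=> fz; have := tangential_on_frontier oOm clOm intC cu tru fz.
apply: filterS => x hx /hx {}hx.
have [[K [KT Kz Kx]]|nK] := pselect (exists K, [/\ K \in T, tetra K z & tetra K x]).
  rewrite (incrementE KT Kz Kx).
  have h t (ht : 0 <= t <= 1) := psi_segment KT Kz Kx ht.
  have := segment_ends h hx.
  by rewrite scale1r scale0r addr0 [z + _]addrC subrK => ->; rewrite subrr.
by apply: increment_out => K KT Kz Kx; apply: nK; exists K.
Qed.

(** With x close to z and then y close to x, a tetrahedron that contains y also
    contains x and z; if there is one, the three increments are differences of
    the same potential. If there is none, y is outside, so x is not interior
    to C: either no tetrahedron contains both x and z, or both are frontier
    points. In either case all three increments vanish. *)
Lemma increment_cocycle z : \forall x \near z, \forall y \near x,
  increment z y - increment z x = increment x y.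
Proof.
have n1 := near_join (tetra_near z).
have n2 : \forall x \near z, C z -> ~ frontier a b z -> nbhs x C.
  have [zC|nzC] := pselect (nbhs z C).
    by have := near_join zC; apply: filterS.
  by near=> x => Cz nf; exfalso; apply: nf.
have n3 : \forall x \near z, frontier a b z -> frontier a b x -> increment z x = 0.
  have [fz|nfz] := pselect (frontier a b z); last by near=> x.
  exact: filterS (fun x h _ => h) (increment_frontier fz).
near=> x.
have h1 : \forall y \near x, forall K, K \in T -> tetra K y -> tetra K z.
  by near: x; exact: n1.
have h2 : C z -> ~ frontier a b z -> nbhs x C by near: x; exact: n2.
have h3 : frontier a b z -> frontier a b x -> increment z x = 0.
  by near: x; exact: n3.
have h4 : \forall y \near x, nbhs x C -> C y.
  have [xC|nxC] := pselect (nbhs x C); last by near=> y.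
  exact: filterS (fun y Cy _ => Cy) xC.
have h5 := tetra_near x.
near=> y.
have yz : forall K, K \in T -> tetra K y -> tetra K z by near: y; exact: h1.
have yx : forall K, K \in T -> tetra K y -> tetra K x by near: y; exact: h5.
have yC : nbhs x C -> C y by near: y; exact: h4.
have [Cy|nCy] := pselect (C y).
  have := Cy; rewrite CT => -[K KT Ky].
  have Kz := yz K KT Ky; have Kx := yx K KT Ky.
  rewrite (incrementE KT Kz Ky) (incrementE KT Kz Kx) (incrementE KT Kx Ky); ring.
have out w : increment w y = 0.
  by apply: increment_out => K KT _ Ky; apply: nCy; rewrite CT; exists K.
rewrite !out sub0r; apply/eqP; rewrite oppr_eq0; apply/eqP.
have [[K [KT Kz Kx]]|nK] :=
  pselect (exists K, [/\ K \in T, tetra K z & tetra K x]); last first.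
  by apply: increment_out => K KT Kz Kx; apply: nK; exists K.
have Cz : C z by rewrite CT; exists K.
have Cx : C x by rewrite CT; exists K.
have nxC : ~ nbhs x C by move=> /yC.
apply: h3; last by split.
by apply: contrapT => nf; apply: nxC; exact: h2.
Unshelve. all: by end_near. Qed.

Variables (M : R) (f : 'rV[R]_3 -> R).
Hypothesis primf : primitive increment (cube M) f.

Lemma primitive_continuous z : cube M z -> forall eps : R, 0 < eps ->
  \forall x \near z, cube M x -> `|f x - f z| < eps.
Proof.
move=> Mz eps eps0.
have h : \forall x \near z, forall K, K \in T -> `|psi K x - psi K z| < eps.
  apply: (near_all_seq (F := nbhs z) (P := fun K x => `|psi K x - psi K z| < eps)).
  move=> K KT; have cK := @continuous_peval R n (e K) z.
  have : \forall x \near z, ball (psi K z) eps (psi K x).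
    exact: (cK _ (nbhsx_ballx (psi K z) eps eps0)).
  by apply: filterS => x; rewrite /ball/= distrC.
apply: filterS2 h (primf Mz) => x hx fx /fx ->.
have [[K [KT Kz Kx]]|nK] := pselect (exists K, [/\ K \in T, tetra K z & tetra K x]).
  by rewrite (incrementE KT Kz Kx); exact: hx.
rewrite increment_out ?normr0// => K KT Kz Kx; apply: nK.
by exists K.
Qed.

(** Points of the mesh outside Om are frontier points, so between nearby
    points outside Om the increment is 0. *)
Lemma primitive_locally_constant z : cube M z -> ~ Om z ->
  \forall x \near z, cube M x -> ~ Om x -> f x = f z.
Proof.
move=> Mz nOz.
have fr x K : K \in T -> tetra K x -> ~ Om x -> frontier a b x.
  move=> KT Kx nOx; split; first by rewrite CT; exists K.
  by move=> nC; apply: nOx; exact: intC.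
suff h : \forall x \near z, ~ Om x -> increment z x = 0.
  apply: filterS2 h (primf Mz) => x hx fx Mx nOx.
  by apply/eqP; rewrite -subr_eq0 (fx Mx) (hx nOx).
have [fz|nfz] := pselect (frontier a b z); last first.
  near=> x => _; apply: increment_out => K KT Kz _; apply: nfz.
  exact: (fr _ _ KT Kz nOz).
apply: filterS (increment_frontier fz) => x hx nOx.
have [/hx //|nfx] := pselect (frontier a b x).
by apply: increment_out => K KT _ Kx; apply: nfx; exact: (fr _ _ KT Kx nOx).
Unshelve. all: by end_near. Qed.

Hypothesis OmM : Om `<=` cube M.

Lemma primitive_derive x (i : 'I_3) : Om x ->
  is_derive x (delta_mx 0 i) f (u x 0 i).
Proof.
move=> Ox; apply/is_derive_lineP => eps eps0.
have nO : \forall y \near x, Om y by exact: (open_nbhs_nbhs (conj oOm Ox)).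
have h1 : \forall y \near x, exists K, [/\ K \in T, tetra K x &
    f y - f x = psi K y - psi K x].
  apply: filterS3 nO (tetra_near x) (primf (OmM Ox)) => y Oy hK fy.
  have : C y by rewrite -clOm; exact: subset_closure.
  rewrite CT => -[K KT Ky]; exists K; split=> //; first exact: hK.
  by rewrite fy ?(incrementE KT (hK K KT Ky) Ky)//; exact: OmM.
have h2 : \forall h \near (0 : R)^', exists K, [/\ K \in T, tetra K x &
    f (x + h *: delta_mx 0 i) - f x = psi K (x + h *: delta_mx 0 i) - psi K x].
  apply: nbhs_dnbhs.
  have := @segment_cvg R x (x + delta_mx 0 i) 0 [set y | exists K, [/\ K \in T,
    tetra K x & f y - f x = psi K y - psi K x]].
  by rewrite scale0r addr0 [x + delta_mx 0 i]addrC addrK; apply.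
have h3 : \forall h \near (0 : R)^', forall K, K \in T -> tetra K x ->
    `|u x 0 i - h^-1 * (psi K (x + h *: delta_mx 0 i) - psi K x)| < eps.
  apply: (near_all_seq (F := (0 : R)^') (P := fun K h => tetra K x ->
    `|u x 0 i - h^-1 * (psi K (x + h *: delta_mx 0 i) - psi K x)| < eps)).
  move=> K KT; have [Kx|nKx] := pselect (tetra K x); last by near=> h.
  have /is_derive_lineP/(_ _ eps0) := peval_is_partial x i (deg_e KT).
  by rewrite (grad_e _ KT Kx); apply: filterS.
by apply: filterS2 h2 h3 => h [K [KT Kx ->]]; apply.
Unshelve. all: by end_near. Qed.

Lemma primitive_poly K : K \in T -> tetra K `<=` cube M ->
  exists c, forall x, tetra K x -> f x = psi K x + c.
Proof.
move=> KT KM; have [[x0 Kx0]|/forallNP nK] := pselect (exists x, tetra K x).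
  exists (f x0 - psi K x0) => x Kx.
  suff <- : f x - psi K x = f x0 - psi K x0 by rewrite addrC subrK.
  apply: (locally_constant_convex (k := fun x => f x - psi K x)
    (@convex_tetra R K)) => // z Kz.
  apply: filterS (primf (KM _ Kz)) => y fy Ky.
  have := fy (KM _ Ky); rewrite (incrementE KT Kz Ky); lra.
by exists 0 => x /nK.
Qed.
End LocalPotential.

(** * The complement of a contractible set *)

Section Contractible.
Variable R : realType.
Variables (Om : set 'rV[R]_3) (M : R) (f : 'rV[R]_3 -> R).
Hypotheses (oOm : open Om) (OmM : forall x, Om x -> forall j, `|x 0 j| < M).
Hypothesis cOm : contractible R Om.
Hypothesis cf : forall z, cube M z -> forall e : R, 0 < e ->
  \forall x \near z, cube M x -> `|f x - f z| < e.
Hypothesis lf : forall z, cube M z -> ~ Om z ->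
  \forall x \near z, cube M x -> ~ Om x -> f x = f z.
Implicit Types (x y z : 'rV[R]_3).

Lemma contraction : exists x0 (H : 'rV[R]_3 * R -> 'rV[R]_3),
  [/\ Om x0, {within Om `*` `[0, 1], continuous H},
      forall x t, Om x -> 0 <= t <= 1 -> Om (H (x, t)),
      forall x, Om x -> H (x, 0) = x0 & forall x, Om x -> H (x, 1) = x].
Proof.
have [h [g [ch hh cg hg [[H [cH HA H0 H1]] _]]]] := cOm.
exists (g 0), H; split=> //; first exact: hg.
by move=> x Ox; rewrite H0//=; have -> : h x = 0 := hh x Ox.
Qed.

(** The faces of the cube lie outside Om, so f is constant on each. From the face
    where the j-th coordinate is s one passes to the adjacent face where the
    next coordinate is M, and there to the corner. *)
Lemma face_constant x (j : 'I_3) (s : R) : `|s| = M -> cube M x -> x 0 j = s ->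
  f x = f (const_mx M).
Proof.
have convF i w : convex_set [set x | cube M x /\ x 0 i = w].
  move=> y z t [My yi] [Mz zi] /andP[t0 t1]; split.
    move=> k; rewrite !mxE ler_norml; have := My k; have := Mz k.
    by rewrite !ler_norml => /andP[? ?] /andP[? ?]; apply/andP; split; nra.
  by rewrite !mxE yi zi subrr mulr0 addr0.
have cstF i w y z : `|w| = M -> cube M y -> cube M z -> y 0 i = w -> z 0 i = w ->
    f y = f z.
  move=> wM My Mz yw zw.
  apply: (locally_constant_convex (convF i w)) => // v [Mv vi].
  have nO (v' : 'rV[R]_3) : v' 0 i = w -> ~ Om v'.
    by move=> v'w /OmM/(_ i); rewrite v'w wM ltxx.
  have := lf Mv (nO _ vi); apply: filterS => v' h [Mv' v'i]; apply: h => //.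
  exact: nO.
move=> sM Mx xj.
have M0 : 0 <= M by rewrite -sM.
pose x' : 'rV[R]_3 := \row_k if k == j then s else M.
have Mx' : cube M x'.
  by move=> k; rewrite mxE; case: ifP => _; rewrite ?sM// ger0_norm.
have Mc : cube M (const_mx M) by move=> k; rewrite mxE ger0_norm.
rewrite (cstF j s x x')//; last by rewrite mxE eqxx.
apply: (cstF (j + 1) M) => //; rewrite ?ger0_norm// mxE//.
by case: ifPn => // /eqP; move: {+}j; apply: ord3_ind.
Qed.

(** Suppose that f takes at y, outside Om, another value than on the faces of the
    cube, and let g be the distance of f to the latter value. Outside Om the
    values of g avoid an interval just below g y, so a band of level sets of
    g lies in Om and separates y from the faces. Let G be x - y where g is below
    the band, x0 - y where g is above it, and across the band H - y, where
    H runs the contraction of Om from x back to x0. Then G is continuous,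
    equal to x - y on the faces, and has no zero since H stays in Om: this
    contradicts the Poincare-Miranda theorem. *)
Lemma constant_outside y : cube M y -> ~ Om y -> f y = f (const_mx M).
Proof.
move=> My nOy; apply: contrapT => fy.
have [x0 [H [Ox0 cH HOm H0 H1]]] := contraction.
pose c0 := f (const_mx M); pose g x := `|f x - c0|; pose b := g y.
have b0 : 0 < b by rewrite normr_gt0 subr_eq0; apply/eqP.
have My' j : `|y 0 j| < M.
  rewrite lt_neqAle My andbT; apply/eqP => yM.
  by apply: fy; exact: (face_constant yM My erefl).
have M0 : 0 < M by rewrite (le_lt_trans _ (My' 0)).
have cg z : cube M z -> forall e : R, 0 < e ->
    \forall x \near z, cube M x -> `|g x - g z| < e.
  move=> Mz e e0; have := cf Mz e0; apply: filterS => x h /h.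
  apply: le_lt_trans; rewrite (le_trans (ler_dist_dist _ _))//.
  by rewrite opprB addrA subrK.
(* Outside Om the function g is locally constant, so by compactness there is a
   gap below the value b. *)
have [d d0 hd] : exists2 d : R, 0 < d & forall x, cube M x -> ~ Om x ->
    g x < b -> g x <= b - d.
  have [|d d0 hd] := @lebesgue_number R (cube M)
      (fun x d => cube M x -> ~ Om x -> g x < b -> g x <= b - d)
      (@compact_cube R M).
    move=> z Mz; have [Oz|nOz] := pselect (Om z).
      have /near_coordP[e e0 he] : nbhs z Om by exact: (open_nbhs_nbhs (conj oOm Oz)).
      by exists e => // x d' hx _ _ _ nOx; exfalso; apply: nOx; exact: he.
    have /near_coordP[e e0 he] := lf Mz nOz.
    have [gz|gz] := ltP (g z) b.
      exists (Num.min e (b - g z)); first by rewrite lt_min e0 subr_gt0.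
      move=> x d' hx _; rewrite lt_min => /andP[_ hd'] Mx nOx _.
      rewrite /g (he x)//; first by rewrite lerBrDr -lerBrDl ltW.
      by move=> j; have := hx j; rewrite lt_min => /andP[].
    exists e => // x d' hx _ _ Mx nOx; rewrite /g (he x)// => hgz.
    by move: gz; rewrite leNgt hgz.
  by exists d => // x Mx; exact: hd.
(* The band c1 <= g <= c2 sits inside the gap; s is 0 below it and 1 above it. *)
pose c1 := b - 2 * d / 3; pose c2 := b - d / 3.
pose s x := Num.min 1 (Num.max 0 ((g x - c1) / (d / 3))).
have s01 x : 0 <= 1 - s x <= 1.
  by rewrite /s subr_ge0 gerBl ge_min lexx le_min ler01 le_max lexx.
have d30 : 0 < d / 3 by rewrite divr_gt0.
have s_lo x : g x < c1 -> s x = 0.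
  move=> h; rewrite /s max_l; first by rewrite min_r.
  by rewrite ler_pdivrMr// mul0r subr_le0 ltW.
have s_hi x : c2 < g x -> s x = 1.
  move=> h; rewrite /s min_l// le_max; apply/orP; right.
  by rewrite ler_pdivlMr// mul1r /c1; move: h; rewrite /c2; lra.
pose G x := if `[< Om x >] then H (x, 1 - s x) - y
            else if g x < c1 then x - y else x0 - y.
have GOm x : Om x -> G x = H (x, 1 - s x) - y by move=> Ox; rewrite /G asboolT.
have GnOm x : ~ Om x -> G x = if g x < c1 then x - y else x0 - y.
  by move=> Ox; rewrite /G asboolF.
have corner : cube M (const_mx M) by move=> k; rewrite mxE ger0_norm// ltW.
have g_face x j w : `|w| = M -> cube M x -> x 0 j = w -> g x = 0.
  by move=> wM Mx xj; rewrite /g (face_constant wM Mx xj) subrr normr0.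
have db : 0 <= b - d.
  have gc : g (const_mx M) = 0 by rewrite /g subrr normr0.
  rewrite -gc; apply: hd => //; last by rewrite gc.
  by move=> /OmM/(_ 0); rewrite mxE ger0_norm ?ltW// ltxx.
have c1_gt0 : 0 < c1 by rewrite /c1; lra.
have nOface x j w : `|w| = M -> x 0 j = w -> ~ Om x.
  by move=> wM xj /OmM/(_ j); rewrite xj wM ltxx.
have Gface x j w : `|w| = M -> cube M x -> x 0 j = w -> G x = x - y.
  move=> wM Mx xj; rewrite GnOm; last exact: nOface wM xj.
  by rewrite (g_face _ _ _ wM Mx xj) c1_gt0.
(* Where g < c1, x is not y because g y = b. *)
have G_neq0 z : G z != 0.
  have [Oz|nOz] := pselect (Om z).
    rewrite GOm// subr_eq0; apply/eqP => h; apply: nOy; rewrite -h.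
    exact: HOm.
  rewrite GnOm//; case: ifPn => h; rewrite subr_eq0; apply/eqP => E.
    by move: h; rewrite E -/b /c1; lra.
  by apply: nOy; rewrite -E.
have cG z : cube M z -> forall j (e : R), 0 < e ->
    \forall x \near z, cube M x -> `|G x 0 j - G z 0 j| < e.
  move=> Mz j e e0; have [Oz|nOz] := pselect (Om z).
    have nO : nbhs z Om by exact: (open_nbhs_nbhs (conj oOm Oz)).
    have nM : \forall x \near z, cube M x.
      by apply: filterS nO => x Ox k; apply: ltW; exact: OmM.
    (* Inside Om: continuity of the cutoff and of the contraction. *)
    pose k (t : R) : R := 1 - Num.min 1 (Num.max 0 ((t - c1) / (d / 3))).
    have ck : continuous k.
      have cm : continuous (fun t : R => (t - c1) / (d / 3)).
        move=> t; apply: cvgM; last exact: cvg_cst.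
        by apply: cvgB; [exact: cvg_id|exact: cvg_cst].
      move=> t; apply: cvgB; first exact: cvg_cst.
      apply: (@continuous_min _ _ (cst 1) (fun t => Num.max 0 ((t - c1) / (d / 3)))).
        exact: cst_continuous.
      apply: (@continuous_max _ _ (cst 0) (fun t => (t - c1) / (d / 3))).
        exact: cst_continuous.
      exact: cm.
    have cs (P : set R) : nbhs (1 - s z) P -> \forall x \near z, P (1 - s x).
      move=> /(ck (g z)) /nbhs_ballP[e' /= e'0 hP].
      have := cg z Mz e' e'0; apply: filterS2 nM => x Mx /(_ Mx) h.
      by apply: hP; rewrite /ball/= distrC.
    have cp (P : set ('rV[R]_3 * R)) : nbhs (z, 1 - s z) P ->
        \forall x \near z, P (x, 1 - s x).
      case=> -[A B] [/= nA nB] hAB; apply: filterS2 nA (cs B nB) => x Ax Bx.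
      exact: hAB.
    move/subspace_continuousP: cH => /(_ (z, 1 - s z)) cHz.
    have {}cHz := cHz (conj Oz (s01 z)).
    have {}cHz : \forall x \near z, forall j,
        `|H (x, 1 - s x) 0 j - H (z, 1 - s z) 0 j| < e.
      have := cHz _ (near_ball (H (z, 1 - s z)) e0).
      move=> hw; have := cp _ hw.
      apply: filterS2 nO => x Ox; apply; split=> //=.
      by rewrite in_itv/=; exact: s01.
    apply: filterS2 nO cHz => x Ox hx _.
    by rewrite !GOm// !mxE opprB addrA subrK; exact: hx.
  (* Outside Om the gap puts z strictly below or strictly above the band, and the
     formulas inside and outside Om agree there. *)
  have [gz|gz] := ltP (g z) b.
    have gz1 : g z < c1 by rewrite (le_lt_trans (hd z Mz nOz gz))// /c1; lra.
    have e1 : 0 < c1 - g z by rewrite subr_gt0.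
    have := cg z Mz _ e1; apply: filterS2 (near_ball z e0) => x hx h Mx.
    have gx : g x < c1 by have := h Mx; rewrite ltr_distl => /andP[_]; lra.
    rewrite [G z]GnOm// gz1.
    have -> : G x = x - y.
      have [Ox|nOx] := pselect (Om x); last by rewrite GnOm// gx.
      by rewrite GOm// s_lo// subr0 H1.
    by rewrite !mxE opprB addrA subrK; exact: hx.
  have gz2 : c2 < g z by rewrite (lt_le_trans _ gz)// /c2; lra.
  have e1 : 0 < g z - c2 by rewrite subr_gt0.
  have := cg z Mz _ e1; apply: filterS => x h Mx.
  have gx : c2 < g x by have := h Mx; rewrite ltr_distl => /andP[+ _]; lra.
  have nlt v : c2 < g v -> (g v < c1) = false.
    by move=> hv; apply/negbTE; rewrite -leNgt; move: hv; rewrite /c1 /c2; lra.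
  rewrite [G z]GnOm// nlt//.
  have -> : G x = x0 - y.
    have [Ox|nOx] := pselect (Om x); last by rewrite GnOm// nlt.
    by rewrite GOm// s_hi// subrr H0.
  by rewrite subrr normr0.
have [||z Mz hz] := @poincare_miranda R M (fun j x => 0 < G x 0 j) M0.
- move=> j x Mx xj; rewrite (Gface _ _ _ _ Mx xj) ?normrN ?gtr0_norm//.
  rewrite !mxE xj -leNgt subr_le0; have := My j; rewrite ler_norml.
  by case/andP.
- move=> j x Mx xj; rewrite (Gface _ _ _ _ Mx xj) ?gtr0_norm//.
  rewrite !mxE xj subr_gt0; have := My' j; rewrite ltr_norml.
  by case/andP.
have [j Gj] : exists j, G z 0 j != 0.
  apply: contrapT => /forallNP h; have /negP := G_neq0 z; apply; apply/eqP.
  by apply/rowP => k; rewrite mxE; apply/eqP; apply: contraT => /(h k).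
apply: (hz j).
have e0 : 0 < `|G z 0 j| by rewrite normr_gt0.
have := cG z Mz j _ e0; apply: filterS => x h /h.
move: Gj; rewrite neq_lt => /orP[G0|G0].
  rewrite (ltr0_norm G0) ltr_distl => /andP[_ hx].
  by rewrite [RHS]ltNge ltW//=; apply/negbTE; rewrite -leNgt; move: hx; lra.
rewrite (gtr0_norm G0) ltr_distl => /andP[hx _].
by rewrite G0; move: hx; rewrite subrr.
Qed.
End Contractible.

(** * The L^2 inner product *)

Section L2InnerProduct.
Variable R : realType.
Local Notation mu3 := (@lebesgue3 R).
Variable Om : set 'rV[R]_3.
Hypothesis oOm : open Om.
Local Notation R3 :=
  (measurableTypeR R * measurableTypeR R * measurableTypeR R)%type.
Local Notation D := (@pt R @^-1` Om : set R3).
Implicit Types (f g : 'rV[R]_3 -> R) (v w : 'rV[R]_3 -> 'rV[R]_3).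

Lemma measurable_domain : measurable D.
Proof. exact: measurable_pt_open. Qed.
Hint Resolve measurable_domain : core.

(** |f g| <= f^2 + g^2. *)
Lemma L2_mul_integrable f g : L2 Om f -> L2 Om g ->
  mu3.-integrable D (EFin \o (fun t => f (pt t) * g (pt t))).
Proof.
move=> [mf if2] [mg ig2].
have mf' : measurable_fun D (fun t : R3 => f (pt t)) := mf.
have mg' : measurable_fun D (fun t : R3 => g (pt t)) := mg.
have h : mu3.-integrable D (EFin \o (fun t => f (pt t) ^+ 2 + g (pt t) ^+ 2)).
  have := integrableD measurable_domain if2 ig2.
  by apply: eq_integrable => // t _; rewrite /= EFinD.
apply: (le_integrable measurable_domain _ _ h).
  by apply/measurable_EFinP; apply: measurable_funM.
move=> t _; rewrite /= lee_fin.
rewrite [leRHS]ger0_norm ?addr_ge0 ?sqr_ge0//.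
by rewrite ler_norml; apply/andP; split; nra.
Qed.

Lemma L2_add f g : L2 Om f -> L2 Om g -> L2 Om (fun x => f x + g x).
Proof.
move=> Lf Lg; have [mf if2] := Lf; have [mg ig2] := Lg; split.
  exact: measurable_funD.
have ifg := L2_mul_integrable Lf Lg.
have := integrableD measurable_domain (integrableD measurable_domain if2 ig2)
  (integrableD measurable_domain ifg ifg).
apply: eq_integrable => // t _; rewrite /= -!EFinD; congr EFin; ring.
Qed.

Lemma L2v_add v w : L2v Om v -> L2v Om w -> L2v Om (fun x => v x + w x).
Proof.
move=> Lv Lw j; have := L2_add (Lv j) (Lw j).
by rewrite (_ : (fun x => (v x + w x) 0 j) = fun x => v x 0 j + w x 0 j)//;
  apply: funext => x; rewrite mxE.
Qed.

Lemma dot_integrable v w : L2v Om v -> L2v Om w ->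
  mu3.-integrable D (EFin \o (fun t => dot (v (pt t)) (w (pt t)))).
Proof.
move=> Lv Lw; have h j := L2_mul_integrable (Lv j) (Lw j).
have := integrableD measurable_domain (integrableD measurable_domain (h 0) (h 1)) (h 2).
by apply: eq_integrable => // t _; rewrite /= dot3 !EFinD.
Qed.

Lemma ip_addr v w w' : L2v Om v -> L2v Om w -> L2v Om w' ->
  ip Om v (fun x => w x + w' x) = ip Om v w + ip Om v w'.
Proof.
move=> Lv Lw Lw'; rewrite /ip.
rewrite -(RintegralD measurable_domain (dot_integrable Lv Lw) (dot_integrable Lv Lw')).
by apply: eq_Rintegral => t _; rewrite dotDr.
Qed.

Lemma ip_ge0 v : 0 <= ip Om v v.
Proof. by apply: Rintegral_ge0 => t _; exact: dotxx_ge0. Qed.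

Lemma ip_eq0 v : L2v Om v -> ip Om v v = 0 ->
  {ae mu3, forall t, Om (pt t) -> v (pt t) = 0}.
Proof.
move=> Lv v0; have iv := dot_integrable Lv Lv.
have fi : (\int[mu3]_(t in D) (dot (v (pt t)) (v (pt t)))%:E = 0)%E.
  have := integrable_fin_num measurable_domain iv => /fineK <-.
  by congr EFin; exact: v0.
have mv : measurable_fun D (EFin \o (fun t => dot (v (pt t)) (v (pt t)))).
  by case/integrableP: iv.
have : ae_eq mu3 D (EFin \o (fun t => dot (v (pt t)) (v (pt t)))) (cst 0%E).
  apply/(ae_eq_integral_abs mu3 measurable_domain mv).
  rewrite -[RHS]fi; apply: eq_integral => t _.
  by rewrite /= ger0_norm// dotxx_ge0.
by apply: filterS => t h Ot; apply: dotxx_eq0; case: (h Ot).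
Qed.

Lemma ip_ae0 v w : {ae mu3, forall t, Om (pt t) -> v (pt t) = 0} ->
  L2v Om v -> (forall j, continuous (fun x => w x 0 j)) -> ip Om v w = 0.
Proof.
move=> v0 Lv cw; rewrite /ip /Rintegral.
rewrite (@ae_eq_integral _ _ _ mu3 D (cst 0%E)
  (EFin \o (fun t => dot (v (pt t)) (w (pt t)))) measurable_domain)//.
- by rewrite integral0.
- apply/measurable_EFinP.
  rewrite (_ : (fun t => _) = fun t => v (pt t) 0 0 * w (pt t) 0 0 +
     v (pt t) 0 1 * w (pt t) 0 1 + v (pt t) 0 2 * w (pt t) 0 2); last first.
    by apply: funext => t; rewrite dot3.
  have mw j : measurable_fun D (fun t => w (pt t) 0 j).
    exact: measurable_funS (measurable_pt_continuous (cw j)).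
  have mv j : measurable_fun D (fun t => v (pt t) 0 j) by case: (Lv j).
  by do 2?apply: measurable_funD; apply: measurable_funM.
- case: v0 => N [mN N0 sN]; exists N; split=> // t /= ht; apply: sN => /= h.
  by apply: ht => /h ->; rewrite dot0l.
Qed.
End L2InnerProduct.

(** * Curl-free finite element fields are discrete gradients *)

Section DiscretePotential.
Variable R : realType.
Implicit Types (K : 'M[R]_(4, 3)) (x y z : 'rV[R]_3).

Variables (Om : set 'rV[R]_3) (T : seq 'M[R]_(4, 3)) (r : nat).
Variables (u cu : 'rV[R]_3 -> 'rV[R]_3).
Hypotheses (hpoly : polyhedron Om) (hcontr : contractible R Om).
Hypotheses (hlip : lipschitz_boundary Om) (hT : tetrahedral_mesh Om T).
Hypotheses (hu : X_space Om T r u) (ucu : is_curl Om u cu).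
Hypothesis cu0 : forall phi, test_field Om phi -> ip Om cu phi = 0.

(** A polynomial field whose weak curl vanishes in an open part of the element
    has symmetric partial derivatives, as polynomials, and is thus a gradient
    on the whole element. *)
Lemma element_potential K : K \in T -> exists e,
  degree_le r.+1 e /\
  forall x l, tetra K x -> peval r.+2 (pdiff l e) x = u x 0 l.
Proof.
move=> KT; have [oOm _ _] := hpoly; have [clT ndT _] := hT.
have [_ _ hK] := hu.
have /choice[c hc] : forall j, exists c, degree_le r c /\
    forall x, tetra K x -> u x 0 j = peval r.+2 c x.
  move=> j; have [c dc hc] := poly_onP (hK K KT j).
  by exists c; split=> // x Kx; apply: hc.
have dc j : degree_le r (c j) by case: (hc j).
have uE j x : tetra K x -> u x 0 j = peval r.+2 (c j) x by case: (hc j) => _; exact.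
have [V [oV V0 VK]] := tetra_interior (ndT K KT).
have VOm : V `<=` Om.
  apply: subset_trans (lipschitz_interior oOm hlip).
  have Vcl : V `<=` closure Om.
    by move=> x /VK Kx; rewrite clT; exists K.
  by rewrite -(open_subsetE _ oV).
(* The range r.+2 of exponents is that of the potential, of degree r.+1. *)
have curl0 := curl_free_peval (n := r.+2) (c := c)
  (fun j => degree_leW (leqnSn r) (dc j)) oV VOm (fun x j Vx => uE j x (VK x Vx)) ucu cu0.
have sym (l l' : 'I_3) : (forall x, V x ->
     peval r.+2 (pdiff l (c l')) x = peval r.+2 (pdiff l' (c l)) x) ->
   forall i j k, pdiff l (c l') i j k = pdiff l' (c l) i j k.
  move=> h i j k.
  have [lt|le] := ltnP (i + j + k) r.+2; last first.
    by rewrite !(@pdiff_degree _ r)// ltnW// ltnW.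
  apply/eqP; rewrite -subr_eq0; apply/eqP.
  apply: (peval_eq0 (n := r.+2)
    (c := fun i j k => pdiff l (c l') i j k + - pdiff l' (c l) i j k) oV V0).
  - move=> x Vx; rewrite (pevalD _ (pdiff l (c l')) (fun i j k => - pdiff l' (c l) i j k)).
    by rewrite pevalN h// subrr.
  - by rewrite (leq_ltn_trans _ lt)// -addnA leq_addr.
  - by rewrite (leq_ltn_trans _ lt)// addnAC leq_addl.
  - by rewrite (leq_ltn_trans _ lt)// leq_addl.
exists (potential c); split; first exact: potential_degree.
move=> x l Kx; rewrite (uE l x Kx); apply: eq_bigr => i _; apply: eq_bigr => j _.
apply: eq_bigr => k _; rewrite pdiff_potential//.
- apply: sym => y Vy; have := curl0 2 y Vy; rewrite !ord3_add; exact: esym.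
- by apply: sym => y Vy; have := curl0 1 y Vy; rewrite !ord3_add.
- by apply: sym => y Vy; have := curl0 0 y Vy; rewrite !ord3_add.
Qed.

(** The primitive of u on a large cube, made zero outside Om by subtracting the
    value that it takes there. On each element it differs from the potential of
    the element by a constant, hence it is polynomial of degree r.+1. *)
Lemma discrete_potential : exists q, Y_space Om T r q /\ is_grad Om q u.
Proof.
have [oOm bOm [m1 [m2 [a [b clOm]]]]] := hpoly; have [clT ndT _] := hT.
have [cuc [Lu _ tru] _] := hu.
have /choice[e he] : forall K, exists e, K \in T -> degree_le r.+1 e /\
    forall x l, tetra K x -> peval r.+2 (pdiff l e) x = u x 0 l.
  move=> K; have [KT|KT] := boolP (K \in T); last by exists (fun _ _ _ => 0).
  by have [e he] := element_potential KT; exists e.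
have deg_e K : K \in T -> degree_le r.+2.-1 (e K) by move=> /he[].
have grad_e K x l : K \in T -> tetra K x -> peval r.+2 (pdiff l (e K)) x = u x 0 l.
  by move=> /he[_]; exact.
have clC : closure Om = constraints a b by [].
have intC : (constraints a b)° `<=` Om.
  by rewrite -clC; exact: lipschitz_interior.
have CT : constraints a b = \bigcup_(K in [set` T]) tetra K by rewrite -clC.
have [M M0 OmM] : exists2 M : R, 0 < M & forall x, closure Om x -> forall j, `|x 0 j| < M.
  have [M0 [_ hM]] := bOm.
  have hM1 x : Om x -> forall j, `|x 0 j| <= `|M0| + 1.
    move=> Ox j; have := hM (`|M0| + 1) _ x Ox.
    rewrite (le_lt_trans (ler_norm M0)) ?ltrDl// => /(_ isT); apply: le_trans.
    rewrite [leRHS]/Num.norm/= mx_normrE.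
    exact: (le_bigmax _ (fun k : 'I_1 * 'I_3 => `|x k.1 k.2|) (0, j)).
  exists (`|M0| + 2) => [|x clx j]; first by rewrite ltr_wpDl.
  have [y [Oy hy]] := clx _ (near_ball x (@ltr01 R)).
  rewrite -[x 0 j](subrK (y 0 j)) (le_lt_trans (ler_normD _ _))//.
  have := hM1 y Oy j; have := hy j; rewrite distrC; lra.
have subcl x : Om x -> closure Om x by exact: subset_closure.
have cocycle := increment_cocycle oOm clC intC cuc tru CT ndT deg_e grad_e.
have [f primf] := primitive_on_cube cocycle M.
have OmC : Om `<=` cube M by move=> x /subcl /OmM h j; exact/ltW/h.
have cf := primitive_continuous deg_e grad_e primf.
have lf := primitive_locally_constant oOm clC intC cuc tru CT deg_e grad_e primf.
have df := primitive_derive oOm clC CT ndT deg_e grad_e primf OmC.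
have pf := primitive_poly deg_e grad_e primf.
have fout := constant_outside oOm (fun x Ox => OmM x (subcl x Ox)) hcontr cf lf.
pose c0 := f (const_mx M).
have clM x : closure Om x -> cube M x by move=> clx j; exact/ltW/OmM.
have cq z : cube M z -> forall eps : R, 0 < eps ->
    \forall x \near z, cube M x -> `|(f z - c0) - (f x - c0)| < eps.
  move=> Mz eps eps0; apply: filterS (cf z Mz eps eps0) => x h /h.
  by rewrite opprB addrA subrK distrC.
exists (fun x => f x - c0); split; first split.
- apply/subspace_continuousP => z clz P /nbhs_ballP[eps /= eps0 hP].
  apply: filterS (cq z (clM z clz) eps eps0) => x h clx.
  by apply: hP; exact: h (clM x clx).
- move=> K KT; have KM : tetra K `<=` cube M.
    by move=> x Kx; apply: clM; rewrite clT; exists K.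
  have [s hs] := pf K KT KM.
  apply: (@degree_le_poly_on _ _ (fun i j k => e K i j k + const_coef (s - c0) i j k)).
    move=> i j k h; rewrite deg_e// add0r /const_coef ifF//.
    by apply/negbTE; rewrite -lt0n (leq_ltn_trans _ h).
  by move=> x Kx; rewrite pevalD peval_const hs// addrA.
- move=> x [clx nOx]; rewrite fout ?subrr//; first exact: clM.
  by move=> Ox; apply: nOx; exact: (open_nbhs_nbhs (conj oOm Ox)).
- apply: is_grad_of_partials => //.
  + move=> z Oz P /nbhs_ballP[eps /= eps0 hP].
    have nO : \forall y \near z, Om y by exact: (open_nbhs_nbhs (conj oOm Oz)).
    apply: filterS2 nO (cq z (OmC z Oz) eps eps0) => x Ox h.
    by apply: hP; exact: h (OmC x Ox).
  + move=> z Oz i.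
    move/subspace_continuousP : cuc => /(_ z (subcl z Oz)) cuz P hP.
    have hU : nbhs (u z) [set y : 'rV[R]_3 | P (y 0 i)].
      exact: (@coord_continuous R 1 3 0 i (u z) P hP).
    have nO : \forall y \near z, Om y by exact: (open_nbhs_nbhs (conj oOm Oz)).
    by apply: filterS2 nO (cuz _ hU) => x Ox; apply; exact: subcl.
  + move=> x Ox i; have dfx := df x i Ox.
    have H := is_deriveB dfx (is_derive_cst c0 x (delta_mx 0 i)).
    by apply: (is_derive_eq H); rewrite subr0.
Qed.
End DiscretePotential.

Theorem theorem3p3 (R : realType) (Omega : set 'rV[R]_3)
    (hpoly : polyhedron Omega) (hcontr : contractible R Omega)
    (hlip : lipschitz_boundary Omega)
    (r : nat) (hr : (0 < r)%N)
    (I : Type) (T : I -> seq 'M[R]_(4, 3)) (hT : regular_family Omega T)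
    (i : I) (lambda : R) :
  discrete_eigenvalue Omega (T i) r lambda -> 0 < lambda.
Proof.
move=> [u [p [hu hp [cu [gp [ucu pgp nz ev orth]]]]]].
have [oOm _ _] := hpoly; have [hmesh _ _] := hT.
have Lu : L2v Omega u by case: hu => _ [].
have Lcu : L2v Omega cu by case: ucu.
have Lgp : L2v Omega gp by case: pgp.
pose w x := u x + gp x.
have Lw : L2v Omega w by exact: L2v_add.
have ww : ip Omega w w = ip Omega w u.
  by rewrite {2}/w (ip_addr oOm Lw Lu Lgp) (orth p gp hp pgp) addr0.
have energy : ip Omega cu cu = lambda * ip Omega w w.
  by rewrite ww; exact: ev hu ucu.
rewrite ltNge; apply/negP => lambda_le0.
have cc0 : ip Omega cu cu = 0.
  apply/eqP; rewrite eq_le ip_ge0 andbT energy.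
  by rewrite mulr_le0_ge0// ip_ge0.
have cu_ae0 := ip_eq0 oOm Lcu cc0.
have cu_test phi : test_field Omega phi -> ip Omega cu phi = 0.
  by move=> [sphi _]; apply: ip_ae0 => // j; exact: (sphi 0%N j).
have [q [Yq gq]] := discrete_potential hpoly hcontr hlip (hmesh i) hu ucu cu_test.
(* Since u is the gradient of q, w is orthogonal to u, hence to itself. *)
apply: nz; apply: (ip_eq0 oOm Lw).
by rewrite ww; exact: orth Yq gq.
Qed.
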